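(* Consider the three-dimensional action $$I=\frac{1}{16\pi G_N}\int d^3x\sqrt{-g}\Big[R+\frac{2}{L^2}-\mathcal{Q}\Big],$$ $$\mathcal{Q}=\sum_{n\ge1}\alpha_nL^{2(n-1)}(\partial\phi)^{2n}-\sum_{m\ge0}\beta_mL^{2(m+1)}(\partial\phi)^{2m}\big[(3+2m)R^{bc}\partial_b\phi\,\partial_c\phi-(\partial\phi)^2R\big],$$ with a real scalar field $\phi$ and arbitrary real constants $\alpha_n,\beta_m$ (finitely many nonzero). For any constants $p$ and $\mu$, the configuration $$ds^2=-f(r)\,dt^2+\frac{dr^2}{f(r)}+r^2d\theta^2,\qquad \phi=p\,\theta,$$ $$f(r)=\frac{\displaystyle\frac{r^2}{L^2}-\mu-\alpha_1p^2\log\frac rL+\sum_{n\ge2}\frac{\alpha_np^{2n}L^{2(n-1)}}{2(n-1)r^{2(n-1)}}}{\displaystyle1+\sum_{m\ge0}\frac{\beta_mp^{2(m+1)}(2m+1)L^{2(m+1)}}{r^{2(m+1)}}}$$ solves all the field equations of the theory (those of the metric and of $\phi$) wherever $f$ is finite and nonzero.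
   Context: $(\partial\phi)^2=g^{ab}\partial_a\phi\,\partial_b\phi$ and $(\partial\phi)^{2n}=[(\partial\phi)^2]^n$. $R_{ab}$ is the Ricci tensor and $R$ the Ricci scalar of $g_{ab}$, signature $(-,+,+)$. The field equations are $\delta I/\delta g^{ab}=0$ and $\delta I/\delta\phi=0$; $L>0$ is a length scale. *)

(* Defs.v *)
From Stdlib Require Import Reals.
From Coquelicot Require Import Coquelicot.

Open Scope R_scope.

(** * Fields on the coordinate space (t, r, theta) *)

Inductive coord : Set := ct | cr | cth.

Definition sum3 (F : coord -> R) : R := F ct + F cr + F cth.

Definition field := R -> R -> R -> R.
Definition tensor2 := coord -> coord -> field.

Definition partial (c : coord) (F : field) : field := fun t r th =>
  match c with
  | ct => Derive (fun s => F s r th) t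
  | cr => Derive (fun s => F t s th) r
  | cth => Derive (fun s => F t r s) th
  end.

Definition ex_partial (c : coord) (F : field) (t r th : R) : Prop :=
  match c with
  | ct => ex_derive (fun s => F s r th) t
  | cr => ex_derive (fun s => F t s th) r
  | cth => ex_derive (fun s => F t r s) th
  end.

Definition partials (l : list coord) (F : field) : field :=
  List.fold_right partial F l.

(* C^infinity on the whole of R^3: all iterated partial derivatives exist and
   are jointly continuous. *)
Definition smooth (F : field) : Prop :=
  forall (l : list coord) (t r th : R),
    continuous (fun x : R * R * R => partials l F (fst (fst x)) (snd (fst x)) (snd x))
      (t, r, th) /\
    forall c, ex_partial c (partials l F) t r th.

(** * Metric geometry; metrics are given by their lower components g_{ab} *)

Definition next (c : coord) : coord :=
  match c with ct => cr | cr => cth | cth => ct end.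

(* With cyclic indices the 2x2 minor already carries the cofactor sign. *)
Definition cofactor (g : tensor2) (a b : coord) : field := fun t r th =>
  g (next a) (next b) t r th * g (next (next a)) (next (next b)) t r th
  - g (next a) (next (next b)) t r th * g (next (next a)) (next b) t r th.

Definition determinant (g : tensor2) : field := fun t r th =>
  sum3 (fun b => g ct b t r th * cofactor g ct b t r th).

Definition inverse (g : tensor2) : tensor2 := fun a b t r th =>
  cofactor g b a t r th / determinant g t r th.

(* christoffel g a b c is Gamma^a_{bc}. *)
Definition christoffel (g : tensor2) (a b c : coord) : field := fun t r th =>
  / 2 * sum3 (fun d => inverse g a d t r th *
    (partial b (g d c) t r th + partial c (g d b) t r th
     - partial d (g b c) t r th)).

(* Sign convention: R_{ab} = d_c Gamma^c_{ab} - ..., positive on round spheres. *)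
Definition ricci (g : tensor2) : tensor2 := fun a b t r th =>
  sum3 (fun c =>
    partial c (christoffel g c a b) t r th
    - partial b (christoffel g c a c) t r th
    + sum3 (fun d =>
        christoffel g c c d t r th * christoffel g d a b t r th
        - christoffel g c b d t r th * christoffel g d a c t r th)).

Definition scalar_curvature (g : tensor2) : field := fun t r th =>
  sum3 (fun a => sum3 (fun b => inverse g a b t r th * ricci g a b t r th)).

(* d^a phi *)
Definition gradient (g : tensor2) (phi : field) (a : coord) : field :=
  fun t r th => sum3 (fun b => inverse g a b t r th * partial b phi t r th).

(* (d phi)^2 *)
Definition kinetic (g : tensor2) (phi : field) : field := fun t r th =>
  sum3 (fun a => sum3 (fun b =>
    inverse g a b t r th * partial a phi t r th * partial b phi t r th)).

(* R^{bc} d_b phi d_c phi *)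
Definition ricci_gradient (g : tensor2) (phi : field) : field := fun t r th =>
  sum3 (fun b => sum3 (fun c =>
    ricci g b c t r th * gradient g phi b t r th * gradient g phi c t r th)).

(** * The theory *)

(* G is Newton's constant.  The values of alpha at indices n >= 1 and of beta
   at indices m >= 0 are the couplings; they vanish beyond N, resp. M, so that
   the sums below, truncated there, are the full ones. *)
Record theory := Theory {
  G : R;
  L : R;
  alpha : nat -> R;
  beta : nat -> R;
  N : nat;
  M : nat;
  G_neq0 : G <> 0;
  L_gt0 : 0 < L;
  alpha_finite : forall n, (N < n)%nat -> alpha n = 0;
  beta_finite : forall m, (M < m)%nat -> beta m = 0
}.

Definition Qterm (T : theory) (g : tensor2) (phi : field) : field :=
  fun t r th =>
    let X := kinetic g phi t r th in
    sum_n_m (fun n => alpha T n * L T ^ (2 * (n - 1)) * X ^ n) 1 (N T)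
    - sum_n_m (fun m => beta T m * L T ^ (2 * (m + 1)) * X ^ m *
        ((3 + 2 * INR m) * ricci_gradient g phi t r th
         - X * scalar_curvature g t r th)) 0 (M T).

Definition lagrangian (T : theory) (g : tensor2) (phi : field) : field :=
  fun t r th =>
    / (16 * PI * G T) *
    (sqrt (- determinant g t r th) *
     (scalar_curvature g t r th + 2 / L T ^ 2 - Qterm T g phi t r th)).

Record box := Box { t0 : R; t1 : R; r0 : R; r1 : R; th0 : R; th1 : R }.

Definition in_box (B : box) (t r th : R) : Prop :=
  t0 B <= t <= t1 B /\ r0 B <= r <= r1 B /\ th0 B <= th <= th1 B.

Definition box_in (B : box) (U : R -> R -> R -> Prop) : Prop :=
  t0 B < t1 B /\ r0 B < r1 B /\ th0 B < th1 B /\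
  forall t r th, in_box B t r th -> U t r th.

Definition box_integral (B : box) (F : field) : R :=
  RInt (fun t => RInt (fun r => RInt (fun th => F t r th)
    (th0 B) (th1 B)) (r0 B) (r1 B)) (t0 B) (t1 B).

Definition action (T : theory) (B : box) (g : tensor2) (phi : field) : R :=
  box_integral B (lagrangian T g phi).

(** * Field equations *)

Definition test_function (B : box) (eta : field) : Prop :=
  smooth eta /\ forall t r th, ~ in_box B t r th -> eta t r th = 0.

(* The metric with inverse g^{ab} + eps k^{ab}. *)
Definition vary_metric (g k : tensor2) (eps : R) : tensor2 :=
  inverse (fun a b t r th => inverse g a b t r th + eps * k a b t r th).

Definition vary_scalar (phi psi : field) (eps : R) : field :=
  fun t r th => phi t r th + eps * psi t r th.

(* delta I / delta g^{ab} = E_{ab} on U, as a functional derivative: E is the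
   density representing the first variation of the action under compactly
   supported variations of the inverse metric.  Testing on boxes inside U
   loses nothing, as functional derivatives of a local action are local. *)
Definition is_metric_functional_derivative (T : theory)
    (U : R -> R -> R -> Prop) (g : tensor2) (phi : field) (E : tensor2) : Prop :=
  forall (B : box) (k : tensor2),
    box_in B U ->
    (forall a b, test_function B (k a b)) ->
    (forall a b t r th, k a b t r th = k b a t r th) ->
    is_derive (fun eps : R => action T B (vary_metric g k eps) phi) 0
      (box_integral B (fun t r th =>
        sum3 (fun a => sum3 (fun b => E a b t r th * k a b t r th)))).

(* delta I / delta phi = E on U. *)
Definition is_scalar_functional_derivative (T : theory)
    (U : R -> R -> R -> Prop) (g : tensor2) (phi : field) (E : field) : Prop :=
  forall (B : box) (psi : field),
    box_in B U ->
    test_function B psi ->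
    is_derive (fun eps : R => action T B g (vary_scalar phi psi eps)) 0
      (box_integral B (fun t r th => E t r th * psi t r th)).

Definition solves_field_equations (T : theory) (U : R -> R -> R -> Prop)
    (g : tensor2) (phi : field) : Prop :=
  is_metric_functional_derivative T U g phi (fun _ _ _ _ _ => 0) /\
  is_scalar_functional_derivative T U g phi (fun _ _ _ => 0).

(** * The configuration *)

(* ds^2 = - f dt^2 + dr^2 / f + r^2 dtheta^2 *)
Definition static_metric (f : R -> R) : tensor2 := fun a b t r th =>
  match a, b with
  | ct, ct => - f r
  | cr, cr => / f r
  | cth, cth => r ^ 2
  | _, _ => 0
  end.

(* theta is a local angular coordinate, ranging over R. *)
Definition angular_scalar (p : R) : field := fun _ _ th => p * th.

Definition f_numerator (T : theory) (p mu r : R) : R :=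
  r ^ 2 / L T ^ 2 - mu - alpha T 1 * p ^ 2 * ln (r / L T)
  + sum_n_m (fun n => alpha T n * p ^ (2 * n) * L T ^ (2 * (n - 1)) /
      (2 * INR (n - 1) * r ^ (2 * (n - 1)))) 2 (N T).

Definition f_denominator (T : theory) (p r : R) : R :=
  1 + sum_n_m (fun m => beta T m * p ^ (2 * (m + 1)) * (2 * INR m + 1) *
      L T ^ (2 * (m + 1)) / r ^ (2 * (m + 1))) 0 (M T).

Definition f_solution (T : theory) (p mu r : R) : R :=
  f_numerator T p mu r / f_denominator T p r.

(* Where the radial coordinate is positive and f is finite and nonzero. *)
Definition regular_region (T : theory) (p mu : R) : R -> R -> R -> Prop :=
  fun _ r _ => 0 < r /\ f_denominator T p r <> 0 /\ f_solution T p mu r <> 0.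

(* Main.v *)
Require Import Defs.
From Stdlib Require Import Reals.
From Coquelicot Require Import Coquelicot.
From Stdlib Require Import Lra Lia Classical ClassicalEpsilon FunctionalExtensionality.

(* Let g be the static metric.  Inverse metrics h + e k with k compactly
   supported, and everything built from them, expand as A0 + e A1 + O(e^2)
   uniformly in space, and the expansion may be differentiated in space; such
   expansions are closed under the field operations.  Hence the action is
   differentiable at e = 0 and its derivative is the integral of the first order
   term of the Lagrangian, which is explicit in k, the varied connection and the
   derivatives of the latter.  With X = p^2 / r^2 the coefficient of the varied
   Ricci tensor is diagonal and depends on r only, so two integrations by parts
   exhibit the first order term as the divergence of a compactly supported flux,
   up to multiples of k^tt, k^rr, k^thth.  These cancel thanks to the single
   equation (D f)' = 2 r / L^2 - r P(X), D the denominator of f and P(X) the sum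
   of the alpha terms, together with its r-derivative: this is what the explicit
   f solves.  For the scalar equation the first order term is a function of r
   times d_theta psi, whose integral over theta vanishes. *)

Open Scope R_scope.

(** * Integrals over boxes *)

(** The field equations are posed through the derivative at [eps = 0] of an actual iterated
    integral, not through Euler-Lagrange expressions, and the integrand contains second derivatives
    of a matrix inverse depending on [eps]. This fixes the budget of derivatives in the expansions:
    two for the metric, one for the connection, none for the Ricci tensor. The estimates live on
    slabs [a < r < b], unbounded in t and theta: the background tensors depend on r alone and the
    variations have compact support, while in r a margin around the closed box is needed. As fields
    are controlled on the slab only, they are clamped in r or extended by zero before being
    integrated. The coefficient of the Ricci tensor is diagonal because phi depends on theta alone:
    the beta terms rescale the inverse metric by [1 - S0] and add [(3 S0 + 2 S1) / r^2] to the thth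
    entry, [S0] and [S1] being moments of the couplings. The first flux is the Palatini current for
    this coefficient; the second is read off from the derivatives of k that remain. The alpha sums
    enter in two ways only, through the volume variation and the variation of X, so two equations
    eliminate them. *)

(** A Lebesgue number argument along the segment [[a, b]], uniform in a parameter near [x0]. The
    last argument of [P] is fed with [/ d]: one radius [d] then delivers uniform closeness, when [P]
    ignores it, and boundedness, when [P] reads it as a constant. *)
Lemma tube {T : UniformSpace} (P : T -> R -> R -> Prop) (x0 : T) (a b : R) :
  (forall x s C C', C <= C' -> P x s C -> P x s C') ->
  (forall s, a <= s <= b -> exists d : posreal,
     forall x s', ball x0 d x -> Rabs (s' - s) < d -> P x s' (/ d)) ->
  exists d : posreal,
    forall x s, ball x0 d x -> a <= s <= b -> P x s (/ d).
Proof.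
  intros mono loc.
  assert (H : forall s, exists d : posreal, a <= s <= b ->
     forall x s', ball x0 d x -> Rabs (s' - s) < d -> P x s' (/ d)).
  { intros s. destruct (classic (a <= s <= b)) as [Hs|Hs].
    - destruct (loc s Hs) as [d Hd]. exists d; auto.
    - exists (mkposreal 1 Rlt_0_1); tauto. }
  pose (delta := fun s => proj1_sig (constructive_indefinite_description _ (H s))).
  (* For each [s] this yields a nearby [t] whose local radius [delta t] is at least [d], but only up
     to double negation, whence [NNPP]. *)
  destruct (compactness_value_1d a b delta) as [d Hd].
  exists d. intros x s Hx Hs.
  apply NNPP; intros Hn. apply (Hd s Hs). intros [t [Ht [Hst Hdt]]].
  apply Hn. unfold delta in Hst, Hdt.
  destruct (constructive_indefinite_description _ (H t)) as [d' Hd']; simpl in *.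
  apply mono with (/ d').
  - apply Rinv_le_contravar; [apply cond_pos|assumption].
  - apply Hd'; auto. apply ball_le with d; auto.
Qed.

Lemma continuous_RInt_param {T : UniformSpace} (F : T -> R -> R) (a b : R) :
  a <= b ->
  (forall x s, continuous (fun z : T * R => F (fst z) (snd z)) (x, s)) ->
  forall x, continuous (fun x => RInt (F x) a b) x.
Proof.
  intros Hab Hc x0.
  assert (Hs : forall x s, continuous (F x) s).
  { intros x s.
    apply (continuous_comp (fun s => (x, s)) (fun z : T * R => F (fst z) (snd z))); auto.
    apply (continuous_comp_2 (fun _ => x) (fun s => s) (fun x s => (x, s))).
    - apply continuous_const.
    - apply continuous_id.
    - apply continuous_ext with (fun z : T * R => z); [now intros []|apply continuous_id]. }
  assert (Hi : forall x, ex_RInt (F x) a b).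
  { intros x. apply (@ex_RInt_continuous R_CompleteNormedModule). auto. }
  apply filterlim_locally. intros eps.
  (* Both [F x s'] and [F x0 s'] are compared with [F x0 s], hence the factor 2. The added 1 keeps
     the quotient defined for [a = b] and makes the final estimate strict. *)
  assert (He : 0 < eps / (2 * (b - a + 1))).
  { apply Rdiv_lt_0_compat; [apply cond_pos|lra]. }
  destruct (tube (fun x s _ => Rabs (F x s - F x0 s) <= eps / (b - a + 1)) x0 a b)
    as [d Hd].
  - auto.
  - intros s Hsab. pose proof (proj1 (filterlim_locally _ _) (Hc x0 s) (mkposreal _ He)) as [d Hd].
    exists d. intros x s' Hx Hs'.
    assert (H1 := Hd (x, s') (conj Hx Hs')).
    assert (H2 := Hd (x0, s') (conj (ball_center _ _) Hs')).
    simpl in H1, H2. unfold ball in H1, H2; simpl in H1, H2.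
    unfold AbsRing_ball, abs, minus, plus, opp in H1, H2; simpl in H1, H2.
    replace (F x s' - F x0 s') with ((F x s' + - F x0 s) - (F x0 s' + - F x0 s)) by ring.
    eapply Rle_trans; [apply Rabs_triang|]. rewrite Rabs_Ropp.
    replace (eps / (b - a + 1)) with (eps / (2 * (b - a + 1)) + eps / (2 * (b - a + 1)))
      by (field; lra). lra.
  - exists d. intros x Hx.
    unfold ball; simpl. unfold AbsRing_ball, abs, minus, plus, opp; simpl.
    change (Rabs (RInt (F x) a b - RInt (F x0) a b) < eps).
    replace (RInt (F x) a b - RInt (F x0) a b) with (RInt (fun s => F x s - F x0 s) a b)
      by (apply (RInt_minus (F x) (F x0)); auto).
    apply Rle_lt_trans with ((b - a) * (eps / (b - a + 1))).
    + apply abs_RInt_le_const; auto.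
      apply (@ex_RInt_minus R_NormedModule); auto.
    + replace ((b - a) * (eps / (b - a + 1))) with (eps * ((b - a) / (b - a + 1)))
        by (field; lra).
      rewrite <- (Rmult_1_r eps) at 2. apply Rmult_lt_compat_l; [apply cond_pos|].
      apply Rlt_div_l; lra.
Qed.

Definition continuous3 (F : field) (t r th : R) : Prop :=
  continuous (fun x : R * R * R => F (fst (fst x)) (snd (fst x)) (snd x)) (t, r, th).

Lemma continuous3_locally (F : field) t r th :
  continuous3 F t r th <->
  forall eps : posreal, exists d : posreal, forall t' r' th',
    Rabs (t' - t) < d -> Rabs (r' - r) < d -> Rabs (th' - th) < d ->
    Rabs (F t' r' th' - F t r th) < eps.
Proof.
  unfold continuous3. split; intros H.
  - intros eps. destruct (proj1 (filterlim_locally _ _) H eps) as [d Hd].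
    exists d. intros t' r' th' H1 H2 H3. apply (Hd (t', r', th')).
    split; [split|]; assumption.
  - apply filterlim_locally. intros eps. destruct (H eps) as [d Hd].
    exists d. intros [[t' r'] th'] [[H1 H2] H3]. apply Hd; assumption.
Qed.

Lemma continuous3_ext_loc (F F' : field) t r th :
  (exists d : posreal, forall t' r' th',
    Rabs (t' - t) < d -> Rabs (r' - r) < d -> Rabs (th' - th) < d ->
    F t' r' th' = F' t' r' th') ->
  continuous3 F t r th -> continuous3 F' t r th.
Proof.
  intros [d Hd] H. rewrite continuous3_locally in *. intros eps.
  destruct (H eps) as [d' Hd'].
  assert (Hm : 0 < Rmin d d') by (apply Rmin_pos; apply cond_pos).
  exists (mkposreal _ Hm). simpl. intros t' r' th' H1 H2 H3.
  pose proof (Rmin_l d d'). pose proof (Rmin_r d d'). pose proof (cond_pos d).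
  rewrite <- Hd, <- Hd; try lra.
  - apply Hd'; lra.
  - rewrite Rminus_diag, Rabs_R0; lra.
  - rewrite Rminus_diag, Rabs_R0; lra.
  - rewrite Rminus_diag, Rabs_R0; lra.
Qed.

(** Three nested uses of [tube]: theta for [(t, r)] near a point, then r, then t with a dummy
    parameter, each making the bound uniform in one more coordinate. *)
Lemma bounded_on_box (F : field) (B : box) :
  (forall t r th, continuous3 F t r th) ->
  exists C, forall t r th, in_box B t r th -> Rabs (F t r th) <= C.
Proof.
  intros Hc.
  destruct (tube (T := R_UniformSpace)
    (fun (_ : R) t C => forall r th, r0 B <= r <= r1 B -> th0 B <= th <= th1 B ->
       Rabs (F t r th) <= C) 0 (t0 B) (t1 B)) as [d Hd].
  - intros x s C C' HC H r th Hr Hth. apply Rle_trans with C; auto.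
  - intros t Ht.
    destruct (tube (T := R_UniformSpace)
      (fun (t : R) r C => forall th, th0 B <= th <= th1 B -> Rabs (F t r th) <= C)
      t (r0 B) (r1 B)) as [d Hd].
    + intros x s C C' HC H th Hth. apply Rle_trans with C; auto.
    + intros r Hr.
      destruct (tube (T := prod_UniformSpace R_UniformSpace R_UniformSpace)
        (fun (x : R * R) th C => Rabs (F (fst x) (snd x) th) <= C)
        (t, r) (th0 B) (th1 B)) as [d Hd].
      * intros x s C C' HC H. lra.
      * intros th Hth.
        destruct (proj1 (continuous3_locally F t r th) (Hc t r th) (mkposreal _ Rlt_0_1))
          as [d Hd]. simpl in Hd.
        assert (Hp : 0 < / (Rabs (F t r th) + 1)).
        { apply Rinv_0_lt_compat. pose proof (Rabs_pos (F t r th)). lra. }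
        (* With the radius at most [/ (Rabs (F t r th) + 1)], the local bound [Rabs (F t r th) + 1]
           is at most the inverse of the radius, the form that [tube] propagates. *)
        assert (Hm : 0 < Rmin d (/ (Rabs (F t r th) + 1))).
        { apply Rmin_pos; [apply cond_pos|assumption]. }
        exists (mkposreal _ Hm). simpl. intros [t' r'] th' [H1 H2] H3; simpl in *.
        pose proof (Rmin_l d (/ (Rabs (F t r th) + 1))).
        pose proof (Rmin_r d (/ (Rabs (F t r th) + 1))).
        assert (Hb : Rabs (F t' r' th' - F t r th) < 1).
        { apply Hd; apply Rlt_le_trans with (2 := H); assumption. }
        apply Rle_trans with (Rabs (F t r th) + 1).
        -- replace (F t' r' th') with (F t r th + (F t' r' th' - F t r th)) by ring.
           eapply Rle_trans; [apply Rabs_triang|]. lra.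
        -- rewrite <- (Rinv_inv (Rabs (F t r th) + 1)) at 1.
           apply Rinv_le_contravar; assumption.
      * exists d. intros t' r' H1 H2 th Hth.
        apply (Hd (t', r') th); [split|]; assumption.
    + exists d. intros _ t' _ Ht' r th Hr Hth. apply Hd; auto.
  - exists (/ d). intros t r th (Ht & Hr & Hth).
    apply (Hd 0 t); auto. apply ball_center.
Qed.

Section BoxIntegral.
Variable B : box.
Hypotheses (ht : t0 B <= t1 B) (hr : r0 B <= r1 B) (hth : th0 B <= th1 B).

Lemma continuous3_slice (F : field) :
  (forall t r th, continuous3 F t r th) ->
  (forall t r th, continuous (fun th => F t r th) th) /\
  (forall t r, continuous (fun x : R * R =>
     RInt (fun th => F (fst x) (snd x) th) (th0 B) (th1 B)) (t, r)) /\
  (forall t r, continuous (fun r => RInt (fun th => F t r th) (th0 B) (th1 B)) r) /\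
  (forall t, continuous (fun t => RInt (fun r => RInt (fun th => F t r th)
     (th0 B) (th1 B)) (r0 B) (r1 B)) t).
Proof.
  intros H.
  assert (H2 : forall t r, continuous (fun x : R * R =>
     RInt (fun th => F (fst x) (snd x) th) (th0 B) (th1 B)) (t, r)).
  { intros t r. apply (continuous_RInt_param
      (T := prod_UniformSpace R_UniformSpace R_UniformSpace)
      (fun x th => F (fst x) (snd x) th)); auto.
    intros [t' r'] th; apply H. }
  split; [|split; [|split]].
  - intros t r th.
    apply (continuous_comp_2 (U := R_UniformSpace) (V := prod_UniformSpace R_UniformSpace R_UniformSpace)
      (fun _ => (t, r)) (fun s => s) (fun x s => F (fst x) (snd x) s)).
    + apply continuous_const.
    + apply continuous_id.
    + apply H.
  - exact H2.
  - intros t r.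
    apply (continuous_comp_2 (U := R_UniformSpace) (fun _ => t) (fun s => s)
      (fun t r => RInt (fun th => F t r th) (th0 B) (th1 B))).
    + apply continuous_const.
    + apply continuous_id.
    + apply H2.
  - intros t. apply (continuous_RInt_param
      (fun t r => RInt (fun th => F t r th) (th0 B) (th1 B))); auto.
Qed.

Lemma box_integral_ext (F F' : field) :
  (forall t r th, in_box B t r th -> F t r th = F' t r th) ->
  box_integral B F = box_integral B F'.
Proof.
  intros H. unfold box_integral.
  apply RInt_ext. intros t. rewrite Rmin_left, Rmax_right by assumption. intros Ht.
  apply RInt_ext. intros r. rewrite Rmin_left, Rmax_right by assumption. intros Hr.
  apply RInt_ext. intros th. rewrite Rmin_left, Rmax_right by assumption. intros Hth.
  apply H. repeat split; lra.
Qed.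

Lemma box_integral_lin (F F' : field) (c : R) :
  (forall t r th, continuous3 F t r th) -> (forall t r th, continuous3 F' t r th) ->
  box_integral B (fun t r th => F t r th + c * F' t r th) =
  box_integral B F + c * box_integral B F'.
Proof.
  intros H H'. unfold box_integral.
  destruct (continuous3_slice F H) as (C1 & _ & C2 & C3).
  destruct (continuous3_slice F' H') as (C1' & _ & C2' & C3').
  assert (lin : forall (g g' : R -> R) u v,
    (forall s, continuous g s) -> (forall s, continuous g' s) ->
    RInt (fun s => g s + c * g' s) u v = RInt g u v + c * RInt g' u v).
  { intros g g' u v Hg Hg'.
    assert (E : ex_RInt g u v) by (apply (@ex_RInt_continuous R_CompleteNormedModule); auto).
    assert (E' : ex_RInt g' u v) by (apply (@ex_RInt_continuous R_CompleteNormedModule); auto).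
    rewrite (RInt_plus g (fun s => c * g' s)); auto.
    - apply f_equal. apply (RInt_scal g'); auto.
    - apply (@ex_RInt_scal R_NormedModule g'); auto. }
  rewrite <- lin by auto.
  apply RInt_ext; intros t _.
  rewrite <- lin by auto.
  apply RInt_ext; intros r _. apply lin; auto.
Qed.

Lemma box_integral_bound (F : field) (C : R) :
  (forall t r th, continuous3 F t r th) ->
  (forall t r th, in_box B t r th -> Rabs (F t r th) <= C) ->
  Rabs (box_integral B F) <= (t1 B - t0 B) * ((r1 B - r0 B) * ((th1 B - th0 B) * C)).
Proof.
  intros H HC. destruct (continuous3_slice F H) as (C1 & _ & C2 & C3).
  unfold box_integral.
  apply abs_RInt_le_const; auto.
  { apply (@ex_RInt_continuous R_CompleteNormedModule); auto. }
  intros t Ht. apply abs_RInt_le_const; auto.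
  { apply (@ex_RInt_continuous R_CompleteNormedModule); auto. }
  intros r Hr. apply abs_RInt_le_const; auto.
  { apply (@ex_RInt_continuous R_CompleteNormedModule); auto. }
  intros th Hth. apply HC. repeat split; lra.
Qed.

(** Every point of a face is a limit of points outside the box, so continuity carries the value 0 to
    it. These are the boundary terms of the integrations by parts. *)
Lemma vanishes_on_faces (F : field) (c : coord) :
  (forall t r th, continuous3 F t r th) ->
  (forall t r th, ~ in_box B t r th -> F t r th = 0) ->
  forall t r th,
    match c with
    | ct => t = t0 B \/ t = t1 B
    | cr => r = r0 B \/ r = r1 B
    | cth => th = th0 B \/ th = th1 B
    end -> F t r th = 0.
Proof.
  intros H H0 t r th Hc.
  apply NNPP; intros Hn.
  assert (Hp : 0 < Rabs (F t r th)) by (apply Rabs_pos_lt; assumption).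
  destruct (proj1 (continuous3_locally F t r th) (H t r th) (mkposreal _ Hp)) as [d Hd].
  simpl in Hd. pose proof (cond_pos d) as Hd0.
  assert (K : exists t' r' th', Rabs (t' - t) < d /\ Rabs (r' - r) < d /\
    Rabs (th' - th) < d /\ ~ in_box B t' r' th').
  { assert (Z : forall x, Rabs (x - x) < d) by (intros; rewrite Rminus_diag, Rabs_R0; lra).
    assert (Z1 : forall x, Rabs (x - d / 2 - x) < d)
      by (intros; unfold Rabs; destruct (Rcase_abs _); lra).
    assert (Z2 : forall x, Rabs (x + d / 2 - x) < d)
      by (intros; unfold Rabs; destruct (Rcase_abs _); lra).
    destruct c; destruct Hc as [->| ->].
    - exists (t0 B - d / 2), r, th. unfold in_box. repeat split; auto; lra.
    - exists (t1 B + d / 2), r, th. unfold in_box. repeat split; auto; lra.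
    - exists t, (r0 B - d / 2), th. unfold in_box. repeat split; auto; lra.
    - exists t, (r1 B + d / 2), th. unfold in_box. repeat split; auto; lra.
    - exists t, r, (th0 B - d / 2). unfold in_box. repeat split; auto; lra.
    - exists t, r, (th1 B + d / 2). unfold in_box. repeat split; auto; lra. }
  destruct K as (t' & r' & th' & K1 & K2 & K3 & K4).
  specialize (Hd t' r' th' K1 K2 K3). rewrite (H0 _ _ _ K4) in Hd.
  rewrite Rminus_0_l, Rabs_Ropp in Hd. lra.
Qed.

Lemma is_derive_RInt_param_continuous (f f' : R -> R -> R) (a b : R) :
  a <= b ->
  (forall x s, is_derive (fun u => f u s) x (f' x s)) ->
  (forall x s, continuous (fun z : R * R => f' (fst z) (snd z)) (x, s)) ->
  (forall x s, continuous (f x) s) ->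
  forall x, is_derive (fun x => RInt (f x) a b) x (RInt (f' x) a b).
Proof.
  intros Hab Hd Hc Hf x.
  replace (RInt (f' x) a b) with (RInt (fun t => Derive (fun u => f u t) x) a b).
  - apply is_derive_RInt_param.
    + apply filter_forall; intros y t _. eexists; apply Hd.
    + intros t _. apply continuity_2d_pt_ext with f'.
      * intros u v. symmetry. apply is_derive_unique, Hd.
      * apply continuity_2d_pt_filterlim, Hc.
    + apply filter_forall; intros y.
      apply (@ex_RInt_continuous R_CompleteNormedModule); auto.
  - apply RInt_ext; intros s _. apply is_derive_unique, Hd.
Qed.

Lemma RInt_derive_vanishing (f f' : R -> R) (a b : R) :
  (forall x, is_derive f x (f' x)) -> (forall x, continuous f' x) ->
  f a = 0 -> f b = 0 -> RInt f' a b = 0.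
Proof.
  intros Hd Hc Ha Hb.
  rewrite (is_RInt_unique f' a b (minus (f b) (f a))).
  - rewrite Ha, Hb. unfold minus, plus, opp; simpl; ring.
  - apply (is_RInt_derive f f'); auto.
Qed.

Lemma RInt_zero a b : RInt (fun _ => 0) a b = 0.
Proof. rewrite RInt_const. unfold scal; simpl. unfold mult; simpl. ring. Qed.

Lemma box_integral_partial (F : field) (c : coord) :
  (forall t r th, continuous3 F t r th) ->
  (forall t r th, continuous3 (partial c F) t r th) ->
  (forall t r th, ex_partial c F t r th) ->
  (forall t r th, ~ in_box B t r th -> F t r th = 0) ->
  box_integral B (partial c F) = 0.
Proof.
  intros H H' Hd H0.
  pose proof (vanishes_on_faces F c H H0) as Hz.
  destruct (continuous3_slice F H) as (C1 & C2 & C3 & C4).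
  destruct (continuous3_slice (partial c F) H') as (C1' & C2' & C3' & C4').
  (* Continuity in two variables with the third frozen is what differentiation under one integral
     sign asks for: [(t, th)] for the derivative in t, [(r, th)] for the one in r. *)
  assert (swap : forall t r th, continuous (fun z : R * R => F (fst z) r (snd z)) (t, th)
     /\ continuous (fun z : R * R => partial c F (fst z) r (snd z)) (t, th)
     /\ continuous (fun z : R * R => F t (fst z) (snd z)) (r, th)
     /\ continuous (fun z : R * R => partial c F t (fst z) (snd z)) (r, th)).
  { assert (E : forall F0, (forall t r th, continuous3 F0 t r th) -> forall t r th,
       continuous (fun z : R * R => F0 (fst z) r (snd z)) (t, th) /\
       continuous (fun z : R * R => F0 t (fst z) (snd z)) (r, th)).
    { intros F0 HF t r th. split.
      - apply (continuous_comp_2 (U := prod_UniformSpace R_UniformSpace R_UniformSpace)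
          (V := prod_UniformSpace R_UniformSpace R_UniformSpace)
          (fun z => (fst z, r)) snd (fun x s => F0 (fst x) (snd x) s)).
        + apply (continuous_comp_2 fst (fun _ => r) (fun x y => (x, y))).
          * apply continuous_fst.
          * apply continuous_const.
          * apply continuous_ext with (fun z : R * R => z); [now intros []|apply continuous_id].
        + apply continuous_snd.
        + apply HF.
      - apply (continuous_comp_2 (U := prod_UniformSpace R_UniformSpace R_UniformSpace)
          (V := prod_UniformSpace R_UniformSpace R_UniformSpace)
          (fun z => (t, fst z)) snd (fun x s => F0 (fst x) (snd x) s)).
        + apply (continuous_comp_2 (fun _ => t) fst (fun x y => (x, y))).
          * apply continuous_const.
          * apply continuous_fst.
          * apply continuous_ext with (fun z : R * R => z); [now intros []|apply continuous_id].
        + apply continuous_snd.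
        + apply HF. }
    intros t r th. destruct (E F H t r th), (E _ H' t r th); auto. }
  unfold box_integral.
  (* The derivative in t has to be moved out of two integrals, the one in r out of one; the one in
     theta is already innermost. *)
  destruct c; simpl in Hz, Hd.
  - apply RInt_derive_vanishing with
      (fun t => RInt (fun r => RInt (fun th => F t r th) (th0 B) (th1 B)) (r0 B) (r1 B)).
    + intros t.
      apply (is_derive_RInt_param_continuous
        (fun t r => RInt (fun th => F t r th) (th0 B) (th1 B))
        (fun t r => RInt (fun th => partial ct F t r th) (th0 B) (th1 B))); auto.
      intros t' r.
      apply (is_derive_RInt_param_continuous (fun t th => F t r th)
        (fun t th => partial ct F t r th)); auto.
      * intros x s. apply Derive_correct, Hd.
      * intros x s. apply swap.
    + apply C4'.
    + rewrite <- (RInt_zero (r0 B) (r1 B)). apply RInt_ext; intros r _.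
      rewrite <- (RInt_zero (th0 B) (th1 B)). apply RInt_ext; intros th _. auto.
    + rewrite <- (RInt_zero (r0 B) (r1 B)). apply RInt_ext; intros r _.
      rewrite <- (RInt_zero (th0 B) (th1 B)). apply RInt_ext; intros th _. auto.
  - rewrite <- (RInt_zero (t0 B) (t1 B)). apply RInt_ext; intros t _.
    apply RInt_derive_vanishing with (fun r => RInt (fun th => F t r th) (th0 B) (th1 B)).
    + intros r. apply (is_derive_RInt_param_continuous (fun r th => F t r th)
        (fun r th => partial cr F t r th)); auto.
      * intros x s. apply (Derive_correct (fun u => F t u s)), Hd.
      * intros x s. apply swap.
    + apply C3'.
    + rewrite <- (RInt_zero (th0 B) (th1 B)). apply RInt_ext; intros th _. auto.
    + rewrite <- (RInt_zero (th0 B) (th1 B)). apply RInt_ext; intros th _. auto.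
  - rewrite <- (RInt_zero (t0 B) (t1 B)). apply RInt_ext; intros t _.
    rewrite <- (RInt_zero (r0 B) (r1 B)). apply RInt_ext; intros r _.
    apply RInt_derive_vanishing with (fun th => F t r th); auto.
    intros th. apply Derive_correct, Hd.
Qed.

End BoxIntegral.

(** * First order expansions *)

Definition fplus (F F' : field) : field := fun t r th => F t r th + F' t r th.
Definition fmult (F F' : field) : field := fun t r th => F t r th * F' t r th.
Definition finv (F : field) : field := fun t r th => / F t r th.
Definition fconst (c : R) : field := fun _ _ _ => c.

Lemma partial_fplus c F F' t r th :
  ex_partial c F t r th -> ex_partial c F' t r th ->
  ex_partial c (fplus F F') t r th /\
  partial c (fplus F F') t r th = partial c F t r th + partial c F' t r th.
Proof.
  intros H H'; destruct c; split.
  - apply (ex_derive_plus (fun s => F s r th) (fun s => F' s r th)); assumption.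
  - apply (Derive_plus (fun s => F s r th) (fun s => F' s r th)); assumption.
  - apply (ex_derive_plus (fun s => F t s th) (fun s => F' t s th)); assumption.
  - apply (Derive_plus (fun s => F t s th) (fun s => F' t s th)); assumption.
  - apply (ex_derive_plus (fun s => F t r s) (fun s => F' t r s)); assumption.
  - apply (Derive_plus (fun s => F t r s) (fun s => F' t r s)); assumption.
Qed.

Lemma partial_fmult c F F' t r th :
  ex_partial c F t r th -> ex_partial c F' t r th ->
  ex_partial c (fmult F F') t r th /\
  partial c (fmult F F') t r th =
    partial c F t r th * F' t r th + F t r th * partial c F' t r th.
Proof.
  intros H H'; destruct c; split.
  - apply (ex_derive_mult (fun s => F s r th) (fun s => F' s r th)); assumption.
  - apply (Derive_mult (fun s => F s r th) (fun s => F' s r th)); assumption.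
  - apply (ex_derive_mult (fun s => F t s th) (fun s => F' t s th)); assumption.
  - apply (Derive_mult (fun s => F t s th) (fun s => F' t s th)); assumption.
  - apply (ex_derive_mult (fun s => F t r s) (fun s => F' t r s)); assumption.
  - apply (Derive_mult (fun s => F t r s) (fun s => F' t r s)); assumption.
Qed.

(** The square is kept as a product of inverses: the derivative of [/ F] is then built from [/ F]
    and the derivative of [F], which lets the induction in [pert_inv] close. *)
Lemma partial_finv c F t r th :
  F t r th <> 0 -> ex_partial c F t r th ->
  ex_partial c (finv F) t r th /\
  partial c (finv F) t r th = - partial c F t r th * (/ F t r th * / F t r th).
Proof.
  intros H0; destruct c; simpl; intros H; split.
  - now apply (ex_derive_inv (fun s => F s r th)).
  - unfold finv. rewrite (Derive_inv (fun s => F s r th)) by assumption. field; assumption.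
  - now apply (ex_derive_inv (fun s => F t s th)).
  - unfold finv. rewrite (Derive_inv (fun s => F t s th)) by assumption. field; assumption.
  - now apply (ex_derive_inv (fun s => F t r s)).
  - unfold finv. rewrite (Derive_inv (fun s => F t r s)) by assumption. field; assumption.
Qed.

Lemma partial_fconst c k t r th :
  ex_partial c (fconst k) t r th /\ partial c (fconst k) t r th = 0.
Proof.
  destruct c; split; first [exact (@ex_derive_const R_AbsRing R_NormedModule k _) | exact (Derive_const k _)].
Qed.

(** * Uniform expansions in a small parameter on a radial slab *)

Definition near (P : R -> Prop) : Prop :=
  exists d, 0 < d /\ forall e, Rabs e < d -> P e.

Lemma near_and P Q : near P -> near Q -> near (fun e => P e /\ Q e).
Proof.
  intros [d [Hd H]] [d' [Hd' H']]. exists (Rmin d d'). split; [now apply Rmin_pos|].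
  intros e He. pose proof (Rmin_l d d'). pose proof (Rmin_r d d').
  split; [apply H|apply H']; lra.
Qed.

Lemma near_imp (P Q : R -> Prop) : (forall e, P e -> Q e) -> near P -> near Q.
Proof. intros HPQ [d [Hd H]]. exists d; split; auto. Qed.

Lemma near_all (P : R -> Prop) : (forall e, P e) -> near P.
Proof. intros H. exists 1; split; [lra|auto]. Qed.

Lemma near_lt d : 0 < d -> near (fun e => Rabs e < d).
Proof. intros H; exists d; auto. Qed.

Section Slab.
Variables a b : R.

(** Only r is confined, to stay away from [r = 0] and from the singularities and zeros of [f]; in t
    and theta the background tensors are constant and the variations have compact support. *)
Definition slab (P : field -> R -> R -> R -> Prop) (F : field) : Prop :=
  forall t r th, a < r < b -> P F t r th.

Definition eq_slab (F F' : field) : Prop :=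
  forall t r th, a < r < b -> F t r th = F' t r th.

Lemma eq_slab_sym F F' : eq_slab F F' -> eq_slab F' F.
Proof. intros H t r th Hr; symmetry; auto. Qed.

Lemma slab_locally r : a < r < b -> locally r (fun s => a < s < b).
Proof.
  intros Hr. apply filter_and.
  - apply (open_gt a); lra.
  - apply (open_lt b); lra.
Qed.

Lemma continuous3_slab F F' :
  eq_slab F F' -> slab continuous3 F -> slab continuous3 F'.
Proof.
  intros H HF t r th Hr. apply continuous3_ext_loc with F; auto.
  destruct (slab_locally r Hr) as [d Hd]. exists d. intros t' r' th' _ H2 _.
  apply H, Hd, H2.
Qed.

Lemma ex_partial_slab c F F' :
  eq_slab F F' -> slab (ex_partial c) F -> slab (ex_partial c) F'.
Proof.
  intros H HF t r th Hr. specialize (HF t r th Hr).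
  destruct c; simpl in *.
  - eapply ex_derive_ext; [|exact HF]. simpl; auto.
  - eapply ex_derive_ext_loc; [|exact HF].
    eapply filter_imp; [|apply slab_locally, Hr]. simpl; auto.
  - eapply ex_derive_ext; [|exact HF]. simpl; auto.
Qed.

Lemma partial_slab c F F' : eq_slab F F' -> eq_slab (partial c F) (partial c F').
Proof.
  intros H t r th Hr. destruct c; simpl.
  - apply Derive_ext; auto.
  - apply Derive_ext_loc. eapply filter_imp; [|apply slab_locally, Hr]. simpl; auto.
  - apply Derive_ext; auto.
Qed.

Definition bounded_slab (C : R) (F : field) : Prop :=
  slab (fun F t r th => Rabs (F t r th) <= C) F.

(* A e = A0 + e A1 + O(e^2) uniformly on the slab a < r < b *)
Definition first_order (A : R -> field) (A0 A1 : field) : Prop :=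
  slab continuous3 A0 /\ slab continuous3 A1 /\
  near (fun e => slab continuous3 (A e)) /\
  exists C, bounded_slab C A0 /\ bounded_slab C A1 /\
    near (fun e => forall t r th, a < r < b ->
      Rabs (A e t r th - A0 t r th - e * A1 t r th) <= C * e ^ 2).

(* the expansion may be differentiated term by term n times *)
Fixpoint pert (n : nat) (A : R -> field) (A0 A1 : field) : Prop :=
  first_order A A0 A1 /\
  match n with
  | O => True
  | S m => forall c,
      near (fun e => slab (ex_partial c) (A e)) /\
      slab (ex_partial c) A0 /\ slab (ex_partial c) A1 /\
      pert m (fun e => partial c (A e)) (partial c A0) (partial c A1)
  end.

Lemma pert_first_order n A A0 A1 : pert n A A0 A1 -> first_order A A0 A1.
Proof. destruct n; intros H; apply H. Qed.

Lemma pert_pred n A A0 A1 : pert (S n) A A0 A1 -> pert n A A0 A1.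
Proof.
  revert A A0 A1; induction n as [|n IH]; intros A A0 A1 [H H'].
  - split; auto.
  - split; auto. intros c. destruct (H' c) as (H1 & H2 & H3 & H4).
    repeat split; auto.
Qed.

Lemma pert_le n m A A0 A1 : (m <= n)%nat -> pert n A A0 A1 -> pert m A A0 A1.
Proof. induction 1; auto. intros H'; apply IHle, pert_pred, H'. Qed.

Lemma pert_partial n A A0 A1 c :
  pert (S n) A A0 A1 -> pert n (fun e => partial c (A e)) (partial c A0) (partial c A1).
Proof. intros [_ H]; apply H. Qed.

Lemma first_order_ext A A' A0 A0' A1 A1' :
  near (fun e => eq_slab (A e) (A' e)) -> eq_slab A0 A0' -> eq_slab A1 A1' ->
  first_order A A0 A1 -> first_order A' A0' A1'.
Proof.
  intros HA H0 H1 (C0 & C1 & CA & C & B0 & B1 & BA).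
  split; [|split; [|split]].
  - now apply continuous3_slab with A0.
  - now apply continuous3_slab with A1.
  - eapply near_imp; [|apply near_and; [exact HA|exact CA]].
    intros e [He Hc]. now apply continuous3_slab with (A e).
  - exists C. split; [|split].
    + intros t r th Hr. rewrite <- H0 by auto. apply B0; auto.
    + intros t r th Hr. rewrite <- H1 by auto. apply B1; auto.
    + eapply near_imp; [|apply near_and; [exact HA|exact BA]].
      intros e [He Hc] t r th Hr. rewrite <- H0, <- H1, <- He by auto; auto.
Qed.

Lemma pert_ext n A A' A0 A0' A1 A1' :
  near (fun e => eq_slab (A e) (A' e)) -> eq_slab A0 A0' -> eq_slab A1 A1' ->
  pert n A A0 A1 -> pert n A' A0' A1'.
Proof.
  revert A A' A0 A0' A1 A1'; induction n as [|n IH]; intros A A' A0 A0' A1 A1' HA H0 H1 [H H'].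
  - split; auto. now apply first_order_ext with A A0 A1.
  - split; [now apply first_order_ext with A A0 A1|]. intros c.
    destruct (H' c) as (E & E0 & E1 & P). repeat split.
    + eapply near_imp; [|apply near_and; [exact HA|exact E]].
      intros e [He Hc]. now apply ex_partial_slab with (A e).
    + now apply ex_partial_slab with A0.
    + now apply ex_partial_slab with A1.
    + eapply IH; [| | |exact P].
      * eapply near_imp; [|exact HA]. intros e He. now apply partial_slab.
      * now apply partial_slab.
      * now apply partial_slab.
Qed.

(** Normal form for the estimates below: a constant at least 1 and [Rabs e < 1] absorb [e ^ 2] into
    [Rabs e], which gives the zeroth order estimate with [2 * C]. *)
Lemma first_order_bounds A A0 A1 : first_order A A0 A1 ->
  exists C, 1 <= C /\ bounded_slab C A0 /\ bounded_slab C A1 /\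
    near (fun e => Rabs e < 1 /\ forall t r th, a < r < b ->
      Rabs (A e t r th - A0 t r th - e * A1 t r th) <= C * e ^ 2 /\
      Rabs (A e t r th - A0 t r th) <= 2 * C * Rabs e).
Proof.
  intros (_ & _ & _ & C & B0 & B1 & BA).
  pose proof (Rmax_l 1 C) as M1. pose proof (Rmax_r 1 C) as M2.
  exists (Rmax 1 C). split; [auto|split; [|split]].
  - intros t r th Hr. specialize (B0 t r th Hr). simpl in *; lra.
  - intros t r th Hr. specialize (B1 t r th Hr). simpl in *; lra.
  - eapply near_imp; [|apply near_and; [exact BA|apply (near_lt 1); lra]].
    intros e [He H1]. split; auto. intros t r th Hr.
    specialize (He t r th Hr). specialize (B1 t r th Hr). simpl in B1.
    assert (He2 : e ^ 2 = Rabs e * Rabs e)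
      by (rewrite <- Rabs_mult, Rabs_right; [ring|apply Rle_ge, Rle_0_sqr]).
    pose proof (Rabs_pos e). pose proof (pow2_ge_0 e).
    assert (Hr1 : Rabs (A e t r th - A0 t r th - e * A1 t r th) <= Rmax 1 C * e ^ 2) by nra.
    split; auto.
    replace (A e t r th - A0 t r th) with
      ((A e t r th - A0 t r th - e * A1 t r th) + e * A1 t r th) by ring.
    eapply Rle_trans; [apply Rabs_triang|]. rewrite Rabs_mult.
    rewrite He2 in Hr1.
    pose proof (Rmult_le_compat_l (Rabs e) _ _ (Rabs_pos e) (Rle_trans _ _ _ B1 M2)).
    assert (Rmax 1 C * (Rabs e * Rabs e) <= Rmax 1 C * (Rabs e * 1)).
    { apply Rmult_le_compat_l; [lra|]. apply Rmult_le_compat_l; lra. }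
    lra.
Qed.

Lemma first_order_fplus A A0 A1 B B0 B1 :
  first_order A A0 A1 -> first_order B B0 B1 ->
  first_order (fun e => fplus (A e) (B e)) (fplus A0 B0) (fplus A1 B1).
Proof.
  intros (CA0 & CA1 & CA & C & BA0 & BA1 & BA) (CB0 & CB1 & CB & C' & BB0 & BB1 & BB).
  assert (cp : forall F F', slab continuous3 F -> slab continuous3 F' ->
    slab continuous3 (fplus F F')).
  { intros F F' H H' t r th Hr.
    apply (continuous_plus (V := R_NormedModule)); [apply H|apply H']; auto. }
  split; [|split; [|split]]; auto.
  - eapply near_imp; [|apply near_and; [exact CA|exact CB]]. intros e []; auto.
  - exists (C + C'). unfold fplus. split; [|split].
    + intros t r th Hr. eapply Rle_trans; [apply Rabs_triang|].
      specialize (BA0 t r th Hr). specialize (BB0 t r th Hr). simpl in *; lra.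
    + intros t r th Hr. eapply Rle_trans; [apply Rabs_triang|].
      specialize (BA1 t r th Hr). specialize (BB1 t r th Hr). simpl in *; lra.
    + eapply near_imp; [|apply near_and; [exact BA|exact BB]].
      intros e [H H'] t r th Hr. specialize (H t r th Hr). specialize (H' t r th Hr).
      replace (_ - _) with ((A e t r th - A0 t r th - e * A1 t r th)
        + (B e t r th - B0 t r th - e * B1 t r th)) by ring.
      eapply Rle_trans; [apply Rabs_triang|]. lra.
Qed.

Lemma first_order_fmult A A0 A1 B B0 B1 :
  first_order A A0 A1 -> first_order B B0 B1 ->
  first_order (fun e => fmult (A e) (B e)) (fmult A0 B0)
    (fplus (fmult A1 B0) (fmult A0 B1)).
Proof.
  intros HA HB.
  destruct (first_order_bounds _ _ _ HA) as (C & HC & BA0 & BA1 & BA).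
  destruct (first_order_bounds _ _ _ HB) as (C' & HC' & BB0 & BB1 & BB).
  destruct HA as (CA0 & CA1 & CA & _). destruct HB as (CB0 & CB1 & CB & _).
  assert (cm : forall F F', slab continuous3 F -> slab continuous3 F' ->
    slab continuous3 (fmult F F')).
  { intros F F' H H' t r th Hr.
    apply (continuous_mult (K := R_AbsRing)); [apply H|apply H']; auto. }
  assert (cp : forall F F', slab continuous3 F -> slab continuous3 F' ->
    slab continuous3 (fplus F F')).
  { intros F F' H H' t r th Hr.
    apply (continuous_plus (V := R_NormedModule)); [apply H|apply H']; auto. }
  assert (CC : 1 <= C * C') by nra.
  assert (bm : forall F F', bounded_slab C F -> bounded_slab C' F' ->
    forall t r th, a < r < b -> Rabs (F t r th * F' t r th) <= C * C').
  { intros F F' H H' t r th Hr. rewrite Rabs_mult.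
    apply Rmult_le_compat; try apply Rabs_pos; [apply H|apply H']; auto. }
  split; [|split; [|split]]; auto.
  - eapply near_imp; [|apply near_and; [exact CA|exact CB]]. intros e []; auto.
  (* 6 = 1 + 3 + 2, the constants of the three summands into which the remainder is split below. *)
  - exists (6 * (C * C')). unfold fplus, fmult. split; [|split].
    + intros t r th Hr. pose proof (bm A0 B0 BA0 BB0 t r th Hr). lra.
    + intros t r th Hr. eapply Rle_trans; [apply Rabs_triang|].
      pose proof (bm A1 B0 BA1 BB0 t r th Hr). pose proof (bm A0 B1 BA0 BB1 t r th Hr). lra.
    + eapply near_imp; [|apply near_and; [exact BA|exact BB]].
      intros e [[He H] [_ H']] t r th Hr.
      destruct (H t r th Hr) as [H1 H2]. destruct (H' t r th Hr) as [H1' H2'].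
      specialize (BA0 t r th Hr). specialize (BB0 t r th Hr). simpl in BA0, BB0.
      pose proof (bm A1 B1 BA1 BB1 t r th Hr) as H11.
      specialize (BA1 t r th Hr). specialize (BB1 t r th Hr). simpl in BA1, BB1.
      revert H1 H2 H1' H2' H11 BA0 BB0 BA1 BB1.
      generalize (A e t r th) (A0 t r th) (A1 t r th) (B e t r th) (B0 t r th) (B1 t r th).
      intros x x0 x1 y y0 y1 H1 H2 H1' H2' H11 BA0 BB0 BA1 BB1.
      (* The cross term of order [e ^ 2], the remainder of [x] times [y], and the linear part of [x]
         times the remainder of [y]. *)
      replace (_ - _) with (e ^ 2 * (x1 * y1) + (x - x0 - e * x1) * y
         + (x0 + e * x1) * (y - y0 - e * y1)) by ring.
      pose proof (pow2_ge_0 e).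
      assert (Hy : Rabs y <= 3 * C').
      { replace y with (y0 + (y - y0)) by ring. eapply Rle_trans; [apply Rabs_triang|]. nra. }
      assert (Hx : Rabs (x0 + e * x1) <= 2 * C).
      { eapply Rle_trans; [apply Rabs_triang|]. rewrite Rabs_mult.
        pose proof (Rabs_pos x1). nra. }
      eapply Rle_trans; [apply Rabs_triang|].
      apply Rle_trans with (e ^ 2 * (C * C') + C * e ^ 2 * (3 * C') + 2 * C * (C' * e ^ 2));
        [|lra].
      apply Rplus_le_compat.
      * eapply Rle_trans; [apply Rabs_triang|].
        apply Rplus_le_compat.
        -- rewrite Rabs_mult, (Rabs_right (e ^ 2)) by lra.
           now apply Rmult_le_compat_l.
        -- rewrite Rabs_mult. apply Rmult_le_compat; auto; apply Rabs_pos.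
      * rewrite Rabs_mult. apply Rmult_le_compat; auto; apply Rabs_pos.
Qed.

(** A uniform bound rather than mere nonvanishing: the slab is not compact, and inverses have to
    stay bounded on it. *)
Definition away (c : R) (F : field) : Prop :=
  slab (fun F t r th => c <= Rabs (F t r th)) F.

Lemma first_order_away A A0 A1 c : first_order A A0 A1 -> 0 < c -> away c A0 ->
  near (fun e => away (c / 2) (A e)).
Proof.
  intros HA Hc H0.
  destruct (first_order_bounds _ _ _ HA) as (C & HC & _ & _ & BA).
  (* For [Rabs e < c / (4 * C)] the deviation [2 * C * Rabs e] from [A0] is below [c / 2]. *)
  assert (Hd : 0 < c / (4 * C)) by (apply Rdiv_lt_0_compat; lra).
  eapply near_imp; [|apply near_and; [exact BA|apply (near_lt _ Hd)]].
  intros e [[_ H] He] t r th Hr.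
  destruct (H t r th Hr) as [_ H2]. specialize (H0 t r th Hr). simpl in H0.
  assert (Rabs e * (4 * C) < c).
  { apply (Rmult_lt_compat_r (4 * C)) in He; [|lra].
    replace (c / (4 * C) * (4 * C)) with c in He by (field; lra). exact He. }
  pose proof (Rabs_triang_inv (A0 t r th) (A0 t r th - A e t r th)) as Ht.
  replace (A0 t r th - (A0 t r th - A e t r th)) with (A e t r th) in Ht by ring.
  rewrite (Rabs_minus_sym (A0 t r th)) in Ht. lra.
Qed.

Lemma away_neq0 c F : 0 < c -> away c F -> forall t r th, a < r < b -> F t r th <> 0.
Proof.
  intros Hc H t r th Hr E. specialize (H t r th Hr). simpl in H.
  rewrite E, Rabs_R0 in H. lra.
Qed.

Lemma first_order_finv A A0 A1 c : first_order A A0 A1 -> 0 < c -> away c A0 ->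
  first_order (fun e => finv (A e)) (finv A0)
    (fmult (fmult (fconst (-1)) A1) (fmult (finv A0) (finv A0))).
Proof.
  intros HA Hc H0.
  pose proof (first_order_away _ _ _ _ HA Hc H0) as HN.
  destruct (first_order_bounds _ _ _ HA) as (C & HC & B0 & B1 & BA).
  destruct HA as (C0 & C1 & CA & _).
  assert (ci : forall F d, 0 < d -> away d F -> slab continuous3 F -> slab continuous3 (finv F)).
  { intros F d Hd Ha H t r th Hr.
    apply (continuous_comp
      (fun x : R * R * R => F (fst (fst x)) (snd (fst x)) (snd x)) Rinv); [apply H; auto|].
    apply continuous_Rinv. simpl. eapply away_neq0; eauto. }
  assert (cm : forall F F', slab continuous3 F -> slab continuous3 F' ->
    slab continuous3 (fmult F F')).
  { intros F F' H H' t r th Hr.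
    apply (continuous_mult (K := R_AbsRing)); [apply H|apply H']; auto. }
  assert (binv : forall x d, 0 < d -> d <= Rabs x -> Rabs (/ x) <= / d).
  { intros x d Hd Hx. rewrite Rabs_inv. apply Rinv_le_contravar; auto. }
  assert (Hic : 0 < / c) by (apply Rinv_0_lt_compat; lra).
  split; [|split; [|split]].
  - apply (ci A0 c); auto.
  - apply (cm (fmult (fconst (-1)) A1) (fmult (finv A0) (finv A0))).
    + apply (cm (fconst (-1)) A1); auto. intros t r th _. apply continuous_const.
    + apply (cm (finv A0) (finv A0)); apply (ci A0 c); auto.
  - eapply near_imp; [|apply near_and; [exact CA|exact HN]].
    intros e [H H']. apply (ci _ (c / 2)); auto; lra.
  (* The summands bound, in turn, the inverse, its first order coefficient and the remainder;
     [/ (c / 2)] bounds the inverse of the perturbed field. *)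
  - exists (/ c + C * (/ c * / c) + 3 * C ^ 2 * (/ (c / 2) * (/ c * / c))).
    assert (Hp1 : 0 <= C * (/ c * / c)) by (apply Rmult_le_pos; [lra|nra]).
    assert (Hp2 : 0 < / (c / 2)) by (apply Rinv_0_lt_compat; lra).
    assert (Hp3 : 0 <= 3 * C ^ 2 * (/ (c / 2) * (/ c * / c))).
    { apply Rmult_le_pos; [nra|]. apply Rmult_le_pos; nra. }
    unfold fmult, finv, fconst. split; [|split].
    + intros t r th Hr. specialize (H0 t r th Hr). simpl in H0.
      pose proof (binv _ _ Hc H0). lra.
    + intros t r th Hr. specialize (H0 t r th Hr). simpl in H0.
      specialize (B1 t r th Hr). simpl in B1.
      pose proof (binv _ _ Hc H0) as Hi. rewrite !Rabs_mult.
      replace (Rabs (-1)) with 1 by (rewrite Rabs_left; lra). rewrite Rmult_1_l.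
      apply Rle_trans with (C * (/ c * / c)); [|lra].
      apply Rmult_le_compat; auto; try apply Rabs_pos.
      * apply Rmult_le_pos; apply Rabs_pos.
      * apply Rmult_le_compat; auto; try apply Rabs_pos.
    + eapply near_imp; [|apply near_and; [exact BA|exact HN]].
      intros e [[He H] H'] t r th Hr.
      pose proof (away_neq0 _ _ Hc H0 t r th Hr) as Z0.
      assert (Hc2 : 0 < c / 2) by lra.
      pose proof (away_neq0 _ _ Hc2 H' t r th Hr) as Z.
      specialize (H t r th Hr). specialize (H' t r th Hr).
      specialize (H0 t r th Hr). specialize (B0 t r th Hr). specialize (B1 t r th Hr).
      simpl in H0, H', B0, B1. destruct H as [H _].
      revert Z0 Z H H' H0 B0 B1.
      generalize (A e t r th) (A0 t r th) (A1 t r th). intros x x0 x1 Z0 Z H H' H0 B0 B1.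
      (* Over the common denominator [x * x0 ^ 2] the numerator is visibly of order [e ^ 2], since
         it contains the remainder of [x] as a factor of its second term. The sizes are [C ^ 2] and
         [2 * C ^ 2], hence the 3. *)
      replace (_ - _) with ((x1 * x1 * e ^ 2 + (e * x1 - x0) * (x - x0 - e * x1))
        * (/ x * (/ x0 * / x0))) by (field; auto).
      apply Rle_trans with ((3 * C ^ 2 * e ^ 2) * (/ (c / 2) * (/ c * / c))).
      * rewrite (Rabs_mult (_ + _)).
        pose proof (pow2_ge_0 e) as He2.
        assert (Hx : Rabs (e * x1 - x0) <= 2 * C).
        { unfold Rminus. eapply Rle_trans; [apply Rabs_triang|].
          rewrite Rabs_Ropp, Rabs_mult. pose proof (Rabs_pos x1). nra. }
        apply Rmult_le_compat; try apply Rabs_pos.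
        -- eapply Rle_trans; [apply Rabs_triang|].
           rewrite (Rabs_mult (x1 * x1)), (Rabs_mult x1), (Rabs_mult (e * x1 - x0)).
           rewrite (Rabs_right (e ^ 2)) by lra.
           apply Rle_trans with (C * C * e ^ 2 + 2 * C * (C * e ^ 2)); [|nra].
           apply Rplus_le_compat.
           ++ apply Rmult_le_compat_r; auto.
              apply Rmult_le_compat; auto; apply Rabs_pos.
           ++ apply Rmult_le_compat; auto; apply Rabs_pos.
        -- rewrite !Rabs_mult.
           apply Rmult_le_compat; auto; try apply Rabs_pos.
           ++ apply Rmult_le_pos; apply Rabs_pos.
           ++ apply Rmult_le_compat; auto; try apply Rabs_pos.
      * pose proof (pow2_ge_0 e) as He2.
        apply Rle_trans with ((3 * C ^ 2 * (/ (c / 2) * (/ c * / c))) * e ^ 2);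
          [apply Req_le; ring|].
        apply Rmult_le_compat_r; lra.
Qed.

(** Given without a counterpart for derivatives, because the square root occurs only in the volume
    factor, which is never differentiated in space. *)
Lemma first_order_sqrt A A0 A1 c : first_order A A0 A1 -> 0 < c ->
  (forall t r th, a < r < b -> c <= A0 t r th) ->
  first_order (fun e t r th => sqrt (A e t r th)) (fun t r th => sqrt (A0 t r th))
    (fun t r th => A1 t r th / (2 * sqrt (A0 t r th))).
Proof.
  intros HA Hc H0.
  destruct (first_order_bounds _ _ _ HA) as (C & HC & B0 & B1 & BA).
  destruct HA as (C0 & C1 & CA & _).
  assert (cs : forall F, slab continuous3 F -> slab continuous3 (fun t r th => sqrt (F t r th))).
  { intros F H t r th Hr.
    apply (continuous_comp (fun x : R * R * R => F (fst (fst x)) (snd (fst x)) (snd x)) sqrt);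
      [apply H; auto|]. apply continuous_sqrt. }
  set (m := sqrt c). assert (Hm : 0 < m) by (apply sqrt_lt_R0; auto).
  assert (Hs : forall t r th, a < r < b -> m <= sqrt (A0 t r th))
    by (intros; apply sqrt_le_1_alt; auto).
  split; [|split; [|split]]; auto.
  - intros t r th Hr. specialize (Hs t r th Hr).
    apply (continuous_mult (K := R_AbsRing)); [apply C1; auto|].
    apply (continuous_comp
      (fun x : R * R * R => 2 * sqrt (A0 (fst (fst x)) (snd (fst x)) (snd x))) Rinv).
    + apply (continuous_mult (K := R_AbsRing) (fun _ => 2)); [apply continuous_const|].
      apply (cs A0 C0); auto.
    + apply continuous_Rinv. simpl. lra.
  - eapply near_imp; [|exact CA]. auto.
  - assert (Hmi : 0 < / m) by (apply Rinv_0_lt_compat; auto).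
    assert (Hq : 0 <= C * / m) by nra.
    assert (Hq' : 0 <= C ^ 2 * (/ m * (/ m * / m))).
    { apply Rmult_le_pos; [nra|]. apply Rmult_le_pos; nra. }
    assert (HCm : forall x, 0 <= x <= C -> sqrt x <= C).
    { intros x Hx. rewrite <- (sqrt_pow2 C) by lra. apply sqrt_le_1_alt. nra. }
    exists (C + C * / m + 2 * (C ^ 2 * (/ m * (/ m * / m)))). split; [|split].
    + intros t r th Hr. specialize (B0 t r th Hr). specialize (H0 t r th Hr). simpl in B0.
      rewrite Rabs_right by (apply Rle_ge, sqrt_pos).
      rewrite Rabs_right in B0 by lra. pose proof (HCm (A0 t r th)). lra.
    + intros t r th Hr. specialize (B1 t r th Hr). specialize (Hs t r th Hr). simpl in B1.
      unfold Rdiv. rewrite Rabs_mult.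
      apply Rle_trans with (C * / m); [|lra].
      apply Rmult_le_compat; auto; try apply Rabs_pos.
      rewrite Rabs_inv. apply Rinv_le_contravar; auto. rewrite Rabs_right; lra.
    + assert (Hd : 0 < c / (2 * C)) by (apply Rdiv_lt_0_compat; lra).
      eapply near_imp; [|apply near_and; [exact BA|apply (near_lt _ Hd)]].
      intros e [[He H] Hdd] t r th Hr.
      destruct (H t r th Hr) as [H1 H2].
      specialize (H0 t r th Hr). specialize (Hs t r th Hr). specialize (B1 t r th Hr).
      simpl in B1.
      assert (Hec : 2 * C * Rabs e < c).
      { apply (Rmult_lt_compat_r (2 * C)) in Hdd; [|lra].
        replace (c / (2 * C) * (2 * C)) with c in Hdd by (field; lra). lra. }
      assert (Hpos : 0 < A e t r th).
      { apply Rabs_le_between in H2. lra. }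
      revert H1 H2 H0 Hs B1 Hpos.
      generalize (A e t r th) (A0 t r th) (A1 t r th). intros x x0 x1 H1 H2 H0 Hs B1 Hpos.
      set (s := sqrt x). set (s0 := sqrt x0) in *.
      assert (Es : x = s * s) by (symmetry; apply sqrt_sqrt; lra).
      assert (Es0 : x0 = s0 * s0) by (symmetry; apply sqrt_sqrt; lra).
      assert (Ps : 0 < s) by (apply sqrt_lt_R0; lra).
      (* From [s - s0 = (x - x0) / (s + s0)], used a second time to replace [/ (s + s0)] by
         [/ (2 * s0)]: the first term carries the remainder of [x], the second is quadratic in
         [x - x0]. *)
      replace (s - s0 - e * (x1 / (2 * s0))) with
        ((x - x0 - e * x1) * / (2 * s0)
         - (x - x0) ^ 2 * (/ (2 * s0) * (/ (s + s0) * / (s + s0))))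
        by (rewrite Es, Es0; field; lra).
      pose proof (pow2_ge_0 e) as He2.
      assert (I1 : 0 < / (2 * s0) <= / m).
      { split; [apply Rinv_0_lt_compat; lra|apply Rinv_le_contravar; lra]. }
      assert (I2 : 0 < / (s + s0) <= / m).
      { split; [apply Rinv_0_lt_compat; lra|apply Rinv_le_contravar; lra]. }
      assert (D2 : (x - x0) ^ 2 <= 4 * C ^ 2 * e ^ 2).
      { replace (4 * C ^ 2 * e ^ 2) with ((2 * C * Rabs e) ^ 2)
          by (rewrite !Rpow_mult_distr, pow2_abs; ring).
        rewrite <- (pow2_abs (x - x0)). apply pow_incr. split; [apply Rabs_pos|auto]. }
      unfold Rminus at 1. eapply Rle_trans; [apply Rabs_triang|].
      rewrite Rabs_Ropp, Rabs_mult, (Rabs_right (/ (2 * s0))) by lra.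
      rewrite (Rabs_right (_ * (_ * _))).
      2:{ apply Rle_ge, Rmult_le_pos; [apply pow2_ge_0|]. apply Rmult_le_pos; nra. }
      apply Rle_trans with (C * e ^ 2 * / m
        + 4 * C ^ 2 * e ^ 2 * (/ (2 * s0) * (/ (s + s0) * / (s + s0)))).
      * apply Rplus_le_compat.
        -- apply Rmult_le_compat; try lra; apply Rabs_pos.
        -- apply Rmult_le_compat_r; auto. apply Rmult_le_pos; nra.
      * assert (I3 : / (2 * s0) * (/ (s + s0) * / (s + s0)) <= / 2 * (/ m * (/ m * / m))).
        { rewrite Rinv_mult, Rmult_assoc.
          apply Rmult_le_compat_l; [lra|].
          apply Rmult_le_compat; try nra.
          - apply Rlt_le, Rinv_0_lt_compat; lra.
          - apply Rinv_le_contravar; lra. }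
        apply (Rmult_le_compat_l (4 * C ^ 2 * e ^ 2)) in I3; [|nra].
        nra.
Qed.

Lemma first_order_const F C : slab continuous3 F -> bounded_slab C F ->
  first_order (fun _ => F) F (fconst 0).
Proof.
  intros H HC. split; [|split; [|split]]; auto.
  - intros t r th _. apply continuous_const.
  - apply near_all; auto.
  (* On an empty slab [C] could be negative; its absolute value is a bound in every case. *)
  - exists (Rabs C). unfold fconst. split; [|split].
    + intros t r th Hr. eapply Rle_trans; [apply HC; auto|apply Rle_abs].
    + intros t r th Hr. rewrite Rabs_R0. apply Rabs_pos.
    + apply near_all. intros e t r th Hr.
      replace (_ - _) with 0 by ring. rewrite Rabs_R0.
      apply Rmult_le_pos; [apply Rabs_pos|apply pow2_ge_0].
Qed.

End Slab.

Section Slab2.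
Variables a b : R.
Notation slab := (slab a b).
Notation eq_slab := (eq_slab a b).
Notation pert := (pert a b).
Notation first_order := (first_order a b).
Notation bounded_slab := (bounded_slab a b).
Notation away := (away a b).

Lemma pert_plus n A A0 A1 B B0 B1 : pert n A A0 A1 -> pert n B B0 B1 ->
  pert n (fun e t r th => A e t r th + B e t r th)
    (fun t r th => A0 t r th + B0 t r th) (fun t r th => A1 t r th + B1 t r th).
Proof.
  revert A A0 A1 B B0 B1; induction n as [|n IH]; intros A A0 A1 B B0 B1 [HA DA] [HB DB].
  { split; auto. now apply first_order_fplus. }
  split; [now apply first_order_fplus|]. intros c.
  destruct (DA c) as (EA & EA0 & EA1 & PA). destruct (DB c) as (EB & EB0 & EB1 & PB).
  split; [|split; [|split]].
  - eapply near_imp; [|apply near_and; [exact EA|exact EB]].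
    intros e [H H'] t r th Hr. now apply (partial_fplus c (A e) (B e)); [apply H|apply H'].
  - intros t r th Hr. now apply (partial_fplus c A0 B0); [apply EA0|apply EB0].
  - intros t r th Hr. now apply (partial_fplus c A1 B1); [apply EA1|apply EB1].
  - eapply pert_ext; [| | |apply (IH _ _ _ _ _ _ PA PB)].
    + eapply near_imp; [|apply near_and; [exact EA|exact EB]].
      intros e [H H'] t r th Hr. symmetry.
      now apply (partial_fplus c (A e) (B e)); [apply H|apply H'].
    + intros t r th Hr. symmetry. now apply (partial_fplus c A0 B0); [apply EA0|apply EB0].
    + intros t r th Hr. symmetry. now apply (partial_fplus c A1 B1); [apply EA1|apply EB1].
Qed.

(** By the Leibniz rule, order [n + 1] reduces to order [n] for products of one differentiated
    factor and one undifferentiated factor, the latter weakened by [pert_pred]. *)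
Lemma pert_mult n A A0 A1 B B0 B1 : pert n A A0 A1 -> pert n B B0 B1 ->
  pert n (fun e t r th => A e t r th * B e t r th)
    (fun t r th => A0 t r th * B0 t r th)
    (fun t r th => A1 t r th * B0 t r th + A0 t r th * B1 t r th).
Proof.
  revert A A0 A1 B B0 B1; induction n as [|n IH]; intros A A0 A1 B B0 B1 PA PB.
  { split; auto. apply first_order_fmult; eapply pert_first_order; eauto. }
  split; [apply first_order_fmult; eapply pert_first_order; eauto|]. intros c.
  pose proof (pert_pred _ _ _ _ _ _ PA) as LA. pose proof (pert_pred _ _ _ _ _ _ PB) as LB.
  destruct PA as [_ DA]. destruct PB as [_ DB].
  destruct (DA c) as (EA & EA0 & EA1 & PA). destruct (DB c) as (EB & EB0 & EB1 & PB).
  assert (M : forall t r th, a < r < b ->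
    ex_partial c (fplus (fmult A1 B0) (fmult A0 B1)) t r th /\
    partial c (fplus (fmult A1 B0) (fmult A0 B1)) t r th =
      (partial c A1 t r th * B0 t r th + A1 t r th * partial c B0 t r th) +
      (partial c A0 t r th * B1 t r th + A0 t r th * partial c B1 t r th)).
  { intros t r th Hr.
    destruct (partial_fmult c A1 B0 t r th (EA1 t r th Hr) (EB0 t r th Hr)) as [E1 <-].
    destruct (partial_fmult c A0 B1 t r th (EA0 t r th Hr) (EB1 t r th Hr)) as [E2 <-].
    now apply partial_fplus. }
  split; [|split; [|split]].
  - eapply near_imp; [|apply near_and; [exact EA|exact EB]].
    intros e [H H'] t r th Hr. now apply (partial_fmult c (A e) (B e)); [apply H|apply H'].
  - intros t r th Hr. now apply (partial_fmult c A0 B0); [apply EA0|apply EB0].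
  - intros t r th Hr. now apply M.
  - eapply pert_ext; [| | |apply (pert_plus _ _ _ _ _ _ _ (IH _ _ _ _ _ _ PA LB)
      (IH _ _ _ _ _ _ LA PB))].
    + eapply near_imp; [|apply near_and; [exact EA|exact EB]].
      intros e [H H'] t r th Hr. symmetry.
      now apply (partial_fmult c (A e) (B e)); [apply H|apply H'].
    + intros t r th Hr. symmetry. now apply (partial_fmult c A0 B0); [apply EA0|apply EB0].
    + intros t r th Hr. symmetry. destruct (M t r th Hr) as [_ M'].
      refine (eq_trans M' _). ring.
Qed.

(** A polynomial of degree one in [e] has remainder zero, and its spatial derivatives are again of
    this kind. Both variations start here: that of the inverse metric and that of the gradient of
    the scalar. *)
Lemma pert_affine n (F F' : field) :
  pert n (fun _ => F) F (fconst 0) -> pert n (fun _ => F') F' (fconst 0) ->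
  pert n (fun e t r th => F t r th + e * F' t r th) F F'.
Proof.
  revert F F'; induction n as [|n IH]; intros F F' H H'.
  - split; auto.
    destruct (pert_first_order _ _ _ _ _ _ H) as (C0 & _ & _ & C & B0 & _ & _).
    destruct (pert_first_order _ _ _ _ _ _ H') as (C0' & _ & _ & C' & B0' & _ & _).
    split; [|split; [|split]]; auto.
    + apply near_all. intros e t r th Hr.
      apply (continuous_plus (V := R_NormedModule)); [apply C0; auto|].
      apply (continuous_mult (K := R_AbsRing)); [apply continuous_const|apply C0'; auto].
    + exists (Rabs C + Rabs C'). pose proof (Rle_abs C). pose proof (Rle_abs C').
      pose proof (Rabs_pos C). pose proof (Rabs_pos C').
      split; [|split].
      * intros t r th Hr. specialize (B0 t r th Hr). simpl in *; lra.
      * intros t r th Hr. specialize (B0' t r th Hr). simpl in *; lra.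
      * apply near_all. intros e t r th Hr.
        replace (_ - _) with 0 by ring. rewrite Rabs_R0.
        apply Rmult_le_pos; [lra|apply pow2_ge_0].
  - assert (P : forall c e t r th, a < r < b ->
      ex_partial c (fun t r th => F t r th + e * F' t r th) t r th /\
      partial c (fun t r th => F t r th + e * F' t r th) t r th =
      partial c F t r th + e * partial c F' t r th).
    { intros c e t r th Hr.
      destruct H as [_ D]. destruct (D c) as (_ & E & _).
      destruct H' as [_ D']. destruct (D' c) as (_ & E' & _).
      destruct (partial_fconst c e t r th) as [K1 K2].
      destruct (partial_fmult c (fconst e) F' t r th K1 (E' t r th Hr)) as [M1 M2].
      destruct (partial_fplus c F (fmult (fconst e) F') t r th (E t r th Hr) M1) as [N1 N2].
      split; [exact N1|]. refine (eq_trans N2 _). rewrite M2, K2.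
      unfold fconst. ring. }
    assert (Z : forall c, eq_slab (partial c (fconst 0)) (fconst 0)).
    { intros c t r th _. apply partial_fconst. }
    split; [|intros c; split; [|split; [|split]]].
    + apply (pert_first_order _ _ n). apply IH; now apply pert_pred.
    + apply near_all. intros e t r th Hr. now apply P.
    + destruct H as [_ D]. apply (D c).
    + destruct H' as [_ D']. apply (D' c).
    + eapply pert_ext; [| | |apply (IH (partial c F) (partial c F'))].
      * apply near_all. intros e t r th Hr. symmetry. now apply P.
      * intros t r th _; reflexivity.
      * intros t r th _; reflexivity.
      * eapply pert_ext; [| | |apply (pert_partial _ _ _ _ _ _ c H)].
        -- apply near_all. intros e t r th _; reflexivity.
        -- intros t r th _; reflexivity.
        -- apply Z.
      * eapply pert_ext; [| | |apply (pert_partial _ _ _ _ _ _ c H')].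
        -- apply near_all. intros e t r th _; reflexivity.
        -- intros t r th _; reflexivity.
        -- apply Z.
Qed.

Lemma pert_const n k : pert n (fun _ => fconst k) (fconst k) (fconst 0).
Proof.
  assert (C : forall k, slab continuous3 (fconst k)).
  { intros k' t r th _. apply continuous_const. }
  assert (base : forall k, first_order (fun _ => fconst k) (fconst k) (fconst 0)).
  { intros k'. apply first_order_const with (Rabs k'); auto.
    intros t r th _; unfold fconst; lra. }
  revert k; induction n as [|n IH]; intros k; split; auto.
  intros c. split; [|split; [|split]].
  - apply near_all. intros e t r th _. apply partial_fconst.
  - intros t r th _. apply partial_fconst.
  - intros t r th _. apply partial_fconst.
  - eapply pert_ext; [| | |apply (IH 0)].
    + apply near_all. intros e t r th _. symmetry. apply partial_fconst.
    + intros t r th _. symmetry. apply partial_fconst.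
    + intros t r th _. symmetry. apply partial_fconst.
Qed.

Lemma pert_scal n k A A0 A1 : pert n A A0 A1 ->
  pert n (fun e t r th => k * A e t r th)
    (fun t r th => k * A0 t r th) (fun t r th => k * A1 t r th).
Proof.
  intros H. eapply pert_ext; [| | |apply (pert_mult _ _ _ _ _ _ _ (pert_const n k) H)].
  - apply near_all. intros e t r th _; reflexivity.
  - intros t r th _; reflexivity.
  - intros t r th _. unfold fconst. ring.
Qed.

Lemma pert_opp n A A0 A1 : pert n A A0 A1 ->
  pert n (fun e t r th => - A e t r th)
    (fun t r th => - A0 t r th) (fun t r th => - A1 t r th).
Proof.
  intros H. eapply pert_ext; [| | |apply (pert_scal _ (-1) _ _ _ H)].
  - apply near_all. intros e t r th _; ring.
  - intros t r th _; ring.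
  - intros t r th _; ring.
Qed.

Lemma pert_minus n A A0 A1 B B0 B1 : pert n A A0 A1 -> pert n B B0 B1 ->
  pert n (fun e t r th => A e t r th - B e t r th)
    (fun t r th => A0 t r th - B0 t r th) (fun t r th => A1 t r th - B1 t r th).
Proof. intros H H'. apply pert_plus; auto. now apply pert_opp. Qed.

Lemma pert_inv n A A0 A1 c : pert n A A0 A1 -> 0 < c -> away c A0 ->
  pert n (fun e t r th => / A e t r th) (fun t r th => / A0 t r th)
    (fun t r th => - A1 t r th * (/ A0 t r th * / A0 t r th)).
Proof.
  intros H Hc H0. revert A A0 A1 H H0; induction n as [|n IH]; intros A A0 A1 PA H0.
  - split; auto. pose proof (pert_first_order _ _ _ _ _ _ PA) as HA.
    eapply first_order_ext; [| | |apply (first_order_finv _ _ _ _ _ c HA Hc H0)].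
    + apply near_all. intros e t r th _; reflexivity.
    + intros t r th _; reflexivity.
    + intros t r th _. unfold fmult, fconst, finv. ring.
  - pose proof (IH _ _ _ (pert_pred _ _ _ _ _ _ PA) H0) as LI.
    pose proof (first_order_away _ _ _ _ _ _ (pert_first_order _ _ _ _ _ _ PA) Hc H0) as HN.
    assert (Hc2 : 0 < c / 2) by lra.
    split; [apply (pert_first_order _ _ _ _ _ _ LI)|]. intros k.
    destruct PA as [_ DA]. destruct (DA k) as (EA & EA0 & EA1 & PA).
    assert (Z : forall t r th, a < r < b -> A0 t r th <> 0)
      by exact (away_neq0 a b c A0 Hc H0).
    assert (M : forall t r th, a < r < b ->
      ex_partial k (fmult (fmult (fconst (-1)) A1) (fmult (finv A0) (finv A0))) t r th /\
      partial k (fmult (fmult (fconst (-1)) A1) (fmult (finv A0) (finv A0))) t r th =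
        - partial k A1 t r th * (/ A0 t r th * / A0 t r th)
        + 2 * A1 t r th * partial k A0 t r th * (/ A0 t r th * (/ A0 t r th * / A0 t r th))).
    { intros t r th Hr. specialize (Z t r th Hr).
      destruct (partial_finv k A0 t r th Z (EA0 t r th Hr)) as [I1 I2].
      destruct (partial_fmult k _ _ t r th I1 I1) as [J1 J2].
      destruct (partial_fconst k (-1) t r th) as [K1 K2].
      destruct (partial_fmult k _ _ t r th K1 (EA1 t r th Hr)) as [L1 L2].
      destruct (partial_fmult k _ _ t r th L1 J1) as [N1 N2].
      split; auto. rewrite N2, L2, J2, K2, I2. unfold fmult, fconst, finv. ring. }
    split; [|split; [|split]].
    + eapply near_imp; [|apply near_and; [exact EA|exact HN]].
      intros e [H H'] t r th Hr. apply (partial_finv k (A e)); [|apply H; auto].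
      apply (away_neq0 _ _ _ _ Hc2 H' t r th Hr).
    + intros t r th Hr. apply (partial_finv k A0); auto.
    + intros t r th Hr. destruct (M t r th Hr) as [M' _].
      refine (ex_partial_slab a b k _ _ _ _ t r th Hr); [|intros ? ? ? ?; now apply M].
      intros t' r' th' _. unfold fmult, fconst, finv. ring.
    + eapply pert_ext; [| | |
        apply (pert_mult _ _ _ _ _ _ _ (pert_opp _ _ _ _ PA) (pert_mult _ _ _ _ _ _ _ LI LI))].
      * eapply near_imp; [|apply near_and; [exact EA|exact HN]].
        intros e [H H'] t r th Hr. symmetry. apply (partial_finv k (A e)); [|apply H; auto].
        apply (away_neq0 _ _ _ _ Hc2 H' t r th Hr).
      * intros t r th Hr. symmetry. apply (partial_finv k A0); auto.
      * intros t r th Hr. symmetry. simpl.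
        etransitivity; [|etransitivity; [exact (proj2 (M t r th Hr))|]].
        -- apply (partial_slab a b); auto. intros t' r' th' _.
           unfold fmult, fconst, finv. ring.
        -- ring.
Qed.

(** At [m = 0] the truncated exponent [m - 1] does no harm, the factor [INR 0] being zero. The same
    applies wherever this expression recurs. *)
Lemma pert_pow n m A A0 A1 : pert n A A0 A1 ->
  pert n (fun e t r th => A e t r th ^ m) (fun t r th => A0 t r th ^ m)
    (fun t r th => INR m * A0 t r th ^ (m - 1) * A1 t r th).
Proof.
  intros H; induction m as [|m IH].
  - eapply pert_ext; [| | |apply (pert_const n 1)].
    + apply near_all. intros e t r th _; reflexivity.
    + intros t r th _; reflexivity.
    + intros t r th _. unfold fconst. simpl; ring.
  - eapply pert_ext; [| | |apply (pert_mult _ _ _ _ _ _ _ H IH)].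
    + apply near_all. intros e t r th _; reflexivity.
    + intros t r th _; reflexivity.
    + intros t r th _. destruct m as [|m].
      * simpl; ring.
      * replace (S (S m) - 1)%nat with (S m) by auto.
        replace (S m - 1)%nat with m by (simpl; now rewrite PeanoNat.Nat.sub_0_r).
        rewrite !S_INR. simpl; ring.
Qed.

Lemma pert_sum_n_m n (A : nat -> R -> field) A0 A1 i j :
  (forall m, pert n (A m) (A0 m) (A1 m)) ->
  pert n (fun e t r th => sum_n_m (fun m => A m e t r th) i j)
    (fun t r th => sum_n_m (fun m => A0 m t r th) i j)
    (fun t r th => sum_n_m (fun m => A1 m t r th) i j).
Proof.
  intros H. induction j as [|j IH].
  - destruct i as [|i].
    + eapply pert_ext; [| | |apply (H 0%nat)].
      * apply near_all. intros e t r th _. now rewrite sum_n_n.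
      * intros t r th _. now rewrite sum_n_n.
      * intros t r th _. now rewrite sum_n_n.
    + eapply pert_ext; [| | |apply (pert_const n 0)].
      * apply near_all. intros e t r th _. rewrite sum_n_m_zero; [reflexivity|apply PeanoNat.Nat.lt_0_succ].
      * intros t r th _. rewrite sum_n_m_zero; [reflexivity|apply PeanoNat.Nat.lt_0_succ].
      * intros t r th _. rewrite sum_n_m_zero; [reflexivity|apply PeanoNat.Nat.lt_0_succ].
  - destruct (Compare_dec.le_lt_dec i (S j)) as [Hij|Hij].
    + eapply pert_ext; [| | |apply (pert_plus _ _ _ _ _ _ _ IH (H (S j)))].
      * apply near_all. intros e t r th _. now rewrite sum_n_Sm.
      * intros t r th _. now rewrite sum_n_Sm.
      * intros t r th _. now rewrite sum_n_Sm.
    + eapply pert_ext; [| | |apply (pert_const n 0)].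
      * apply near_all. intros e t r th _. now rewrite sum_n_m_zero.
      * intros t r th _. now rewrite sum_n_m_zero.
      * intros t r th _. now rewrite sum_n_m_zero.
Qed.

(* background fields: continuous and bounded, with their derivatives up to order n *)
Definition bg (n : nat) (F : field) : Prop := pert n (fun _ => F) F (fconst 0).

Lemma bg_ext n F F' : eq_slab F F' -> bg n F -> bg n F'.
Proof.
  intros H. apply pert_ext; auto.
  - apply near_all; auto.
  - intros t r th _; reflexivity.
Qed.

Lemma bg_plus n F F' : bg n F -> bg n F' -> bg n (fun t r th => F t r th + F' t r th).
Proof.
  intros H H'. eapply pert_ext; [| | |apply (pert_plus _ _ _ _ _ _ _ H H')].
  - apply near_all. intros e t r th _; reflexivity.
  - intros t r th _; reflexivity.
  - intros t r th _. unfold fconst; ring.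
Qed.

Lemma bg_mult n F F' : bg n F -> bg n F' -> bg n (fun t r th => F t r th * F' t r th).
Proof.
  intros H H'. eapply pert_ext; [| | |apply (pert_mult _ _ _ _ _ _ _ H H')].
  - apply near_all. intros e t r th _; reflexivity.
  - intros t r th _; reflexivity.
  - intros t r th _. unfold fconst; ring.
Qed.

Lemma bg_const n k : bg n (fconst k).
Proof. apply pert_const. Qed.

Lemma bg_partial n F c : bg (S n) F -> bg n (partial c F).
Proof.
  intros H. eapply pert_ext; [| | |apply (pert_partial _ _ _ _ _ _ c H)].
  - apply near_all. intros e t r th _; reflexivity.
  - intros t r th _; reflexivity.
  - intros t r th _. apply partial_fconst.
Qed.

(** Applied to the varied connection, it shows that its components and their first derivatives are
    continuous and bounded, without any explicit formula. *)
Lemma pert_bg1 n A A0 A1 : pert n A A0 A1 -> bg n A1.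
Proof.
  revert A A0 A1; induction n as [|n IH]; intros A A0 A1 [(_ & C1 & _ & C & _ & B1 & _) H].
  - split; auto. now apply first_order_const with C.
  - split; [now apply first_order_const with C|]. intros c.
    destruct (H c) as (_ & _ & E1 & P). split; [|split; [|split]]; auto.
    + apply near_all; auto.
    + intros t r th _; apply partial_fconst.
    + eapply pert_ext; [| | |apply (IH _ _ _ P)].
      * apply near_all. intros e t r th _; reflexivity.
      * intros t r th _; reflexivity.
      * intros t r th _. symmetry. apply partial_fconst.
Qed.

Lemma bg_continuous3 n F : bg n F -> slab continuous3 F.
Proof. intros H. apply (pert_first_order _ _ _ _ _ _ H). Qed.

Lemma bg_ex_partial n F c : bg (S n) F -> slab (ex_partial c) F.
Proof. intros [_ H]. apply (H c). Qed.

(** * Fields depending on the radius only *)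

Definition radial (f : R -> R) : field := fun _ r _ => f r.

Hypothesis Hab : a <= b.

Lemma continuous3_radial f t r th : continuous f r -> continuous3 (radial f) t r th.
Proof.
  intros H. apply (continuous_comp (fun x : R * R * R => snd (fst x)) f); auto.
  apply (continuous_comp (fst : R * R * R -> R * R) snd).
  - apply continuous_fst.
  - apply continuous_snd.
Qed.

(** The extreme value theorem on the closed interval bounds the field on the open slab; hence the
    hypotheses on [f] are made for [a <= r <= b] throughout. *)
Lemma radial_bounded f : (forall r, a <= r <= b -> continuous f r) ->
  exists C, bounded_slab C (radial f).
Proof.
  intros H.
  assert (Hc : forall r, a <= r <= b -> continuity_pt (fun r => Rabs (f r)) r).
  { intros r Hr. apply (continuity_pt_comp f Rabs).
    - apply continuity_pt_filterlim, H, Hr.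
    - apply Rcontinuity_abs. }
  destruct (continuity_ab_maj _ a b Hab Hc) as [M [HM _]].
  exists (Rabs (f M)). intros t r th Hr. apply HM; lra.
Qed.

Lemma radial_away f : (forall r, a <= r <= b -> continuous f r) ->
  (forall r, a <= r <= b -> f r <> 0) ->
  exists c, 0 < c /\ away c (radial f).
Proof.
  intros H H0.
  assert (Hc : forall r, a <= r <= b -> continuity_pt (fun r => Rabs (f r)) r).
  { intros r Hr. apply (continuity_pt_comp f Rabs).
    - apply continuity_pt_filterlim, H, Hr.
    - apply Rcontinuity_abs. }
  destruct (continuity_ab_min _ a b Hab Hc) as [M [HM HM']].
  exists (Rabs (f M)). split; [apply Rabs_pos_lt; auto|].
  intros t r th Hr. apply HM; lra.
Qed.

Lemma bg_radial0 f : (forall r, a <= r <= b -> continuous f r) -> bg 0 (radial f).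
Proof.
  intros H. destruct (radial_bounded f H) as [C HC].
  split; auto. apply first_order_const with C; auto.
  intros t r th Hr. apply continuous3_radial, H; lra.
Qed.

Lemma partial_radial f f' c t r th : is_derive f r f' ->
  ex_partial c (radial f) t r th /\
  partial c (radial f) t r th = match c with cr => f' | _ => 0 end.
Proof.
  intros H; destruct c; split; try exact (@ex_derive_const R_AbsRing R_NormedModule (f r) _);
    try exact (Derive_const (f r) _).
  - now exists f'.
  - now apply is_derive_unique.
Qed.

Lemma bg_radial_S n f f' : (forall r, a <= r <= b -> is_derive f r (f' r)) ->
  bg n (radial f') -> bg (S n) (radial f).
Proof.
  intros H H'.
  assert (Hc : forall r, a <= r <= b -> continuous f r).
  { intros r Hr. apply (ex_derive_continuous (V := R_NormedModule)). eexists; apply H, Hr. }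
  assert (Hi : forall r, a < r < b -> is_derive f r (f' r)) by (intros; apply H; lra).
  split.
  - apply (pert_first_order _ _ 0), (bg_radial0 f Hc).
  - intros c. split; [|split; [|split]].
    + apply near_all. intros e t r th Hr. exact (proj1 (partial_radial f (f' r) c t r th (Hi r Hr))).
    + intros t r th Hr. exact (proj1 (partial_radial f (f' r) c t r th (Hi r Hr))).
    + intros t r th _. apply partial_fconst.
    + assert (E : eq_slab (partial c (radial f))
        (match c with cr => radial f' | _ => fconst 0 end)).
      { intros t r th Hr. rewrite (proj2 (partial_radial f (f' r) c t r th (Hi r Hr))).
        now destruct c. }
      eapply pert_ext with (A := fun _ => match c with cr => radial f' | _ => fconst 0 end)
        (A0 := match c with cr => radial f' | _ => fconst 0 end) (A1 := fconst 0).
      * apply near_all. intros e. now apply eq_slab_sym.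
      * now apply eq_slab_sym.
      * intros t r th _. symmetry. apply partial_fconst.
      * destruct c; auto; apply bg_const.
Qed.

End Slab2.

(** * First variation of an integral *)

Section Action.
Variables (a b : R) (B : box).
Hypotheses (ht : t0 B <= t1 B) (hr : r0 B <= r1 B) (hth : th0 B <= th1 B).
Hypotheses (ha : a < r0 B) (hb : r1 B < b).

(** The integral lemmas ask for continuity on all of space, the expansions give it on the slab.
    Composing with the projection of r to [[r0 B, r1 B]] repairs this and leaves integrals over the
    box unchanged. *)
Definition clamp (r : R) : R := Rmax (r0 B) (Rmin (r1 B) r).

Definition clamped (F : field) : field := fun t r th => F t (clamp r) th.

Lemma clamp_in r : r0 B <= clamp r <= r1 B.
Proof.
  unfold clamp. pose proof (Rmin_l (r1 B) r). split; [apply Rmax_l|].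
  apply Rmax_lub; lra.
Qed.

Lemma clamp_id r : r0 B <= r <= r1 B -> clamp r = r.
Proof. intros H. unfold clamp. rewrite Rmin_right, Rmax_right; lra. Qed.

Lemma clamp_lipschitz r s : Rabs (clamp r - clamp s) <= Rabs (r - s).
Proof.
  unfold clamp, Rmax, Rmin, Rabs.
  repeat (destruct (Rle_dec _ _) || destruct (Rcase_abs _)); lra.
Qed.

Lemma clamped_continuous F : slab a b continuous3 F ->
  forall t r th, continuous3 (clamped F) t r th.
Proof.
  intros H t r th. apply continuous3_locally. intros eps.
  pose proof (clamp_in r). assert (Hr : a < clamp r < b) by lra.
  destruct (proj1 (continuous3_locally F _ _ _) (H t (clamp r) th Hr) eps) as [d Hd].
  exists d. intros t' r' th' H1 H2 H3. apply Hd; auto.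
  eapply Rle_lt_trans; [apply clamp_lipschitz|auto].
Qed.

Lemma box_integral_clamped F : box_integral B (clamped F) = box_integral B F.
Proof.
  apply box_integral_ext; auto. intros t r th (_ & Hr & _).
  unfold clamped. now rewrite clamp_id.
Qed.

Lemma is_derive_box_integral A A0 A1 : first_order a b A A0 A1 ->
  is_derive (fun e => box_integral B (A e)) 0 (box_integral B A1).
Proof.
  intros HA. destruct (first_order_bounds _ _ _ _ _ HA) as (C & HC & _ & _ & BA).
  destruct HA as (C0 & C1 & CA & _).
  set (vol := (t1 B - t0 B) * ((r1 B - r0 B) * (th1 B - th0 B))).
  assert (Hvol : 0 <= vol).
  { apply Rmult_le_pos; [lra|]. apply Rmult_le_pos; lra. }
  destruct (near_and _ _ CA BA) as [d [Hd HN]].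
  assert (quad : forall e, Rabs e < d ->
    Rabs (box_integral B (A e) - box_integral B A0 - e * box_integral B A1)
      <= vol * C * (Rabs e * Rabs e)).
  { intros e He. destruct (HN e He) as [CE [_ BE]].
    rewrite <- (box_integral_clamped (A e)), <- (box_integral_clamped A0),
      <- (box_integral_clamped A1).
    pose proof (clamped_continuous _ CE) as K. pose proof (clamped_continuous _ C0) as K0.
    pose proof (clamped_continuous _ C1) as K1.
    assert (K' : forall t r th, continuous3 (fun t r th =>
        clamped A0 t r th + e * clamped A1 t r th) t r th).
    { intros t r th. apply (continuous_plus (V := R_NormedModule)); [apply K0|].
      apply (continuous_mult (K := R_AbsRing)); [apply continuous_const|apply K1]. }
    assert (K'' : forall t r th, continuous3 (fun t r th =>
        clamped (A e) t r th + -1 * (clamped A0 t r th + e * clamped A1 t r th)) t r th).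
    { intros t r th. apply (continuous_plus (V := R_NormedModule)); [apply K|].
      apply (continuous_mult (K := R_AbsRing)); [apply continuous_const|apply K']. }
    replace (_ - _ - _) with (box_integral B (fun t r th =>
        clamped (A e) t r th + -1 * (clamped A0 t r th + e * clamped A1 t r th))).
    2:{ rewrite (box_integral_lin B hr hth (clamped (A e)) _ (-1) K K').
        rewrite (box_integral_lin B hr hth (clamped A0) _ e K0 K1). ring. }
    eapply Rle_trans.
    - apply (box_integral_bound B ht hr hth _ (C * e ^ 2)); auto.
      intros t r th _. unfold clamped.
      pose proof (clamp_in r). assert (Hr : a < clamp r < b) by lra.
      destruct (BE t (clamp r) th Hr) as [BE' _].
      eapply Rle_trans; [|exact BE']. apply Req_le. f_equal. ring.
    - apply Req_le. unfold vol. rewrite <- (pow2_abs e). ring. }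
  apply is_derive_Reals. intros eps Heps.
  (* The difference quotient errs by at most [vol * C * Rabs h]; the added 1 covers a box of zero
     volume. *)
  assert (Hm : 0 < Rmin d (eps / (vol * C + 1))).
  { apply Rmin_pos; auto. apply Rdiv_lt_0_compat; nra. }
  exists (mkposreal _ Hm). simpl. intros h Hh0 Hh.
  pose proof (Rmin_l d (eps / (vol * C + 1))). pose proof (Rmin_r d (eps / (vol * C + 1))).
  rewrite Rplus_0_l.
  (* [A 0] is not assumed to be [A0]; the remainder estimate at [e = 0] forces equal integrals. *)
  assert (E0 : box_integral B (A 0) = box_integral B A0).
  { assert (H00 : Rabs 0 < d) by (rewrite Rabs_R0; lra).
    pose proof (quad 0 H00) as Q. rewrite Rabs_R0 in Q.
    pose proof (Rabs_pos (box_integral B (A 0) - box_integral B A0 - 0 * box_integral B A1)).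
    assert (Z : Rabs (box_integral B (A 0) - box_integral B A0 - 0 * box_integral B A1) = 0)
      by lra.
    destruct (Req_dec (box_integral B (A 0) - box_integral B A0 - 0 * box_integral B A1) 0)
      as [Z'|Z']; [lra|]. exact (False_ind _ (Rabs_no_R0 _ Z' Z)). }
  rewrite E0.
  assert (Hhd : Rabs h < d) by lra. pose proof (quad h Hhd) as Q.
  assert (Ph : 0 < Rabs h) by (apply Rabs_pos_lt; auto).
  replace (_ / h - _) with
    ((box_integral B (A h) - box_integral B A0 - h * box_integral B A1) / h)
    by (field; auto).
  unfold Rdiv. rewrite Rabs_mult, Rabs_inv.
  apply Rle_lt_trans with (vol * C * Rabs h).
  - apply (Rmult_le_reg_r (Rabs h)); auto.
    rewrite Rmult_assoc, Rinv_l by lra. lra.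
  - assert (Hx : Rabs h * (vol * C + 1) < eps).
    { assert (Hk : 0 < vol * C + 1) by nra.
      apply (Rmult_lt_compat_r _ _ _ Hk) in Hh.
      apply (Rmult_le_compat_r (vol * C + 1)) in H0; [|lra].
      replace (eps / (vol * C + 1) * (vol * C + 1)) with eps in H0 by (field; lra). lra. }
    lra.
Qed.

(** Clamping would destroy the derivative in r, so a field whose derivative is to be integrated is
    extended by zero instead; compact support makes the extension as regular as the field. *)
Definition zero_extension (F : field) : field := fun t r th =>
  if Rlt_dec a r then if Rlt_dec r b then F t r th else 0 else 0.

Lemma zero_extension_slab F : eq_slab a b F (zero_extension F).
Proof.
  intros t r th Hr. unfold zero_extension.
  destruct (Rlt_dec a r); [|lra]. destruct (Rlt_dec r b); [auto|lra].
Qed.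

Definition supported (F : field) : Prop :=
  forall t r th, a < r < b -> ~ in_box B t r th -> F t r th = 0.

(** The box lies strictly inside the slab, with margin [Rmin (r0 B - a) (b - r1 B)], so the
    extension vanishes around every radius outside the slab. *)
Lemma zero_extension_cases F r : supported F ->
  a < r < b \/ exists d : posreal, forall t' r' th', Rabs (r' - r) < d ->
    zero_extension F t' r' th' = 0.
Proof.
  intros HF. destruct (classic (a < r < b)) as [H|H]; [now left|right].
  assert (Hm : 0 < Rmin (r0 B - a) (b - r1 B)) by (apply Rmin_pos; lra).
  exists (mkposreal _ Hm). simpl. intros t' r' th' Hr'.
  pose proof (Rmin_l (r0 B - a) (b - r1 B)). pose proof (Rmin_r (r0 B - a) (b - r1 B)).
  apply Rabs_def2 in Hr'. unfold zero_extension.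
  destruct (Rlt_dec a r'); auto. destruct (Rlt_dec r' b); auto.
  apply HF; [lra|]. intros (_ & Hb & _). lra.
Qed.

Lemma zero_extension_continuous F : supported F -> slab a b continuous3 F ->
  forall t r th, continuous3 (zero_extension F) t r th.
Proof.
  intros HF HC t r th. destruct (zero_extension_cases F r HF) as [Hr|[d Hd]].
  - apply (continuous3_slab a b F); auto. apply zero_extension_slab.
  - apply continuous3_ext_loc with (fconst 0).
    + exists d. intros t' r' th' _ H2 _. symmetry; now apply Hd.
    + apply continuous_const.
Qed.

Lemma supported_partial F c : supported F -> supported (partial c F).
Proof.
  intros HF t r th Hr Hb.
  assert (loc : forall x u v, ~ (u <= x <= v) -> locally x (fun y => ~ (u <= y <= v))).
  { intros x u v Hx. destruct (Rlt_dec x u).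
    - eapply filter_imp; [|apply (open_lt u x); auto]. simpl; intros; lra.
    - eapply filter_imp; [|apply (open_gt v x); lra]. simpl; intros; lra. }
  (* Either another coordinate is already outside its range, and then the line misses the box, or
     the moving coordinate lies in the open complement of a closed interval. *)
  assert (loc3 : match c with
    | ct => locally t (fun s => F s r th = 0)
    | cr => locally r (fun s => F t s th = 0)
    | cth => locally th (fun s => F t r s = 0) end).
  { unfold in_box in Hb.
    destruct c.
    - destruct (classic (r0 B <= r <= r1 B /\ th0 B <= th <= th1 B)) as [H|H].
      + eapply filter_imp; [|apply (loc t (t0 B) (t1 B)); tauto].
        simpl; intros s Hs. apply HF; auto. unfold in_box; tauto.
      + apply filter_forall. intros s. apply HF; auto. unfold in_box; tauto.
    - destruct (classic (t0 B <= t <= t1 B /\ th0 B <= th <= th1 B)) as [H|H].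
      + eapply filter_imp; [|apply filter_and; [apply (loc r (r0 B) (r1 B)); tauto|
          apply (slab_locally a b r Hr)]].
        simpl; intros s [Hs Hs']. apply HF; auto. unfold in_box; tauto.
      + eapply filter_imp; [|apply (slab_locally a b r Hr)].
        simpl; intros s Hs. apply HF; auto. unfold in_box; tauto.
    - destruct (classic (t0 B <= t <= t1 B /\ r0 B <= r <= r1 B)) as [H|H].
      + eapply filter_imp; [|apply (loc th (th0 B) (th1 B)); tauto].
        simpl; intros s Hs. apply HF; auto. unfold in_box; tauto.
      + apply filter_forall. intros s. apply HF; auto. unfold in_box; tauto. }
  destruct c; simpl;
    (erewrite Derive_ext_loc; [apply (Derive_const 0)|exact loc3]).
Qed.

(** The zero extension is a representative with a continuous derivative on all of space, to which
    [box_integral_partial] applies. *)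
Lemma box_integral_divergence F c : supported F -> bg a b 1 F ->
  box_integral B (partial c F) = 0.
Proof.
  intros HF HB.
  assert (HP : eq_slab a b (partial c F) (partial c (zero_extension F)))
    by (apply partial_slab, zero_extension_slab).
  rewrite (box_integral_ext B ht hr hth _ (partial c (zero_extension F))).
  2:{ intros t r th (_ & Hr & _). apply HP. lra. }
  assert (PZ : forall t r th,
    partial c (zero_extension F) t r th = zero_extension (partial c F) t r th /\
    ex_partial c (zero_extension F) t r th).
  { intros t r th. destruct (zero_extension_cases F r HF) as [Hr|[d Hd]].
    - split.
      + rewrite <- HP by auto. now apply zero_extension_slab.
      + apply (ex_partial_slab a b c F); auto; [apply zero_extension_slab|].
        now apply (bg_ex_partial a b 0).
    - destruct (zero_extension_cases (partial c F) r (supported_partial F c HF))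
        as [Hr|[d' Hd']].
      { split.
        + rewrite <- HP by auto. now apply zero_extension_slab.
        + apply (ex_partial_slab a b c F); auto; [apply zero_extension_slab|].
          now apply (bg_ex_partial a b 0). }
      rewrite Hd' by (rewrite Rminus_diag, Rabs_R0; apply cond_pos).
      assert (Z : forall s, Rabs (s - r) < d -> forall t th, 0 = zero_extension F t s th)
        by (intros; symmetry; now apply Hd).
      assert (Zr : Rabs (r - r) < d) by (rewrite Rminus_diag, Rabs_R0; apply cond_pos).
      destruct c; simpl; split.
      + erewrite Derive_ext; [apply (Derive_const 0)|]. intros s; symmetry; now apply Z.
      + eapply ex_derive_ext; [|apply (@ex_derive_const R_AbsRing R_NormedModule 0)].
        intros s; now apply Z.
      + erewrite Derive_ext_loc; [apply (Derive_const 0)|].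
        exists d. intros s Hs. symmetry; now apply Z.
      + eapply ex_derive_ext_loc; [|apply (@ex_derive_const R_AbsRing R_NormedModule 0)].
        exists d. intros s Hs. now apply Z.
      + erewrite Derive_ext; [apply (Derive_const 0)|]. intros s; symmetry; now apply Z.
      + eapply ex_derive_ext; [|apply (@ex_derive_const R_AbsRing R_NormedModule 0)].
        intros s; now apply Z. }
  apply box_integral_partial; auto.
  - apply zero_extension_continuous; auto. now apply (bg_continuous3 a b 1).
  - intros t r th. apply continuous3_ext_loc with (zero_extension (partial c F)).
    + exists (mkposreal 1 Rlt_0_1). intros; symmetry; apply PZ.
    + apply zero_extension_continuous; [now apply supported_partial|].
      apply (bg_continuous3 a b 0). now apply bg_partial.
  - intros t r th; apply PZ.
  - intros t r th Hb. unfold zero_extension.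
    destruct (Rlt_dec a r); auto. destruct (Rlt_dec r b); auto.
Qed.

(** Compact support turns continuity of each iterated derivative into a bound on the unbounded slab.
    The induction runs over all lists of derivatives at once, as a further derivative is a longer
    list. *)
Lemma bg_test_function n eta : test_function B eta -> bg a b n eta.
Proof.
  intros [Hs H0].
  assert (S : forall n l, bg a b n (partials l eta)).
  { assert (V : forall l, supported (partials l eta)).
    { intros l. induction l as [|c l IH].
      - intros t r th _. apply H0.
      - now apply supported_partial. }
    assert (F1 : forall l, first_order a b (fun _ => partials l eta) (partials l eta) (fconst 0)).
    { intros l.
      destruct (bounded_on_box (partials l eta) B) as [C HC].
      { intros t r th. apply (Hs l t r th). }
      apply first_order_const with (Rabs C).
      - intros t r th _. apply (Hs l t r th).
      - intros t r th Hr.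
        destruct (classic (in_box B t r th)) as [Hb|Hb].
        + eapply Rle_trans; [apply HC; auto|apply Rle_abs].
        + rewrite V by auto. rewrite Rabs_R0. apply Rabs_pos. }
    intros m; induction m as [|m IH]; intros l; split; auto.
    intros c. split; [|split; [|split]].
    - apply near_all. intros e t r th _. apply (Hs l t r th).
    - intros t r th _. apply (Hs l t r th).
    - intros t r th _. apply partial_fconst.
    - eapply pert_ext; [| | |exact (IH (cons c l))].
      * apply near_all. intros e t r th _; reflexivity.
      * intros t r th _; reflexivity.
      * intros t r th _. symmetry; apply partial_fconst. }
  apply (S n nil).
Qed.

End Action.

(** * Variation of curvature and of the Lagrangian *)

Definition tensor3 := coord -> coord -> coord -> field.

(* christoffel g = christoffel_of (inverse g) g, bilinear in the two arguments *)
Definition christoffel_of (h g : tensor2) : tensor3 := fun a b c t r th =>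
  / 2 * sum3 (fun d => h a d t r th *
    (partial b (g d c) t r th + partial c (g d b) t r th
     - partial d (g b c) t r th)).

Definition ricci_of (Gam : tensor3) : tensor2 := fun a b t r th =>
  sum3 (fun c =>
    partial c (Gam c a b) t r th - partial b (Gam c a c) t r th
    + sum3 (fun d => Gam c c d t r th * Gam d a b t r th
        - Gam c b d t r th * Gam d a c t r th)).

(** [k] and [q] stand for the variations of [h] and [g]; their relation, [q = lowered f k], enters
    only for the static metric. *)
Definition christoffel_variation (h k g q : tensor2) : tensor3 := fun a b c t r th =>
  christoffel_of k g a b c t r th + christoffel_of h q a b c t r th.

(** The plain Leibniz linearisation in partial derivatives; covariant derivatives are avoided
    because the static connection is explicit. *)
Definition ricci_variation (Gam Gam' : tensor3) : tensor2 := fun a b t r th =>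
  sum3 (fun c =>
    partial c (Gam' c a b) t r th - partial b (Gam' c a c) t r th
    + sum3 (fun d =>
        (Gam' c c d t r th * Gam d a b t r th + Gam c c d t r th * Gam' d a b t r th)
        - (Gam' c b d t r th * Gam d a c t r th
           + Gam c b d t r th * Gam' d a c t r th))).

Definition trace_of (h S : tensor2) : field := fun t r th =>
  sum3 (fun a => sum3 (fun b => h a b t r th * S a b t r th)).

Definition raise_of (h : tensor2) (P : coord -> field) (a : coord) : field :=
  fun t r th => sum3 (fun b => h a b t r th * P b t r th).

Definition quadratic_of (S : tensor2) (v w : coord -> field) : field := fun t r th =>
  sum3 (fun a => sum3 (fun b => S a b t r th * v a t r th * w b t r th)).

Section Perturbation.
Variables a b : R.
Notation pert := (pert a b).

Lemma pert_sum3 n (A : coord -> R -> field) A0 A1 :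
  (forall c, pert n (A c) (A0 c) (A1 c)) ->
  pert n (fun e t r th => sum3 (fun c => A c e t r th))
    (fun t r th => sum3 (fun c => A0 c t r th))
    (fun t r th => sum3 (fun c => A1 c t r th)).
Proof.
  intros H. unfold sum3. apply pert_plus; [apply pert_plus|]; apply H.
Qed.

Lemma pert_christoffel n g g0 g1 h h0 h1 :
  (forall i j, pert (S n) (fun e => g e i j) (g0 i j) (g1 i j)) ->
  (forall i j, pert n (fun e => h e i j) (h0 i j) (h1 i j)) ->
  forall i j l, pert n (fun e => christoffel_of (h e) (g e) i j l)
    (christoffel_of h0 g0 i j l) (christoffel_variation h0 h1 g0 g1 i j l).
Proof.
  intros Hg Hh i j l.
  assert (D : forall c i j, pert n (fun e => partial c (g e i j))
    (partial c (g0 i j)) (partial c (g1 i j))).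
  { intros c i' j'. apply (pert_partial a b n (fun e => g e i' j')), Hg. }
  eapply pert_ext; [| | |apply pert_scal, pert_sum3; intros d;
    apply pert_mult; [apply Hh|apply pert_minus; [apply pert_plus|]; apply D]].
  - apply near_all. intros e t r th _; reflexivity.
  - intros t r th _; reflexivity.
  - intros t r th _. unfold christoffel_variation, christoffel_of, sum3. ring.
Qed.

Lemma pert_ricci n (Gam : R -> tensor3) Gam0 Gam1 :
  (forall i j l, pert (S n) (fun e => Gam e i j l) (Gam0 i j l) (Gam1 i j l)) ->
  forall i j, pert n (fun e => ricci_of (Gam e) i j)
    (ricci_of Gam0 i j) (ricci_variation Gam0 Gam1 i j).
Proof.
  intros H i j.
  assert (D : forall c i j l, pert n (fun e => partial c (Gam e i j l))
    (partial c (Gam0 i j l)) (partial c (Gam1 i j l))).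
  { intros c i' j' l'. apply (pert_partial a b n (fun e => Gam e i' j' l')), H. }
  assert (L : forall i j l, pert n (fun e => Gam e i j l) (Gam0 i j l) (Gam1 i j l)).
  { intros i' j' l'. apply pert_pred, H. }
  apply pert_sum3; intros c. apply pert_plus.
  - apply pert_minus; apply D.
  - apply pert_sum3; intros d. apply pert_minus; apply pert_mult; apply L.
Qed.

Lemma pert_trace n h h0 h1 (S : R -> tensor2) S0 S1 :
  (forall i j, pert n (fun e => h e i j) (h0 i j) (h1 i j)) ->
  (forall i j, pert n (fun e => S e i j) (S0 i j) (S1 i j)) ->
  pert n (fun e => trace_of (h e) (S e)) (trace_of h0 S0)
    (fun t r th => trace_of h1 S0 t r th + trace_of h0 S1 t r th).
Proof.
  intros Hh HS.
  eapply pert_ext; [| | |apply pert_sum3; intros i; apply pert_sum3; intros j;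
    apply pert_mult; [apply Hh|apply HS]].
  - apply near_all. intros e t r th _; reflexivity.
  - intros t r th _; reflexivity.
  - intros t r th _. unfold trace_of, sum3. ring.
Qed.

Lemma pert_raise n h h0 h1 (P : R -> coord -> field) P0 P1 :
  (forall i j, pert n (fun e => h e i j) (h0 i j) (h1 i j)) ->
  (forall i, pert n (fun e => P e i) (P0 i) (P1 i)) ->
  forall i, pert n (fun e => raise_of (h e) (P e) i) (raise_of h0 P0 i)
    (fun t r th => raise_of h1 P0 i t r th + raise_of h0 P1 i t r th).
Proof.
  intros Hh HP i.
  eapply pert_ext; [| | |apply pert_sum3; intros j; apply pert_mult; [apply Hh|apply HP]].
  - apply near_all. intros e t r th _; reflexivity.
  - intros t r th _; reflexivity.
  - intros t r th _. unfold raise_of, sum3. ring.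
Qed.

Lemma pert_quadratic n (S : R -> tensor2) S0 S1 (v : R -> coord -> field) v0 v1 :
  (forall i j, pert n (fun e => S e i j) (S0 i j) (S1 i j)) ->
  (forall i, pert n (fun e => v e i) (v0 i) (v1 i)) ->
  pert n (fun e => quadratic_of (S e) (v e) (v e)) (quadratic_of S0 v0 v0)
    (fun t r th => quadratic_of S1 v0 v0 t r th
      + (quadratic_of S0 v1 v0 t r th + quadratic_of S0 v0 v1 t r th)).
Proof.
  intros HS Hv.
  eapply pert_ext; [| | |apply pert_sum3; intros i; apply pert_sum3; intros j;
    apply pert_mult; [apply pert_mult; [apply HS|]|]; apply Hv].
  - apply near_all. intros e t r th _; reflexivity.
  - intros t r th _; reflexivity.
  - intros t r th _. unfold quadratic_of, sum3. ring.
Qed.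

(** The kinetic term, the Ricci term and the scalar curvature are independent arguments, so that one
    linearisation serves both the metric and the scalar variation. *)
Definition Q_of (T : theory) (X C K : field) : field := fun t r th =>
  sum_n_m (fun n => alpha T n * L T ^ (2 * (n - 1)) * X t r th ^ n) 1 (Defs.N T)
  - sum_n_m (fun m => beta T m * L T ^ (2 * (m + 1)) * X t r th ^ m *
      ((3 + 2 * INR m) * C t r th - X t r th * K t r th)) 0 (M T).

Definition Q_variation (T : theory) (X C K X' C' K' : field) : field := fun t r th =>
  sum_n_m (fun n => alpha T n * L T ^ (2 * (n - 1)) *
      (INR n * X t r th ^ (n - 1) * X' t r th)) 1 (Defs.N T)
  - sum_n_m (fun m => beta T m * L T ^ (2 * (m + 1)) *
      (INR m * X t r th ^ (m - 1) * X' t r th) *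
      ((3 + 2 * INR m) * C t r th - X t r th * K t r th)
      + beta T m * L T ^ (2 * (m + 1)) * X t r th ^ m *
      ((3 + 2 * INR m) * C' t r th
        - (X' t r th * K t r th + X t r th * K' t r th))) 0 (M T).

Lemma pert_Q n T X X0 X1 C C0 C1 K K0 K1 :
  pert n X X0 X1 -> pert n C C0 C1 -> pert n K K0 K1 ->
  pert n (fun e => Q_of T (X e) (C e) (K e)) (Q_of T X0 C0 K0)
    (Q_variation T X0 C0 K0 X1 C1 K1).
Proof.
  intros HX HC HK.
  apply pert_minus.
  - apply (pert_sum_n_m a b n (fun i e t r th => alpha T i * L T ^ (2 * (i - 1)) * X e t r th ^ i)
      (fun i t r th => alpha T i * L T ^ (2 * (i - 1)) * X0 t r th ^ i)
      (fun i t r th => alpha T i * L T ^ (2 * (i - 1)) * (INR i * X0 t r th ^ (i - 1) * X1 t r th))).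
    intros i. apply pert_scal, pert_pow, HX.
  - apply (pert_sum_n_m a b n (fun m e t r th => beta T m * L T ^ (2 * (m + 1)) * X e t r th ^ m *
        ((3 + 2 * INR m) * C e t r th - X e t r th * K e t r th))
      (fun m t r th => beta T m * L T ^ (2 * (m + 1)) * X0 t r th ^ m *
        ((3 + 2 * INR m) * C0 t r th - X0 t r th * K0 t r th))
      (fun m t r th => beta T m * L T ^ (2 * (m + 1)) *
      (INR m * X0 t r th ^ (m - 1) * X1 t r th) *
      ((3 + 2 * INR m) * C0 t r th - X0 t r th * K0 t r th)
      + beta T m * L T ^ (2 * (m + 1)) * X0 t r th ^ m *
      ((3 + 2 * INR m) * C1 t r th
        - (X1 t r th * K0 t r th + X0 t r th * K1 t r th)))).
    intros i. apply pert_mult.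
    + apply pert_scal, pert_pow, HX.
    + apply pert_minus; [apply pert_scal, HC|apply pert_mult; auto].
Qed.

(** Covers both variations at once. The square root is handed over separately, as its expansion
    needs a positive lower bound; the zeroth order term stays existential because only the first
    order one is integrated. *)
Lemma pert_lagrangian T (g : R -> tensor2) (phi : R -> field) s0 s1 g0 g1 h0 h1 P0 P1 :
  pert 0 (fun e t r th => sqrt (- determinant (g e) t r th)) s0 s1 ->
  (forall i j, pert 2 (fun e => g e i j) (g0 i j) (g1 i j)) ->
  (forall i j, pert 1 (fun e => inverse (g e) i j) (h0 i j) (h1 i j)) ->
  (forall i, pert 0 (fun e => partial i (phi e)) (P0 i) (P1 i)) ->
  let Gam := christoffel_of h0 g0 in
  let Ric := ricci_of Gam in
  let Ric' := ricci_variation Gam (christoffel_variation h0 h1 g0 g1) in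
  let v := raise_of h0 P0 in
  let v' i t r th := raise_of h1 P0 i t r th + raise_of h0 P1 i t r th in
  let K := trace_of h0 Ric in
  let K' t r th := trace_of h1 Ric t r th + trace_of h0 Ric' t r th in
  let X := quadratic_of h0 P0 P0 in
  let X' t r th := quadratic_of h1 P0 P0 t r th
    + (quadratic_of h0 P1 P0 t r th + quadratic_of h0 P0 P1 t r th) in
  let C := quadratic_of Ric v v in
  let C' t r th := quadratic_of Ric' v v t r th
    + (quadratic_of Ric v' v t r th + quadratic_of Ric v v' t r th) in
  exists L0, pert 0 (fun e => lagrangian T (g e) (phi e)) L0
    (fun t r th => / (16 * PI * G T) *
      (s1 t r th * (K t r th + 2 / L T ^ 2 - Q_of T X C K t r th)
       + s0 t r th * (K' t r th - Q_variation T X C K X' C' K' t r th))).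
Proof.
  intros Hs Hg Hh HP Gam Ric Ric' v v' K K' X X' C C'.
  assert (Hh0 : forall i j, pert 0 (fun e => inverse (g e) i j) (h0 i j) (h1 i j))
    by (intros; apply pert_pred, Hh).
  pose proof (pert_christoffel 1 g g0 g1 (fun e => inverse (g e)) h0 h1 Hg Hh) as HGam.
  pose proof (pert_ricci 0 _ _ _ HGam) as HRic.
  pose proof (pert_trace 0 _ _ _ _ _ _ Hh0 HRic) as HR.
  pose proof (pert_raise 0 _ _ _ _ _ _ Hh0 HP) as Hv.
  pose proof (pert_quadratic 0 _ _ _ _ _ _ Hh0 HP) as HX.
  pose proof (pert_quadratic 0 _ _ _ _ _ _ HRic Hv) as HC.
  pose proof (pert_Q 0 T _ _ _ _ _ _ _ _ _ HX HC HR) as HQ.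
  eexists. eapply pert_ext; [| | |apply pert_scal, pert_mult; [exact Hs|
    apply pert_minus; [apply pert_plus; [exact HR|apply (pert_const a b 0 (2 / L T ^ 2))]|
      exact HQ]]].
  - apply near_all. intros e t r th _. reflexivity.
  - intros t r th _; reflexivity.
  - intros t r th _. unfold fconst. cbv beta.
    change (trace_of h0 (ricci_of (christoffel_of h0 g0)) t r th) with (K t r th).
    unfold K', X', C', v', X, C, K, v, Ric', Ric, Gam. ring.
Qed.

End Perturbation.

(** * The static background *)

(** The 2x2 minors of the adjugate are the determinant times the entries of the matrix; two
    divisions by the determinant leave one inverse power of it. *)
Lemma cofactor_inverse (u : tensor2) i j t r th :
  determinant u t r th <> 0 ->
  cofactor (inverse u) i j t r th = u j i t r th / determinant u t r th.
Proof.
  intros HD. unfold inverse. set (D := determinant u) in *.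
  assert (E : forall c1 c2 c3 c4 x : R, c1 * c2 - c3 * c4 = x * D t r th ->
    c1 / D t r th * (c2 / D t r th) - c3 / D t r th * (c4 / D t r th) = x / D t r th).
  { intros c1 c2 c3 c4 x H.
    replace (c1 / D t r th * (c2 / D t r th) - c3 / D t r th * (c4 / D t r th))
      with ((c1 * c2 - c3 * c4) / D t r th / D t r th) by (field; auto).
    rewrite H. field; auto. }
  unfold cofactor at 1. apply E. unfold D, determinant, sum3, cofactor.
  destruct i, j; simpl; ring.
Qed.

Lemma determinant_inverse (u : tensor2) t r th :
  determinant u t r th <> 0 ->
  determinant (inverse u) t r th = / determinant u t r th.
Proof.
  intros HD. unfold determinant at 1, sum3. rewrite !cofactor_inverse by auto.
  unfold inverse.
  apply (Rmult_eq_reg_r (determinant u t r th * determinant u t r th));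
    [|now apply Rmult_integral_contrapositive].
  field_simplify; auto.
  unfold determinant, cofactor, sum3; simpl; ring.
Qed.

(** This is what makes [g^{ab} + eps k^{ab}] the actual inverse of [vary_metric], wherever its
    determinant is nonzero. *)
Lemma inverse_inverse (u : tensor2) i j t r th :
  determinant u t r th <> 0 -> inverse (inverse u) i j t r th = u i j t r th.
Proof.
  intros HD. unfold inverse at 1. rewrite cofactor_inverse, determinant_inverse by auto.
  field; auto.
Qed.

Definition inverse_static (f : R -> R) : tensor2 := fun i j t r th =>
  match i, j with
  | ct, ct => - / f r
  | cr, cr => f r
  | cth, cth => / r ^ 2
  | _, _ => 0
  end.

Lemma cofactor_static f i j t r th : f r <> 0 ->
  cofactor (static_metric f) i j t r th =
  match i, j with
  | ct, ct => / f r * r ^ 2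
  | cr, cr => - f r * r ^ 2
  | cth, cth => - 1
  | _, _ => 0
  end.
Proof. intros Hf; destruct i, j; unfold cofactor; simpl; field; auto. Qed.

Lemma determinant_static f t r th : f r <> 0 ->
  determinant (static_metric f) t r th = - r ^ 2.
Proof. intros Hf; unfold determinant, sum3. rewrite !cofactor_static by auto. simpl; field; auto. Qed.

Lemma inverse_static_correct f i j t r th : f r <> 0 -> r <> 0 ->
  inverse (static_metric f) i j t r th = inverse_static f i j t r th.
Proof.
  intros Hf Hr. unfold inverse. rewrite cofactor_static, determinant_static by auto.
  destruct i, j; simpl; field; auto.
Qed.

(** An inverse matrix changes to first order by [- g k g], which for a diagonal metric is one factor
    per component. The values 0 of t and theta are arbitrary, the metric depending on r only. *)
Definition lowering (f : R -> R) (i j : coord) (r : R) : R :=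
  - static_metric f i i 0 r 0 * static_metric f j j 0 r 0.

Definition lowered (f : R -> R) (k : tensor2) : tensor2 := fun i j t r th =>
  lowering f i j r * k i j t r th.

Definition lowering' (f f1 : R -> R) (i j : coord) (r : R) : R :=
  match i, j with
  | ct, ct => - (2 * f r * f1 r)
  | cr, cr => 2 * f1 r / f r ^ 3
  | cth, cth => - (4 * r ^ 3)
  | ct, cr | cr, ct => 0
  | ct, cth | cth, ct => f1 r * r ^ 2 + f r * (2 * r)
  | cr, cth | cth, cr => - (2 * r / f r - r ^ 2 * f1 r / f r ^ 2)
  end.

Definition static_metric' (f f1 : R -> R) (i j : coord) (r : R) : R :=
  match i, j with
  | ct, ct => - f1 r
  | cr, cr => - f1 r / f r ^ 2
  | cth, cth => 2 * r
  | _, _ => 0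
  end.

Definition christoffel_static (f f1 : R -> R) (i j l : coord) (r : R) : R :=
  match i, j, l with
  | ct, ct, cr | ct, cr, ct => f1 r / (2 * f r)
  | cr, ct, ct => f r * f1 r / 2
  | cr, cr, cr => - f1 r / (2 * f r)
  | cr, cth, cth => - (r * f r)
  | cth, cr, cth | cth, cth, cr => / r
  | _, _, _ => 0
  end.

Definition christoffel_static' (f f1 f2 : R -> R) (i j l : coord) (r : R) : R :=
  match i, j, l with
  | ct, ct, cr | ct, cr, ct => (f2 r * f r - f1 r ^ 2) / (2 * f r ^ 2)
  | cr, ct, ct => (f1 r ^ 2 + f r * f2 r) / 2
  | cr, cr, cr => - (f2 r * f r - f1 r ^ 2) / (2 * f r ^ 2)
  | cr, cth, cth => - (f r + r * f1 r)
  | cth, cr, cth | cth, cth, cr => - / r ^ 2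
  | _, _, _ => 0
  end.

Definition ricci_static (f f1 f2 : R -> R) (i j : coord) (r : R) : R :=
  match i, j with
  | ct, ct => f r * (f2 r / 2 + f1 r / (2 * r))
  | cr, cr => - (f2 r / 2 + f1 r / (2 * r)) / f r
  | cth, cth => - (r * f1 r)
  | _, _ => 0
  end.

Section Static.
Variables (a b : R) (f f1 f2 : R -> R).
Hypotheses (ha : 0 < a) (hab : a <= b).
Hypothesis f_neq0 : forall r, a <= r <= b -> f r <> 0.
Hypothesis f_derive : forall r, a <= r <= b -> is_derive f r (f1 r).
Hypothesis f1_derive : forall r, a <= r <= b -> is_derive f1 r (f2 r).
Hypothesis f2_continuous : forall r, a <= r <= b -> continuous f2 r.

Ltac derive_radial r Hr :=
  let Hf := fresh in let Hf' := fresh in let H0 := fresh in let Hp := fresh in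
  let D := fresh in let D' := fresh in
  pose proof (f_derive r Hr) as Hf; pose proof (f1_derive r Hr) as Hf';
  pose proof (f_neq0 r Hr) as H0; assert (Hp : r <> 0) by lra;
  assert (D : Derive (fun x => f x) r = f1 r) by exact (is_derive_unique _ _ _ Hf);
  assert (D' : Derive (fun x => f1 x) r = f2 r) by exact (is_derive_unique _ _ _ Hf');
  auto_derive;
  [ repeat split; auto; try (eexists; eassumption);
    try (apply Rmult_integral_contrapositive; split; auto; lra)
  | rewrite ?D, ?D'; field; auto ].

Lemma derive_static_metric i j r : a <= r <= b ->
  is_derive (fun r => static_metric f i j 0 r 0) r (static_metric' f f1 i j r).
Proof. intros Hr. destruct i, j; simpl; derive_radial r Hr. Qed.

Lemma derive_lowering i j r : a <= r <= b ->
  is_derive (lowering f i j) r (lowering' f f1 i j r).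
Proof. intros Hr. unfold lowering. destruct i, j; simpl; derive_radial r Hr. Qed.

Lemma derive_christoffel_static i j l r : a <= r <= b ->
  is_derive (christoffel_static f f1 i j l) r (christoffel_static' f f1 f2 i j l r).
Proof. intros Hr. unfold christoffel_static. destruct i, j, l; simpl; derive_radial r Hr. Qed.

Lemma partial_static_metric c i j t r th : a < r < b ->
  partial c (static_metric f i j) t r th =
  match c with cr => static_metric' f f1 i j r | _ => 0 end.
Proof.
  intros Hr. assert (Hr' : a <= r <= b) by lra.
  rewrite <- (proj2 (partial_radial _ _ c t r th (derive_static_metric i j r Hr'))).
  now destruct c, i, j.
Qed.

Lemma christoffel_static_correct i j l :
  eq_slab a b (christoffel_of (inverse_static f) (static_metric f) i j l)
    (radial (christoffel_static f f1 i j l)).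
Proof.
  intros t r th Hr. unfold christoffel_of, sum3, radial.
  rewrite !partial_static_metric by auto.
  assert (Hr' : a <= r <= b) by lra. pose proof (f_neq0 r Hr').
  assert (r <> 0) by lra.
  destruct i, j, l; simpl; try ring; field; auto.
Qed.

Lemma partial_christoffel_static c i j l t r th : a < r < b ->
  partial c (christoffel_of (inverse_static f) (static_metric f) i j l) t r th =
  match c with cr => christoffel_static' f f1 f2 i j l r | _ => 0 end.
Proof.
  intros Hr. assert (Hr' : a <= r <= b) by lra.
  rewrite (partial_slab a b c _ _ (christoffel_static_correct i j l)) by auto.
  exact (proj2 (partial_radial _ _ c t r th (derive_christoffel_static i j l r Hr'))).
Qed.

Lemma ricci_static_correct i j t r th : a < r < b ->
  ricci_of (christoffel_of (inverse_static f) (static_metric f)) i j t r th =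
  ricci_static f f1 f2 i j r.
Proof.
  intros Hr. unfold ricci_of, sum3.
  rewrite !partial_christoffel_static, !christoffel_static_correct by auto.
  unfold radial.
  assert (Hr' : a <= r <= b) by lra. pose proof (f_neq0 r Hr').
  assert (r <> 0) by lra.
  destruct i, j; simpl; try ring; field; auto.
Qed.

End Static.

(** * Variations of the static metric *)

Section Metric.
Variables (a b : R) (f f1 f2 : R -> R).
Hypotheses (ha : 0 < a) (hab : a <= b).
Hypothesis f_neq0 : forall r, a <= r <= b -> f r <> 0.
Hypothesis f_derive : forall r, a <= r <= b -> is_derive f r (f1 r).
Hypothesis f1_derive : forall r, a <= r <= b -> is_derive f1 r (f2 r).
Hypothesis f2_continuous : forall r, a <= r <= b -> continuous f2 r.

Lemma f_continuous r : a <= r <= b -> continuous f r.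
Proof.
  intros Hr. apply (ex_derive_continuous (V := R_NormedModule)).
  eexists; apply f_derive, Hr.
Qed.

Lemma bg_inv_radial n g : bg a b n (radial g) ->
  (forall r, a <= r <= b -> continuous g r) -> (forall r, a <= r <= b -> g r <> 0) ->
  bg a b n (radial (fun r => / g r)).
Proof.
  intros H Hc H0. destruct (radial_away a b hab g Hc H0) as [c [Hc0 Haw]].
  eapply pert_ext; [| | |apply (pert_inv a b n (fun _ => radial g) _ _ c H Hc0 Haw)].
  - apply near_all. intros e t r th _; reflexivity.
  - intros t r th _; reflexivity.
  - intros t r th _. unfold fconst; ring.
Qed.

Lemma bg_f : bg a b 2 (radial f).
Proof.
  apply (bg_radial_S a b hab 1 f f1 f_derive).
  apply (bg_radial_S a b hab 0 f1 f2 f1_derive).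
  now apply bg_radial0.
Qed.

Lemma bg_id n : bg a b n (radial (fun r => r)).
Proof.
  destruct n as [|n].
  - apply bg_radial0; auto. intros; apply continuous_id.
  - apply (bg_radial_S a b hab n (fun r => r) (fun _ => 1)).
    + intros r _. apply (is_derive_id (K := R_AbsRing)).
    + apply bg_const.
Qed.

Lemma bg_sqr n : bg a b n (radial (fun r => r ^ 2)).
Proof.
  eapply bg_ext; [|apply bg_mult; apply bg_id].
  intros t r th _. unfold radial. ring.
Qed.

Lemma sqr_neq0 r : a <= r <= b -> r ^ 2 <> 0.
Proof. intros Hr. apply pow_nonzero; lra. Qed.

Lemma sqr_continuous r : a <= r <= b -> continuous (fun r => r ^ 2) r.
Proof.
  intros _. apply (ex_derive_continuous (V := R_NormedModule)). now auto_derive.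
Qed.

Lemma bg_inverse_static i j : bg a b 2 (inverse_static f i j).
Proof.
  pose proof (bg_inv_radial 2 f bg_f f_continuous f_neq0) as H.
  pose proof (bg_inv_radial 2 _ (bg_sqr 2) sqr_continuous sqr_neq0) as H'.
  pose proof (bg_const a b 2 0) as Z.
  destruct i, j; [|exact Z|exact Z|exact Z| |exact Z|exact Z|exact Z|].
  - eapply bg_ext; [|apply bg_mult; [apply (bg_const a b 2 (-1))|exact H]].
    intros t r th _. unfold fconst, radial; simpl; ring.
  - exact bg_f.
  - exact H'.
Qed.

Variable k : tensor2.
Hypothesis k_bg : forall n i j, bg a b n (k i j).
Hypothesis k_sym : forall i j, k i j = k j i.

Definition upper (e : R) : tensor2 := fun i j t r th =>
  inverse (static_metric f) i j t r th + e * k i j t r th.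

Lemma slab_neq0 r : a < r < b -> f r <> 0 /\ r <> 0.
Proof. intros Hr. split; [apply f_neq0|]; lra. Qed.

Lemma pert_upper i j :
  pert a b 2 (fun e => upper e i j) (inverse_static f i j) (k i j).
Proof.
  eapply pert_ext; [| | |apply (pert_affine a b 2 _ _ (bg_inverse_static i j) (k_bg 2 i j))].
  - apply near_all. intros e t r th Hr. unfold upper.
    destruct (slab_neq0 r Hr). now rewrite inverse_static_correct.
  - intros t r th _; reflexivity.
  - intros t r th _; reflexivity.
Qed.

Definition cofactor_variation (i j : coord) : field := fun t r th =>
  let h := inverse_static f in
  let i' := next i in let i'' := next i' in let j' := next j in let j'' := next j' in
  (k i' j' t r th * h i'' j'' t r th + h i' j' t r th * k i'' j'' t r th)
  - (k i' j'' t r th * h i'' j' t r th + h i' j'' t r th * k i'' j' t r th).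

Lemma pert_cofactor_upper i j :
  pert a b 2 (fun e => cofactor (upper e) i j) (cofactor (inverse_static f) i j)
    (cofactor_variation i j).
Proof. apply pert_minus; apply pert_mult; apply pert_upper. Qed.

(** Jacobi's formula: the first order coefficient is the determinant [- / r ^ 2] of the inverse
    static metric times the trace of [k] against the metric. *)
Lemma pert_determinant_upper :
  pert a b 2 (fun e => determinant (upper e)) (radial (fun r => - / r ^ 2))
    (fun t r th => - / r ^ 2 *
      (sum3 (fun i => static_metric f i i t r th * k i i t r th))).
Proof.
  eapply pert_ext; [| | |apply (pert_sum3 a b 2
    (fun c e t r th => upper e ct c t r th * cofactor (upper e) ct c t r th));
    intros c; apply pert_mult; [apply pert_upper|apply pert_cofactor_upper]].
  - apply near_all. intros e t r th _; reflexivity.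
  - intros t r th Hr. destruct (slab_neq0 r Hr).
    unfold sum3, cofactor, radial; simpl. field; auto.
  - intros t r th Hr. destruct (slab_neq0 r Hr).
    unfold sum3, cofactor, cofactor_variation; simpl. field; auto.
Qed.

Lemma determinant_away :
  exists c, 0 < c /\ away a b c (radial (fun r => - / r ^ 2)).
Proof.
  apply radial_away; auto.
  - intros r Hr. apply (ex_derive_continuous (V := R_NormedModule)). auto_derive.
    exact (sqr_neq0 r Hr).
  - intros r Hr. apply Ropp_neq_0_compat, Rinv_neq_0_compat, sqr_neq0, Hr.
Qed.

Lemma determinant_upper_neq0 :
  near (fun e => forall t r th, a < r < b -> determinant (upper e) t r th <> 0).
Proof.
  destruct determinant_away as [c [Hc H]].
  pose proof (pert_first_order _ _ _ _ _ _ pert_determinant_upper) as HD.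
  eapply near_imp; [|apply (first_order_away a b _ _ _ c HD Hc H)].
  intros e He. assert (Hc2 : 0 < c / 2) by lra. exact (away_neq0 a b _ _ Hc2 He).
Qed.

(** For small [e] this is the determinant of the varied metric. It is used twice: to divide the
    cofactors in [pert_vary_metric] and under the square root in the volume factor. *)
Lemma pert_inverse_determinant_upper :
  pert a b 2 (fun e t r th => / determinant (upper e) t r th) (radial (fun r => - r ^ 2))
    (fun t r th => r ^ 2 *
      (sum3 (fun i => static_metric f i i t r th * k i i t r th))).
Proof.
  destruct determinant_away as [c [Hc H]].
  eapply pert_ext; [| | |apply (pert_inv a b 2 _ _ _ c pert_determinant_upper Hc H)].
  - apply near_all. intros e t r th _; reflexivity.
  - intros t r th Hr. destruct (slab_neq0 r Hr). unfold radial. field; auto.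
  - intros t r th Hr. destruct (slab_neq0 r Hr).
    unfold sum3, radial; simpl. field; auto.
Qed.

Lemma pert_vary_metric i j :
  pert a b 2 (fun e => vary_metric (static_metric f) k e i j) (static_metric f i j)
    (lowered f k i j).
Proof.
  eapply pert_ext; [| | |apply (pert_mult _ _ _ _ _ _ _ _ _ (pert_cofactor_upper j i)
    pert_inverse_determinant_upper)].
  - apply near_all. intros e t r th _; reflexivity.
  - intros t r th Hr. destruct (slab_neq0 r Hr).
    unfold cofactor, radial; destruct i, j; simpl; field; auto.
  - intros t r th Hr. destruct (slab_neq0 r Hr).
    unfold cofactor, cofactor_variation, radial, lowered, lowering, sum3.
    destruct i, j; simpl; field; auto.
Qed.

Lemma pert_inverse_vary_metric i j :
  pert a b 2 (fun e => inverse (vary_metric (static_metric f) k e) i j)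
    (inverse_static f i j) (k i j).
Proof.
  eapply pert_ext; [| | |apply pert_upper].
  - eapply near_imp; [|exact determinant_upper_neq0]. intros e He t r th Hr.
    symmetry. apply (inverse_inverse (upper e)). now apply He.
  - intros t r th _; reflexivity.
  - intros t r th _; reflexivity.
Qed.

Lemma pert_sqrt_determinant :
  pert a b 0 (fun e t r th => sqrt (- determinant (vary_metric (static_metric f) k e) t r th))
    (radial (fun r => r))
    (fun t r th => - / 2 * r *
      (sum3 (fun i => static_metric f i i t r th * k i i t r th))).
Proof.
  assert (P : pert a b 0
    (fun e t r th => - determinant (vary_metric (static_metric f) k e) t r th)
    (radial (fun r => r ^ 2))
    (fun t r th => - r ^ 2 *
      (sum3 (fun i => static_metric f i i t r th * k i i t r th)))).
  { eapply pert_ext; [| | |apply pert_opp, (pert_le a b 2 0);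
      [auto|exact pert_inverse_determinant_upper]].
    - eapply near_imp; [|exact determinant_upper_neq0]. intros e He t r th Hr.
      rewrite <- (determinant_inverse (upper e)) by (now apply He). reflexivity.
    - intros t r th _. unfold radial; ring.
    - intros t r th _. ring. }
  assert (Ha : 0 < a ^ 2) by (apply pow_lt; auto).
  split; auto.
  eapply first_order_ext; [| | |apply (first_order_sqrt a b _ _ _ (a ^ 2)
    (pert_first_order _ _ _ _ _ _ P) Ha)].
  - apply near_all. intros e t r th _; reflexivity.
  - intros t r th Hr. unfold radial. apply sqrt_pow2; lra.
  - intros t r th Hr. unfold radial. rewrite sqrt_pow2 by lra. field; lra.
  - intros t r th Hr. unfold radial. apply pow_incr; lra.
Qed.

(** * The varied connection of the static metric *)

Lemma pert_christoffel_vary i j l :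
  pert a b 1 (fun e => christoffel (vary_metric (static_metric f) k e) i j l)
    (christoffel_of (inverse_static f) (static_metric f) i j l)
    (christoffel_variation (inverse_static f) k (static_metric f) (lowered f k) i j l).
Proof.
  apply (pert_christoffel a b 1 (fun e => vary_metric (static_metric f) k e)
    (static_metric f) (lowered f k)
    (fun e => inverse (vary_metric (static_metric f) k e)) (inverse_static f) k).
  - apply pert_vary_metric.
  - intros i' j'. apply pert_pred, pert_inverse_vary_metric.
Qed.

Notation Gam' := (christoffel_variation (inverse_static f) k (static_metric f) (lowered f k)).

Lemma partial_radial_mult g g' F c t r th : is_derive g r g' ->
  ex_partial c F t r th ->
  partial c (fun t r th => g r * F t r th) t r th =
  (match c with cr => g' | _ => 0 end) * F t r th + g r * partial c F t r th.
Proof.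
  intros Hg HF. destruct (partial_radial g g' c t r th Hg) as [E <-].
  apply (partial_fmult c (radial g) F t r th E HF).
Qed.

Lemma partial_lowered c i j t r th : a < r < b ->
  partial c (lowered f k i j) t r th =
  (match c with cr => lowering' f f1 i j r | _ => 0 end) * k i j t r th
    + lowering f i j r * partial c (k i j) t r th.
Proof.
  intros Hr. apply partial_radial_mult.
  - apply (derive_lowering a b f f1 f2); auto; lra.
  - apply (bg_ex_partial a b 0); auto.
Qed.

Ltac expand_christoffel Hr :=
  unfold christoffel_variation, christoffel_of, sum3;
  rewrite !(partial_static_metric a b f f1 f2), !partial_lowered by auto;
  unfold lowering, lowering', static_metric', inverse_static; simpl.

(** This and the next four are, up to symmetry, the undifferentiated components that survive in
    [metric_identity]; the derivatives of [k] in them are what [metric_flux] absorbs. *)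
Lemma christoffel_variation_ttr t r th : a < r < b ->
  Gam' ct ct cr t r th = (f1 r * k ct ct t r th + f r * partial cr (k ct ct) t r th) / 2.
Proof.
  intros Hr. destruct (slab_neq0 r Hr). expand_christoffel Hr.
  rewrite (k_sym cr ct). field; auto.
Qed.

Lemma christoffel_variation_thrth t r th : a < r < b ->
  Gam' cth cth cr t r th =
  - (r * k cth cth t r th) - r ^ 2 * partial cr (k cth cth) t r th / 2.
Proof.
  intros Hr. destruct (slab_neq0 r Hr). expand_christoffel Hr.
  rewrite (k_sym cr cth). field; auto.
Qed.

Lemma christoffel_variation_rrr t r th : a < r < b ->
  Gam' cr cr cr t r th =
  (f1 r * k cr cr t r th / f r ^ 2 - partial cr (k cr cr) t r th / f r) / 2.
Proof. intros Hr. destruct (slab_neq0 r Hr). expand_christoffel Hr. field; auto. Qed.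

Lemma christoffel_variation_rtt t r th : a < r < b ->
  Gam' cr ct ct t r th =
  (f1 r * k cr cr t r th + 2 * f r * partial ct (k ct cr) t r th
   + 2 * f r ^ 2 * f1 r * k ct ct t r th + f r ^ 3 * partial cr (k ct ct) t r th) / 2.
Proof.
  intros Hr. destruct (slab_neq0 r Hr). expand_christoffel Hr.
  rewrite (k_sym cr ct). field; auto.
Qed.

Lemma christoffel_variation_rthth t r th : a < r < b ->
  Gam' cr cth cth t r th =
  - (r * k cr cr t r th) - r ^ 2 * partial cth (k cr cth) t r th
  + f r * (4 * r ^ 3 * k cth cth t r th + r ^ 4 * partial cr (k cth cth) t r th) / 2.
Proof.
  intros Hr. destruct (slab_neq0 r Hr). expand_christoffel Hr.
  field; auto.
Qed.

Lemma bg_christoffel_variation i j l : bg a b 1 (Gam' i j l).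
Proof. apply (pert_bg1 a b 1 _ _ _ (pert_christoffel_vary i j l)). Qed.

Lemma christoffel_variation_sym i j l t r th : a < r < b ->
  Gam' i j l t r th = Gam' i l j t r th.
Proof.
  intros Hr. destruct (slab_neq0 r Hr).
  unfold christoffel_variation, christoffel_of, sum3.
  assert (E : forall i j, static_metric f i j = static_metric f j i) by now destruct i0, j0.
  assert (E' : forall i j, lowered f k i j = lowered f k j i).
  { intros i' j'. unfold lowered, lowering. rewrite (k_sym i' j').
    repeat (apply functional_extensionality; intro). ring. }
  rewrite (E l j), (E' l j). ring.
Qed.

End Metric.

(** * Moments of the couplings *)

(* With X = p^2 / r^2, the radial coefficients of the first variation are linear in
   the sums of beta_m L^(2m+2) X^(m+1) m^i and of alpha_n L^(2n-2) X^n n^i, which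
   d/dr maps to each other. *)
Definition beta_moment (T : theory) (p : R) (i : nat) (r : R) : R :=
  sum_n_m (fun m => beta T m * L T ^ (2 * (m + 1)) * (p ^ 2 / r ^ 2) ^ (m + 1) * INR m ^ i)
    0 (M T).

Definition alpha_moment (T : theory) (p : R) (i : nat) (r : R) : R :=
  sum_n_m (fun n => alpha T n * L T ^ (2 * (n - 1)) * (p ^ 2 / r ^ 2) ^ n * INR n ^ i)
    1 (Defs.N T).

(** Three moments occur together in [Q_variation_background]; shorter combinations are padded with
    zero terms. *)
Lemma sum_n_m_lin3 (x y z : nat -> R) (c d e : R) i j :
  sum_n_m (fun m => c * x m + d * y m + e * z m) i j =
  c * sum_n_m x i j + d * sum_n_m y i j + e * sum_n_m z i j.
Proof.
  rewrite (sum_n_m_plus (fun m => c * x m + d * y m) (fun m => e * z m)).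
  rewrite (sum_n_m_plus (fun m => c * x m) (fun m => d * y m)).
  rewrite (sum_n_m_mult_l c x), (sum_n_m_mult_l d y), (sum_n_m_mult_l e z). reflexivity.
Qed.

Lemma is_derive_sum_n_m (F F' : nat -> R -> R) x i j :
  (forall m, (i <= m <= j)%nat -> is_derive (F m) x (F' m x)) ->
  is_derive (fun r => sum_n_m (fun m => F m r) i j) x (sum_n_m (fun m => F' m x) i j).
Proof.
  induction j as [|j IH]; intros H.
  - destruct i as [|i].
    + rewrite sum_n_n. eapply is_derive_ext; [|apply H; lia].
      intros r. simpl. now rewrite sum_n_n.
    + rewrite sum_n_m_zero by lia. eapply is_derive_ext; [|apply (@is_derive_const R_AbsRing R_NormedModule zero)].
      intros r. simpl. now rewrite sum_n_m_zero by lia.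
  - destruct (Compare_dec.le_lt_dec i (S j)) as [Hij|Hij].
    + rewrite sum_n_Sm by assumption.
      eapply is_derive_ext; [|apply (is_derive_plus (V := R_NormedModule));
        [apply IH; intros; apply H; lia|apply (H (S j)); lia]].
      intros r. simpl. now rewrite sum_n_Sm.
    + rewrite sum_n_m_zero by assumption. eapply is_derive_ext; [|apply (@is_derive_const R_AbsRing R_NormedModule zero)].
      intros r. simpl. now rewrite sum_n_m_zero.
Qed.

Ltac as_real := match goal with |- @eq _ ?x ?y => change (@eq R x y) end.

Lemma is_derive_value (f : R -> R) (x l l' : R) :
  l = l' -> is_derive f x l -> is_derive f x l'.
Proof. now intros ->. Qed.

Section Couplings.
Variables (T : theory) (p : R).

(** [r d/dr] multiplies [X ^ n] by [- 2 n], so that differentiating a moment only raises the power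
    of the index. *)
Lemma derive_power_ratio n r : r <> 0 ->
  is_derive (fun r => (p ^ 2 / r ^ 2) ^ n) r (- 2 * INR n / r * (p ^ 2 / r ^ 2) ^ n).
Proof.
  intros Hr. assert (H2 : r ^ 2 <> 0) by now apply pow_nonzero.
  destruct n as [|n].
  - simpl. replace (-2 * 0 / r * 1) with 0 by (field; auto). apply (@is_derive_const R_AbsRing R_NormedModule).
  - assert (E : is_derive (fun r => p ^ 2 / r ^ 2) r (- 2 * p ^ 2 / r ^ 3)).
    { auto_derive; [exact H2|field; auto]. }
    replace (- 2 * INR (S n) / r * (p ^ 2 / r ^ 2) ^ S n) with
      (INR (S n) * (- 2 * p ^ 2 / r ^ 3) * (p ^ 2 / r ^ 2) ^ pred (S n))
      by (simpl pred; rewrite <- !tech_pow_Rmult; field; auto).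
    apply (is_derive_pow (fun r => p ^ 2 / r ^ 2)). exact E.
Qed.

(** The exponent of [X] is [m + 1], so the factor [- 2 (m + 1)] splits into the moments [i] and
    [S i]. *)
Lemma derive_beta_moment i r : r <> 0 ->
  is_derive (beta_moment T p i) r
    (- 2 / r * (beta_moment T p i r + beta_moment T p (S i) r)).
Proof.
  intros Hr.
  set (t j m := beta T m * L T ^ (2 * (m + 1)) * (p ^ 2 / r ^ 2) ^ (m + 1) * INR m ^ j).
  replace (- 2 / r * _) with
    (sum_n_m (fun m => - 2 * INR (m + 1) / r * t i m) 0 (M T)).
  2:{ transitivity (sum_n_m (fun m => - 2 / r * t i m + - 2 / r * t (S i) m + 0 * t i m) 0 (M T)).
      - apply sum_n_m_ext; intros m. rewrite plus_INR. unfold t; simpl. as_real. field; auto.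
      - rewrite sum_n_m_lin3. unfold beta_moment. fold (t i) (t (S i)).
        change (fun m => beta T m * L T ^ (2 * (m + 1)) * (p ^ 2 / r ^ 2) ^ (m + 1) * INR m ^ i)
          with (t i).
        change (fun m => beta T m * L T ^ (2 * (m + 1)) * (p ^ 2 / r ^ 2) ^ (m + 1) * INR m ^ S i)
          with (t (S i)). as_real. ring. }
  apply (is_derive_sum_n_m
    (fun m r => beta T m * L T ^ (2 * (m + 1)) * (p ^ 2 / r ^ 2) ^ (m + 1) * INR m ^ i)
    (fun m r => - 2 * INR (m + 1) / r *
      (beta T m * L T ^ (2 * (m + 1)) * (p ^ 2 / r ^ 2) ^ (m + 1) * INR m ^ i))).
  intros m _.
  apply (is_derive_value _ _ (beta T m * L T ^ (2 * (m + 1)) * INR m ^ i *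
     (- 2 * INR (m + 1) / r * (p ^ 2 / r ^ 2) ^ (m + 1)))); [field; auto|].
  eapply is_derive_ext; [|apply (is_derive_scal (fun r => (p ^ 2 / r ^ 2) ^ (m + 1)));
    apply (derive_power_ratio (m + 1) r Hr)].
  intros s. simpl. ring.
Qed.

Lemma derive_alpha_moment i r : r <> 0 ->
  is_derive (alpha_moment T p i) r (- 2 / r * alpha_moment T p (S i) r).
Proof.
  intros Hr.
  set (t j m := alpha T m * L T ^ (2 * (m - 1)) * (p ^ 2 / r ^ 2) ^ m * INR m ^ j).
  replace (- 2 / r * _) with
    (sum_n_m (fun m => - 2 * INR m / r * t i m) 1 (Defs.N T)).
  2:{ transitivity (sum_n_m (fun m => - 2 / r * t (S i) m + 0 * t i m + 0 * t i m) 1 (Defs.N T)).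
      - apply sum_n_m_ext; intros m. unfold t; simpl. as_real. field; auto.
      - rewrite sum_n_m_lin3. unfold alpha_moment.
        change (fun n => alpha T n * L T ^ (2 * (n - 1)) * (p ^ 2 / r ^ 2) ^ n * INR n ^ S i)
          with (t (S i)). as_real. ring. }
  apply (is_derive_sum_n_m
    (fun m r => alpha T m * L T ^ (2 * (m - 1)) * (p ^ 2 / r ^ 2) ^ m * INR m ^ i)
    (fun m r => - 2 * INR m / r *
      (alpha T m * L T ^ (2 * (m - 1)) * (p ^ 2 / r ^ 2) ^ m * INR m ^ i))).
  intros m _.
  apply (is_derive_value _ _ (alpha T m * L T ^ (2 * (m - 1)) * INR m ^ i *
     (- 2 * INR m / r * (p ^ 2 / r ^ 2) ^ m))); [field; auto|].
  eapply is_derive_ext; [|apply (is_derive_scal (fun r => (p ^ 2 / r ^ 2) ^ m));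
    apply (derive_power_ratio m r Hr)].
  intros s. simpl. ring.
Qed.

(** Restores the power lost in differentiating [X ^ n]. At [n = 0] both sides vanish by [INR 0],
    whatever the truncated exponent. *)
Lemma power_ratio_shift n r : r <> 0 ->
  INR n * (p ^ 2 / r ^ 2) ^ (n - 1) * p ^ 2 = r ^ 2 * INR n * (p ^ 2 / r ^ 2) ^ n.
Proof.
  intros Hr. destruct n as [|n]; [simpl; ring|].
  replace (S n - 1)%nat with n by lia. rewrite <- (tech_pow_Rmult (p ^ 2 / r ^ 2)). generalize ((p ^ 2 / r ^ 2) ^ n). intros. field; auto.
Qed.

(** The factor [p ^ 2] taken out of the scalars supplies the power that turns [X ^ m] into the
    [X ^ (m + 1)] of the moments; no division by [p] occurs, so [p = 0] is not special. *)
Lemma Q_of_background (X C K : field) (c t r th : R) : r <> 0 ->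
  X t r th = p ^ 2 / r ^ 2 -> C t r th = p ^ 2 * c ->
  Q_of T X C K t r th = alpha_moment T p 0 r
    - ((3 * r ^ 2 * c - K t r th) * beta_moment T p 0 r
       + 2 * r ^ 2 * c * beta_moment T p 1 r).
Proof.
  intros Hr HX HC. unfold Q_of. rewrite HX, HC. apply f_equal2.
  - apply sum_n_m_ext; intros n. simpl; as_real; ring.
  - transitivity (sum_n_m (fun m =>
      (3 * r ^ 2 * c - K t r th) *
        (beta T m * L T ^ (2 * (m + 1)) * (p ^ 2 / r ^ 2) ^ (m + 1) * INR m ^ 0)
      + 2 * r ^ 2 * c *
        (beta T m * L T ^ (2 * (m + 1)) * (p ^ 2 / r ^ 2) ^ (m + 1) * INR m ^ 1)
      + 0 * 0) 0 (M T)).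
    + apply sum_n_m_ext; intros m. rewrite (pow_add (p ^ 2 / r ^ 2) m 1).
      generalize ((p ^ 2 / r ^ 2) ^ m) (L T ^ (2 * (m + 1))). intros. as_real. field; auto.
    + rewrite sum_n_m_lin3. unfold beta_moment. as_real. ring.
Qed.

Lemma Q_variation_background (X C K X' C' K' : field) (c c' x' t r th : R) : r <> 0 ->
  X t r th = p ^ 2 / r ^ 2 -> C t r th = p ^ 2 * c ->
  X' t r th = p ^ 2 * x' -> C' t r th = p ^ 2 * c' ->
  Q_variation T X C K X' C' K' t r th =
    r ^ 2 * x' * alpha_moment T p 1 r
    - ((3 * r ^ 2 * c' - r ^ 2 * x' * K t r th - K' t r th) * beta_moment T p 0 r
       + (x' * (3 * r ^ 4 * c - r ^ 2 * K t r th) + 2 * r ^ 2 * c') * beta_moment T p 1 r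
       + 2 * x' * r ^ 4 * c * beta_moment T p 2 r).
Proof.
  intros Hr HX HC HX' HC'. unfold Q_variation. rewrite HX, HC, HX', HC'. apply f_equal2.
  - transitivity (sum_n_m (fun n => r ^ 2 * x' *
      (alpha T n * L T ^ (2 * (n - 1)) * (p ^ 2 / r ^ 2) ^ n * INR n ^ 1)
      + 0 * 0 + 0 * 0) 1 (Defs.N T)).
    + apply sum_n_m_ext; intros n.
      replace (INR n * (p ^ 2 / r ^ 2) ^ (n - 1) * (p ^ 2 * x')) with
        (r ^ 2 * INR n * (p ^ 2 / r ^ 2) ^ n * x')
        by (rewrite <- power_ratio_shift by auto; ring).
      as_real. ring.
    + rewrite sum_n_m_lin3. unfold alpha_moment. as_real. ring.
  - transitivity (sum_n_m (fun m =>
      (3 * r ^ 2 * c' - r ^ 2 * x' * K t r th - K' t r th) *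
        (beta T m * L T ^ (2 * (m + 1)) * (p ^ 2 / r ^ 2) ^ (m + 1) * INR m ^ 0)
      + (x' * (3 * r ^ 4 * c - r ^ 2 * K t r th) + 2 * r ^ 2 * c') *
        (beta T m * L T ^ (2 * (m + 1)) * (p ^ 2 / r ^ 2) ^ (m + 1) * INR m ^ 1)
      + 2 * x' * r ^ 4 * c *
        (beta T m * L T ^ (2 * (m + 1)) * (p ^ 2 / r ^ 2) ^ (m + 1) * INR m ^ 2)) 0 (M T)).
    + apply sum_n_m_ext; intros m.
      replace (INR m * (p ^ 2 / r ^ 2) ^ (m - 1) * (p ^ 2 * x')) with
        (r ^ 2 * INR m * (p ^ 2 / r ^ 2) ^ m * x')
        by (rewrite <- power_ratio_shift by auto; ring).
      rewrite (pow_add (p ^ 2 / r ^ 2) m 1).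
      generalize ((p ^ 2 / r ^ 2) ^ m) (L T ^ (2 * (m + 1))). intros. as_real. field; auto.
    + rewrite sum_n_m_lin3. unfold beta_moment. as_real. ring.
Qed.

End Couplings.

(** * The first order term as a divergence *)

Section Identity.
Variables (a b : R) (f f1 f2 : R -> R).
Hypotheses (ha : 0 < a) (hab : a <= b).
Hypothesis f_neq0 : forall r, a <= r <= b -> f r <> 0.
Hypothesis f_derive : forall r, a <= r <= b -> is_derive f r (f1 r).
Hypothesis f1_derive : forall r, a <= r <= b -> is_derive f1 r (f2 r).
Hypothesis f2_continuous : forall r, a <= r <= b -> continuous f2 r.
Variables (T : theory) (p : R).
Variable k : tensor2.
Hypothesis k_bg : forall n i j, bg a b n (k i j).
Hypothesis k_sym : forall i j, k i j = k j i.

Notation S0 := (beta_moment T p 0).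
Notation S1 := (beta_moment T p 1).
Notation S2 := (beta_moment T p 2).
Notation S3 := (beta_moment T p 3).
Notation P0 := (alpha_moment T p 0).
Notation P1 := (alpha_moment T p 1).

Let Gam := christoffel_of (inverse_static f) (static_metric f).
Let Gam' := christoffel_variation (inverse_static f) k (static_metric f) (lowered f k).
Let Ric := ricci_of Gam.
Let Ric' := ricci_variation Gam Gam'.

(* r W^aa, where W^ab is the coefficient of R_ab in the Lagrangian *)
Definition weight (i : coord) (r : R) : R :=
  match i with
  | ct => - (r * (1 - S0 r) / f r)
  | cr => r * (1 - S0 r) * f r
  | cth => (1 + 2 * S0 r + 2 * S1 r) / r
  end.

Definition weight' (i : coord) (r : R) : R :=
  match i with
  | ct => - ((1 - S0 r) + 2 * (S0 r + S1 r)) / f r + r * (1 - S0 r) * f1 r / f r ^ 2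
  | cr => ((1 - S0 r) + 2 * (S0 r + S1 r)) * f r + r * (1 - S0 r) * f1 r
  | cth => - (1 + 6 * S0 r + 10 * S1 r + 4 * S2 r) / r ^ 2
  end.

(* coefficient of k^aa in the radial flux left once the derivatives of the
   varied connection are integrated by parts *)
Definition flux (i : coord) (r : R) : R :=
  match i with
  | ct => f r ^ 2 * (S0 r + 2 * S1 r) / 2
  | cr => (3 * S0 r + 2 * S1 r) / 2
  | cth => f r * r ^ 2 * (- S0 r + 4 * S1 r + 4 * S2 r) / 2
  end.

Definition flux' (i : coord) (r : R) : R :=
  match i with
  | ct => f r * f1 r * (S0 r + 2 * S1 r) - f r ^ 2 * (S0 r + 3 * S1 r + 2 * S2 r) / r
  | cr => - (3 * S0 r + 5 * S1 r + 2 * S2 r) / r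
  | cth => (f1 r * r ^ 2 + 2 * r * f r) * (- S0 r + 4 * S1 r + 4 * S2 r) / 2
      - f r * r * (- S0 r + 3 * S1 r + 8 * S2 r + 4 * S3 r)
  end.

Lemma r_bounds r : a <= r <= b -> r <> 0.
Proof. intros; lra. Qed.

Ltac derive_moments r Hr :=
  let Hf := fresh in let H0 := fresh in let Hp := fresh in
  let D := fresh in let D0 := fresh in let D1 := fresh in let D2 := fresh in
  pose proof (f_derive r Hr) as Hf;
  pose proof (f_neq0 r Hr) as H0; pose proof (r_bounds r Hr) as Hp;
  assert (D : Derive (fun x => f x) r = f1 r) by exact (is_derive_unique _ _ _ Hf);
  pose proof (derive_beta_moment T p 0 r Hp) as D0;
  pose proof (derive_beta_moment T p 1 r Hp) as D1;
  pose proof (derive_beta_moment T p 2 r Hp) as D2;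
  assert (E0 : Derive (fun x => S0 x) r = _) by exact (is_derive_unique _ _ _ D0);
  assert (E1 : Derive (fun x => S1 x) r = _) by exact (is_derive_unique _ _ _ D1);
  assert (E2 : Derive (fun x => S2 x) r = _) by exact (is_derive_unique _ _ _ D2);
  auto_derive;
  [ repeat split; auto; eexists; eassumption
  | rewrite ?D, ?E0, ?E1, ?E2; field; auto ].

Lemma derive_weight i r : a <= r <= b -> is_derive (weight i) r (weight' i r).
Proof. intros Hr. unfold weight. destruct i; simpl; derive_moments r Hr. Qed.

Lemma derive_flux i r : a <= r <= b -> is_derive (flux i) r (flux' i r).
Proof. intros Hr. unfold flux. destruct i; simpl; derive_moments r Hr. Qed.

(** Separates the derivatives of the varied connection, to be matched with [connection_flux], from
    the terms linear in it, whose coefficients are static Christoffel symbols. *)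
Lemma ricci_variation_tt t r th : a < r < b ->
  Ric' ct ct t r th =
  sum3 (fun c => partial c (Gam' c ct ct) t r th)
  - sum3 (fun c => partial ct (Gam' c ct c) t r th)
  + (Gam' ct ct cr t r th + Gam' cr cr cr t r th + Gam' cth cth cr t r th) * (f r * f1 r / 2)
  + Gam' cr ct ct t r th / r
  - (Gam' cr ct ct t r th * f1 r / f r + Gam' ct ct cr t r th * f r * f1 r).
Proof.
  intros Hr. assert (Hr' : a <= r <= b) by lra.
  pose proof (f_neq0 r Hr'). pose proof (r_bounds r Hr').
  unfold Ric', ricci_variation, sum3, Gam.
  rewrite !(christoffel_static_correct a b f f1 f2) by auto.
  unfold radial, christoffel_static.
  fold Gam'. field; auto.
Qed.

Lemma ricci_variation_rr t r th : a < r < b ->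
  Ric' cr cr t r th =
  sum3 (fun c => partial c (Gam' c cr cr) t r th)
  - sum3 (fun c => partial cr (Gam' c cr c) t r th)
  - (Gam' ct ct cr t r th + Gam' cr cr cr t r th + Gam' cth cth cr t r th)
      * (f1 r / (2 * f r))
  + Gam' cr cr cr t r th / r
  - 2 * (Gam' ct ct cr t r th * f1 r / (2 * f r) - Gam' cr cr cr t r th * f1 r / (2 * f r)
      + Gam' cth cth cr t r th / r).
Proof.
  intros Hr. assert (Hr' : a <= r <= b) by lra.
  pose proof (f_neq0 r Hr'). pose proof (r_bounds r Hr').
  unfold Ric', ricci_variation, sum3, Gam.
  rewrite !(christoffel_static_correct a b f f1 f2) by auto.
  unfold radial, christoffel_static.
  fold Gam'.
  pose proof (christoffel_variation_sym a b f ha f_neq0 k k_sym ct cr ct t r th Hr) as E1.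
  pose proof (christoffel_variation_sym a b f ha f_neq0 k k_sym cth cr cth t r th Hr) as E2.
  fold Gam' in E1, E2. rewrite E1, E2.
  field; auto.
Qed.

Lemma ricci_variation_thth t r th : a < r < b ->
  Ric' cth cth t r th =
  sum3 (fun c => partial c (Gam' c cth cth) t r th)
  - sum3 (fun c => partial cth (Gam' c cth c) t r th)
  - (Gam' ct ct cr t r th + Gam' cr cr cr t r th + Gam' cth cth cr t r th) * (r * f r)
  + Gam' cr cth cth t r th / r
  - 2 * (Gam' cr cth cth t r th / r - Gam' cth cth cr t r th * (r * f r)).
Proof.
  intros Hr. assert (Hr' : a <= r <= b) by lra.
  pose proof (f_neq0 r Hr'). pose proof (r_bounds r Hr').
  unfold Ric', ricci_variation, sum3, Gam.
  rewrite !(christoffel_static_correct a b f f1 f2) by auto.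
  unfold radial, christoffel_static.
  fold Gam'. field; auto.
Qed.

(** The Palatini current [W^{ab} Gam'^c_{ab} - W^{cb} Gam'^d_{bd}] for diagonal [W], the volume
    factor r being part of the weights. *)
Definition connection_flux (c : coord) : field := fun t r th =>
  sum3 (fun i => weight i r * Gam' c i i t r th)
  + (- weight c r) * sum3 (fun d => Gam' d c d t r th).

(** Once the divergence of [connection_flux] is subtracted, the remaining derivatives of [k] are
    those of k^tr along t, of k^aa along r and of k^rth along theta; the entries are their
    coefficients. *)
Definition metric_flux (c : coord) : field := fun t r th =>
  match c with
  | ct => 2 * (S0 r + S1 r) * k ct cr t r th
  | cr => sum3 (fun i => flux i r * k i i t r th)
  | cth => - 4 * (S0 r + 2 * S1 r + S2 r) * k cr cth t r th
  end.

Lemma partial_sum3 c (F : coord -> field) t r th :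
  (forall i, ex_partial c (F i) t r th) ->
  ex_partial c (fun t r th => sum3 (fun i => F i t r th)) t r th /\
  partial c (fun t r th => sum3 (fun i => F i t r th)) t r th =
  sum3 (fun i => partial c (F i) t r th).
Proof.
  intros H. destruct (partial_fplus c (F ct) (F cr) t r th (H ct) (H cr)) as [E1 E2].
  destruct (partial_fplus c _ (F cth) t r th E1 (H cth)) as [E3 E4].
  split; [exact E3|]. unfold sum3. rewrite <- E2. exact E4.
Qed.

Lemma ex_partial_radial_mult g g' F c t r th : is_derive g r g' ->
  ex_partial c F t r th -> ex_partial c (fun t r th => g r * F t r th) t r th.
Proof.
  intros Hg HF. destruct (partial_radial g g' c t r th Hg) as [E _].
  apply (partial_fmult c (radial g) F t r th E HF).
Qed.

Lemma ex_partial_variation c i j l t r th : a < r < b -> ex_partial c (Gam' i j l) t r th.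
Proof.
  intros Hr. apply (bg_ex_partial a b 0); auto.
  now apply (bg_christoffel_variation a b f f1 f2).
Qed.

(** The weights depend on r alone, so their derivatives appear for [cr] only; these terms combine
    with the linear ones of [ricci_variation_tt] and its companions. *)
Lemma partial_connection_flux c t r th : a < r < b ->
  partial c (connection_flux c) t r th =
  sum3 (fun i => (match c with cr => weight' i r | _ => 0 end) * Gam' c i i t r th
    + weight i r * partial c (Gam' c i i) t r th)
  - ((match c with cr => weight' c r | _ => 0 end) * sum3 (fun d => Gam' d c d t r th)
    + weight c r * sum3 (fun d => partial c (Gam' d c d) t r th)).
Proof.
  intros Hr. assert (Hr' : a <= r <= b) by lra.
  assert (D := fun i => derive_weight i r Hr').
  assert (DN : is_derive (fun r => - weight c r) r (- weight' c r))
    by (apply (is_derive_opp (weight c)), D).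
  destruct (partial_sum3 c (fun i t r th => weight i r * Gam' c i i t r th) t r th)
    as [E1 E2].
  { intros i. apply ex_partial_radial_mult with (weight' i r); auto.
    now apply ex_partial_variation. }
  destruct (partial_sum3 c (fun d => Gam' d c d) t r th) as [E3 E4].
  { intros d. now apply ex_partial_variation. }
  destruct (partial_fplus c _ _ t r th E1 (ex_partial_radial_mult _ _ _ c t r th DN E3))
    as [_ E5].
  unfold connection_flux. refine (eq_trans E5 _). rewrite E2.
  rewrite (partial_radial_mult _ _ _ c t r th DN E3), E4.
  unfold Rminus. apply f_equal2.
  - unfold sum3. now rewrite !(partial_radial_mult _ _ _ c t r th (D _)) by
      now apply ex_partial_variation.
  - destruct c; ring.
Qed.

Lemma partial_metric_flux c t r th : a < r < b ->
  partial c (metric_flux c) t r th =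
  match c with
  | ct => 2 * (S0 r + S1 r) * partial ct (k ct cr) t r th
  | cr => sum3 (fun i => flux' i r * k i i t r th + flux i r * partial cr (k i i) t r th)
  | cth => - 4 * (S0 r + 2 * S1 r + S2 r) * partial cth (k cr cth) t r th
  end.
Proof.
  intros Hr. assert (Hr' : a <= r <= b) by lra.
  assert (E : forall c i j, ex_partial c (k i j) t r th)
    by (intros; apply (bg_ex_partial a b 0); auto).
  destruct c.
  - apply (Derive_scal (fun s => k ct cr s r th)).
  - assert (D := fun i => derive_flux i r Hr').
    destruct (partial_sum3 cr (fun i t r th => flux i r * k i i t r th) t r th) as [E1 E2].
    { intros i. apply ex_partial_radial_mult with (flux' i r); auto. }
    refine (eq_trans E2 _). unfold sum3.
    now rewrite !(partial_radial_mult _ _ _ cr t r th (D _)) by auto.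
  - apply (Derive_scal (fun s => k cr cth t r s)).
Qed.

(** For [D = 1 + S0 + 2 S1] the rule for moments gives [D' = - 2 / r (S0 + 3 S1 + 2 S2)], so the
    left side is [(D f)']. Applying the rule once more yields the coefficients of [ode']. *)
Hypothesis ode : forall r, a <= r <= b ->
  (1 + S0 r + 2 * S1 r) * f1 r - 2 / r * (S0 r + 3 * S1 r + 2 * S2 r) * f r
  = 2 * r / L T ^ 2 - r * P0 r.
Hypothesis ode' : forall r, a <= r <= b ->
  (1 + S0 r + 2 * S1 r) * f2 r - 4 / r * (S0 r + 3 * S1 r + 2 * S2 r) * f1 r
  + (2 / r ^ 2 * (S0 r + 3 * S1 r + 2 * S2 r)
     + 4 / r ^ 2 * (S0 r + 4 * S1 r + 5 * S2 r + 2 * S3 r)) * f r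
  = 2 / L T ^ 2 - P0 r + 2 * P1 r.

Let K := trace_of (inverse_static f) Ric.
Let K' : field := fun t r th => trace_of k Ric t r th + trace_of (inverse_static f) Ric' t r th.
Let s' : field := fun t r th => - / 2 * r *
      (sum3 (fun i => static_metric f i i t r th * k i i t r th)).

(** [c], [c'] and [x'] are, up to the factor [p ^ 2], the Ricci term, its variation and the
    variation of the kinetic term; the left side is the first order Lagrangian without its
    prefactor. *)
Lemma metric_identity t r th : a < r < b ->
  let c := Ric cth cth t r th / r ^ 4 in
  let c' := Ric' cth cth t r th / r ^ 4 + 2 * Ric cth cth t r th * k cth cth t r th / r ^ 2 in
  let x' := k cth cth t r th in
  s' t r th * (K t r th + 2 / L T ^ 2 - (P0 r
    - ((3 * r ^ 2 * c - K t r th) * S0 r + 2 * r ^ 2 * c * S1 r)))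
  + r * (K' t r th - (r ^ 2 * x' * P1 r
    - ((3 * r ^ 2 * c' - r ^ 2 * x' * K t r th - K' t r th) * S0 r
       + (x' * (3 * r ^ 4 * c - r ^ 2 * K t r th) + 2 * r ^ 2 * c') * S1 r
       + 2 * x' * r ^ 4 * c * S2 r)))
  = sum3 (fun c => partial c (connection_flux c) t r th + partial c (metric_flux c) t r th).
Proof.
  intros Hr. assert (Hr' : a <= r <= b) by lra.
  pose proof (f_neq0 r Hr') as Hf0. pose proof (r_bounds r Hr') as Hr0.
  pose proof (ode r Hr') as O1. pose proof (ode' r Hr') as O2.
  (* [P0] comes from the variation of the volume, [P1] from that of the kinetic term and hence with
     k^thth only. Solving both equations for them leaves an identity free of alpha. *)
  assert (E0 : P0 r = 2 / L T ^ 2 - ((1 + S0 r + 2 * S1 r) * f1 r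
    - 2 / r * (S0 r + 3 * S1 r + 2 * S2 r) * f r) / r).
  { rewrite O1. field. split; auto. apply Rgt_not_eq, L_gt0. }
  rewrite E0 in O2.
  assert (E1 : P1 r = ((1 + S0 r + 2 * S1 r) * f2 r
    - 4 / r * (S0 r + 3 * S1 r + 2 * S2 r) * f1 r
    + (2 / r ^ 2 * (S0 r + 3 * S1 r + 2 * S2 r)
     + 4 / r ^ 2 * (S0 r + 4 * S1 r + 5 * S2 r + 2 * S3 r)) * f r
    - ((1 + S0 r + 2 * S1 r) * f1 r
    - 2 / r * (S0 r + 3 * S1 r + 2 * S2 r) * f r) / r) / 2) by lra.
  clear O1 O2. cbv zeta. rewrite E0, E1. clear E0 E1.
  assert (HR : forall i j, Ric i j t r th = ricci_static f f1 f2 i j r)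
    by (intros; now apply (ricci_static_correct a b f f1 f2)).
  assert (HK : K t r th = - f2 r - 2 * f1 r / r).
  { unfold K, trace_of, sum3. rewrite !HR. simpl. field; auto. }
  assert (HK' : K' t r th = k ct ct t r th * ricci_static f f1 f2 ct ct r
    + k cr cr t r th * ricci_static f f1 f2 cr cr r
    + k cth cth t r th * ricci_static f f1 f2 cth cth r
    - Ric' ct ct t r th / f r + f r * Ric' cr cr t r th + Ric' cth cth t r th / r ^ 2).
  { unfold K', trace_of, sum3. rewrite !HR. simpl. field; auto. }
  rewrite HK', HK, !HR. clear HK HK' HR.
  rewrite ricci_variation_tt, ricci_variation_rr, ricci_variation_thth by auto.
  unfold sum3. rewrite !partial_connection_flux, !partial_metric_flux by auto.
  unfold s', sum3.
  pose proof (christoffel_variation_sym a b f ha f_neq0 k k_sym ct cr ct t r th Hr) as E1.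
  pose proof (christoffel_variation_sym a b f ha f_neq0 k k_sym cth cr cth t r th Hr) as E2.
  pose proof (christoffel_variation_ttr a b f f1 f2 ha f_neq0 f_derive f1_derive
    k k_bg k_sym t r th Hr) as G1.
  pose proof (christoffel_variation_thrth a b f f1 f2 ha f_neq0 f_derive f1_derive
    k k_bg k_sym t r th Hr) as G2.
  pose proof (christoffel_variation_rrr a b f f1 f2 ha f_neq0 f_derive f1_derive
    k k_bg t r th Hr) as G3.
  pose proof (christoffel_variation_rtt a b f f1 f2 ha f_neq0 f_derive f1_derive
    k k_bg k_sym t r th Hr) as G4.
  pose proof (christoffel_variation_rthth a b f f1 f2 ha f_neq0 f_derive f1_derive
    k k_bg t r th Hr) as G5.
  fold Gam' in E1, E2, G1, G2, G3, G4, G5.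
  rewrite E1, E2, G1, G2, G3, G4, G5.
  clear E1 E2 G1 G2 G3 G4 G5.
  unfold weight, weight', flux, flux'. simpl ricci_static. simpl static_metric.
  (* From here on the components and derivatives of [k] and of the varied connection are independent
     indeterminates: the identity is one of rational functions. *)
  repeat match goal with
  | |- context [partial ?c (Gam' ?i ?j ?l) t r th] =>
      generalize (partial c (Gam' i j l) t r th); intro
  | |- context [partial ?c (k ?i ?j) t r th] =>
      generalize (partial c (k i j) t r th); intro
  | |- context [k ?i ?j t r th] => generalize (k i j t r th); intro
  | |- context [Gam' ?i ?j ?l t r th] => generalize (Gam' i j l t r th); intro
  end.
  assert (HL : L T <> 0) by apply Rgt_not_eq, L_gt0.
  revert HL Hf0 Hr0.
  generalize (S0 r) (S1 r) (S2 r) (S3 r) (f r) (f1 r) (f2 r) (L T). intros.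
  field; auto.
Qed.

End Identity.

(** * Vanishing of the first variations *)

Definition angular_gradient (p : R) (i : coord) : field :=
  match i with cth => fconst p | _ => fconst 0 end.

Lemma partial_angular_scalar p i t r th :
  partial i (angular_scalar p) t r th = angular_gradient p i t r th.
Proof.
  destruct i; simpl.
  - exact (Derive_const (p * th) t).
  - exact (Derive_const (p * th) r).
  - unfold angular_scalar, fconst. rewrite Derive_scal, Derive_id. ring.
Qed.

Lemma ex_partial_angular_scalar p i t r th : ex_partial i (angular_scalar p) t r th.
Proof.
  destruct i; simpl.
  - exact (@ex_derive_const R_AbsRing R_NormedModule (p * th) t).
  - exact (@ex_derive_const R_AbsRing R_NormedModule (p * th) r).
  - unfold angular_scalar. now auto_derive.
Qed.

Section Variations.
Variables (a b : R) (B : box).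
Hypotheses (ht : t0 B <= t1 B) (hr : r0 B <= r1 B) (hth : th0 B <= th1 B).
Hypotheses (har : a < r0 B) (hrb : r1 B < b).

(** Continuity is bundled in because linearity of the iterated integral is established for
    continuous fields. *)
Definition null (F : field) : Prop := slab a b continuous3 F /\ box_integral B F = 0.

Lemma null_lin F F' c : null F -> null F' -> null (fun t r th => F t r th + c * F' t r th).
Proof.
  intros [C Z] [C' Z']. split.
  - intros t r th Hr. apply (continuous_plus (V := R_NormedModule)); [apply C; auto|].
    apply (continuous_mult (K := R_AbsRing)); [apply continuous_const|apply C'; auto].
  - rewrite <- (box_integral_clamped B ht hr hth).
    (* Clamping commutes with pointwise operations by definition. *)
    transitivity (box_integral B (fun t r th => clamped B F t r th + c * clamped B F' t r th)).
    { reflexivity. }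
    rewrite box_integral_lin; auto; try (apply (clamped_continuous a b); auto).
    rewrite !box_integral_clamped by auto. rewrite Z, Z'. ring.
Qed.

Lemma null_ext F F' : (forall t r th, F t r th = F' t r th) -> null F -> null F'.
Proof.
  intros H [C Z]. split.
  - apply (continuous3_slab a b F); auto. intros t r th _; auto.
  - rewrite <- Z. apply box_integral_ext; auto.
Qed.

Lemma null_plus F F' : null F -> null F' -> null (fun t r th => F t r th + F' t r th).
Proof.
  intros H H'. eapply null_ext; [|apply (null_lin F F' 1 H H')].
  intros; simpl; ring.
Qed.

Lemma null_scal c F : null F -> null (fun t r th => c * F t r th).
Proof.
  intros H. eapply null_ext; [|apply (null_lin F F (c - 1) H H)].
  intros; simpl; ring.
Qed.

Lemma null_divergence F c : supported a b B F -> bg a b 1 F -> null (partial c F).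
Proof.
  intros HF HB. split.
  - apply (bg_continuous3 a b 0). now apply bg_partial.
  - now apply (box_integral_divergence a b).
Qed.

(** [w] may be arbitrary: the innermost integral, over theta, is already zero for every t and r. *)
Lemma box_integral_angular (w : R -> R) psi : test_function B psi ->
  box_integral B (fun t r th => w r * partial cth psi t r th) = 0.
Proof.
  intros [Hs H0]. unfold box_integral.
  rewrite <- (RInt_zero (t0 B) (t1 B)). apply RInt_ext; intros t _.
  rewrite <- (RInt_zero (r0 B) (r1 B)). apply RInt_ext; intros r _.
  assert (C : forall t r th, continuous3 psi t r th) by (intros; apply (Hs nil)).
  assert (C' : forall t r th, continuous3 (partial cth psi) t r th)
    by (intros; apply (Hs (cons cth nil))).
  destruct (continuous3_slice B hr hth _ C') as (C1 & _).
  transitivity (w r * RInt (fun th => partial cth psi t r th) (th0 B) (th1 B)).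
  { apply (RInt_scal (fun th => partial cth psi t r th)).
    apply (@ex_RInt_continuous R_CompleteNormedModule). intros; apply C1. }
  rewrite (RInt_derive_vanishing (fun th => psi t r th)); [apply Rmult_0_r| | | |].
  - intros th. apply Derive_correct, (Hs nil t r th) with (c := cth).
  - intros th; apply C1.
  - apply (vanishes_on_faces B psi cth); auto.
  - apply (vanishes_on_faces B psi cth); auto.
Qed.

Variables (f f1 f2 : R -> R).
Hypotheses (ha : 0 < a) (hab : a <= b).
Hypothesis f_neq0 : forall r, a <= r <= b -> f r <> 0.
Hypothesis f_derive : forall r, a <= r <= b -> is_derive f r (f1 r).
Hypothesis f1_derive : forall r, a <= r <= b -> is_derive f1 r (f2 r).
Hypothesis f2_continuous : forall r, a <= r <= b -> continuous f2 r.
Variables (T : theory) (p : R).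

Notation S0 := (beta_moment T p 0).
Notation S1 := (beta_moment T p 1).
Notation S2 := (beta_moment T p 2).
Notation S3 := (beta_moment T p 3).
Notation P0 := (alpha_moment T p 0).
Notation P1 := (alpha_moment T p 1).
Notation h := (inverse_static f).
Notation g := (static_metric f).
Notation Gam := (christoffel_of h g).
Notation Ric := (ricci_of Gam).
Notation dphi := (angular_gradient p).

Lemma kinetic_background t r th : a < r < b ->
  quadratic_of h dphi dphi t r th = p ^ 2 / r ^ 2.
Proof.
  intros Hr. assert (r <> 0) by lra. assert (f r <> 0) by (apply f_neq0; lra).
  unfold quadratic_of, sum3; simpl. unfold fconst. field; auto.
Qed.

Lemma ricci_gradient_background t r th : a < r < b ->
  quadratic_of Ric (raise_of h dphi) (raise_of h dphi) t r th
  = p ^ 2 * (Ric cth cth t r th / r ^ 4).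
Proof.
  intros Hr. assert (r <> 0) by lra. assert (f r <> 0) by (apply f_neq0; lra).
  unfold quadratic_of, raise_of, sum3; simpl. unfold fconst. field; auto.
Qed.

Lemma bg_dphi i : bg a b 0 (dphi i).
Proof. destruct i; apply bg_const. Qed.

Section MetricVariation.
Variable k : tensor2.
Hypothesis k_test : forall i j, test_function B (k i j).
Hypothesis k_sym : forall i j, k i j = k j i.

Notation q := (lowered f k).
Notation Gam' := (christoffel_variation h k g q).
Notation Ric' := (ricci_variation Gam Gam').

Let k_bg : forall n i j, bg a b n (k i j).
Proof. intros n i j. apply (bg_test_function a b B); auto. Qed.

Lemma supported_mult g' F : supported a b B F ->
  supported a b B (fun t r th => g' r * F t r th).
Proof. intros H t r th Hr Hb. rewrite H by auto. ring. Qed.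

Lemma supported_christoffel_variation i j l : supported a b B (Gam' i j l).
Proof.
  assert (Hk : forall i j, supported a b B (k i j)).
  { intros i' j' t r th _. apply k_test. }
  assert (Hq : forall i j, supported a b B (q i j)).
  { intros i' j'. now apply supported_mult. }
  intros t r th Hr Hb. unfold christoffel_variation, christoffel_of, sum3.
  rewrite !Hk by auto.
  rewrite !(supported_partial a b B (q _ _) _ (Hq _ _)) by auto. ring.
Qed.

Lemma ex_derive_f r : a <= r <= b -> ex_derive f r.
Proof. intros Hr; eexists; apply f_derive, Hr. Qed.

Lemma ex_derive_f1 r : a <= r <= b -> ex_derive f1 r.
Proof. intros Hr; eexists; apply f1_derive, Hr. Qed.

Lemma ex_derive_beta_moment i r : a <= r <= b -> ex_derive (beta_moment T p i) r.
Proof. intros Hr; eexists; apply derive_beta_moment; lra. Qed.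

Ltac continuous_radial Hr :=
  apply (ex_derive_continuous (V := R_NormedModule)); auto_derive;
  repeat split; auto using f_neq0, ex_derive_f, ex_derive_f1, ex_derive_beta_moment;
  try lra; try (apply Rmult_integral_contrapositive; split; auto; try lra).

Lemma bg_weight i : bg a b 1 (radial (weight f T p i)).
Proof.
  apply (bg_radial_S a b hab 0 _ (weight' f f1 T p i)).
  - intros r Hr. now apply (derive_weight a b f f1).
  - apply bg_radial0; auto. intros r Hr. assert (Hr0 : r <> 0) by lra.
    unfold weight'. destruct i; continuous_radial Hr.
Qed.

Lemma bg_flux i : bg a b 1 (radial (flux f T p i)).
Proof.
  apply (bg_radial_S a b hab 0 _ (flux' f f1 T p i)).
  - intros r Hr. now apply (derive_flux a b f f1).
  - apply bg_radial0; auto. intros r Hr. assert (Hr0 : r <> 0) by lra.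
    unfold flux'. destruct i; continuous_radial Hr.
Qed.

Lemma bg_moment i : bg a b 1 (radial (beta_moment T p i)).
Proof.
  apply (bg_radial_S a b hab 0 _
    (fun r => - 2 / r * (beta_moment T p i r + beta_moment T p (S i) r))).
  - intros r Hr. apply derive_beta_moment; lra.
  - apply bg_radial0; auto. intros r Hr. assert (Hr0 : r <> 0) by lra.
    continuous_radial Hr.
Qed.

Lemma null_connection_flux c : null (partial c (connection_flux f T p k c)).
Proof.
  assert (Hb : forall i j l, bg a b 1 (Gam' i j l)).
  { intros. now apply (bg_christoffel_variation a b f f1 f2). }
  apply null_divergence.
  - intros t r th Hr Hbx. unfold connection_flux, sum3.
    rewrite !supported_christoffel_variation by auto. ring.
  - apply bg_plus.
    + exact (bg_plus _ _ _ _ _ (bg_plus _ _ _ _ _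
        (bg_mult _ _ _ _ _ (bg_weight ct) (Hb c ct ct))
        (bg_mult _ _ _ _ _ (bg_weight cr) (Hb c cr cr)))
        (bg_mult _ _ _ _ _ (bg_weight cth) (Hb c cth cth))).
    + apply (bg_mult a b 1 (radial (fun r => - weight f T p c r))).
      * eapply bg_ext; [|apply (bg_mult a b 1 _ _ (bg_const a b 1 (-1)) (bg_weight c))].
        intros t r th _. unfold fconst, radial. ring.
      * apply bg_plus; [apply bg_plus|]; apply Hb.
Qed.

Lemma null_metric_flux c : null (partial c (metric_flux f T p k c)).
Proof.
  apply null_divergence.
  - intros t r th Hr Hbx. destruct c; unfold metric_flux, sum3;
      rewrite !(proj2 (k_test _ _)) by auto; ring.
  - destruct c.
    + eapply bg_ext; [|apply (bg_mult a b 1 _ _ (bg_const a b 1 2)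
        (bg_mult a b 1 _ _ (bg_plus a b 1 _ _ (bg_moment 0) (bg_moment 1)) (k_bg 1 ct cr)))].
      intros t r th _. unfold metric_flux, fconst, radial. ring.
    + exact (bg_plus _ _ _ _ _ (bg_plus _ _ _ _ _
        (bg_mult _ _ _ _ _ (bg_flux ct) (k_bg 1 ct ct))
        (bg_mult _ _ _ _ _ (bg_flux cr) (k_bg 1 cr cr)))
        (bg_mult _ _ _ _ _ (bg_flux cth) (k_bg 1 cth cth))).
    + eapply bg_ext; [|apply (bg_mult a b 1 _ _ (bg_const a b 1 (-4))
        (bg_mult a b 1 _ _ (bg_plus a b 1 _ _ (bg_moment 0)
          (bg_plus a b 1 _ _ (bg_moment 1) (bg_plus a b 1 _ _ (bg_moment 1) (bg_moment 2))))
          (k_bg 1 cr cth)))].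
      intros t r th _. unfold metric_flux, fconst, radial. ring.
Qed.

Hypothesis ode : forall r, a <= r <= b ->
  (1 + S0 r + 2 * S1 r) * f1 r - 2 / r * (S0 r + 3 * S1 r + 2 * S2 r) * f r
  = 2 * r / L T ^ 2 - r * P0 r.
Hypothesis ode' : forall r, a <= r <= b ->
  (1 + S0 r + 2 * S1 r) * f2 r - 4 / r * (S0 r + 3 * S1 r + 2 * S2 r) * f1 r
  + (2 / r ^ 2 * (S0 r + 3 * S1 r + 2 * S2 r)
     + 4 / r ^ 2 * (S0 r + 4 * S1 r + 5 * S2 r + 2 * S3 r)) * f r
  = 2 / L T ^ 2 - P0 r + 2 * P1 r.

Lemma metric_variation_vanishes :
  is_derive (fun e => action T B (vary_metric g k e) (angular_scalar p)) 0 0.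
Proof.
  destruct (pert_lagrangian a b T (fun e => vary_metric g k e) (fun _ => angular_scalar p)
    (radial (fun r => r))
    (fun t r th => - / 2 * r * (sum3 (fun i => g i i t r th * k i i t r th)))
    g q h k dphi (fun _ => fconst 0)) as [L0 HL0].
  - now apply (pert_sqrt_determinant a b f f1 f2).
  - intros i j. now apply (pert_vary_metric a b f f1 f2).
  - intros i j. apply pert_pred. now apply (pert_inverse_vary_metric a b f f1 f2).
  (* The gradient of phi carries lower indices and does not see the metric, so its first order
     coefficient is zero. *)
  - intros i. eapply pert_ext; [| | |apply (bg_dphi i)].
    + apply near_all. intros e t r th _. symmetry. apply partial_angular_scalar.
    + intros t r th _; reflexivity.
    + intros t r th _; reflexivity.
  - pose proof (is_derive_box_integral a b B ht hr hth har hrb _ _ _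
      (pert_first_order _ _ _ _ _ _ HL0)) as D.
    eapply is_derive_value; [|exact D].
    assert (Z : forall c, null (fun t r th => partial c (connection_flux f T p k c) t r th
        + partial c (metric_flux f T p k c) t r th)).
    { intros c. exact (null_plus _ _ (null_connection_flux c) (null_metric_flux c)). }
    pose proof (null_scal (/ (16 * PI * G T)) _
      (null_plus _ _ (null_plus _ _ (Z ct) (Z cr)) (Z cth))) as [_ N].
    refine (eq_trans _ N). apply box_integral_ext; auto. clear N Z D.
    intros t r th (_ & Hrb & _). assert (Hr : a < r < b) by lra.
    assert (Hr0 : r <> 0) by lra.
    apply f_equal.
    (* What remains is to rewrite both [Q] terms in the moments in which the identity is stated. *)
    etransitivity; [|exact (metric_identity a b f f1 f2 ha hab f_neq0 f_derive f1_derive f2_continuous T p k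
      k_bg k_sym ode ode' t r th Hr)]. cbv zeta.
    rewrite (Q_of_background T p _ _ _ (Ric cth cth t r th / r ^ 4)); auto.
    2: now apply kinetic_background.
    2: now apply ricci_gradient_background.
    rewrite (Q_variation_background T p _ _ _ _ _ _ (Ric cth cth t r th / r ^ 4)
      (Ric' cth cth t r th / r ^ 4 + 2 * Ric cth cth t r th * k cth cth t r th / r ^ 2)
      (k cth cth t r th)); auto.
    + now apply kinetic_background.
    + now apply ricci_gradient_background.
    + unfold quadratic_of, sum3; simpl. unfold fconst. ring.
    + assert (HR : forall i j, Ric i j t r th = ricci_static f f1 f2 i j r)
        by (intros; now apply (ricci_static_correct a b f f1 f2)).
      unfold quadratic_of, raise_of. unfold sum3. rewrite !HR. simpl. unfold fconst.
      assert (f r <> 0) by (apply f_neq0; lra). field; auto.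
Qed.

End MetricVariation.

(** With the metric fixed, the first order terms are proportional to the theta derivative of psi,
    here [y]. Constant fields taken at the origin exhibit the other factor as a function of the
    zeroth order values and of [x'], [c']. *)
Lemma Q_variation_scal (X C K X' C' K' : field) (X0 C0 K0 x' c' y t r th : R) :
  X t r th = X0 -> C t r th = C0 -> K t r th = K0 ->
  X' t r th = y * x' -> C' t r th = y * c' -> K' t r th = 0 ->
  Q_variation T X C K X' C' K' t r th =
  y * Q_variation T (fconst X0) (fconst C0) (fconst K0) (fconst x') (fconst c') (fconst 0) 0 0 0.
Proof.
  intros HX HC HK HX' HC' HK'. unfold Q_variation. rewrite HX, HC, HK, HX', HC', HK'.
  unfold fconst. rewrite Rmult_minus_distr_l.
  apply f_equal2.
  - rewrite <- (sum_n_m_mult_l (K := R_AbsRing)). apply sum_n_m_ext; intros n.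
    as_real. unfold mult; simpl. ring.
  - rewrite <- (sum_n_m_mult_l (K := R_AbsRing)). apply sum_n_m_ext; intros n.
    as_real. unfold mult; simpl. ring.
Qed.

Lemma bg_static_metric i j : bg a b 2 (g i j).
Proof.
  pose proof (bg_f a b f f1 f2 hab f_derive f1_derive f2_continuous) as Hf.
  pose proof (bg_inv_radial a b hab 2 f Hf (f_continuous a b f f1 f_derive) f_neq0) as Hi.
  pose proof (bg_const a b 2 0) as Z.
  destruct i, j; [|exact Z|exact Z|exact Z|exact Hi|exact Z|exact Z|exact Z|].
  - eapply bg_ext; [|apply (bg_mult a b 2 _ _ (bg_const a b 2 (-1)) Hf)].
    intros t r th _. unfold fconst, radial; simpl; ring.
  - exact (bg_sqr a b hab 2).
Qed.

Lemma sqrt_determinant_static t r th : a < r < b ->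
  sqrt (- determinant g t r th) = r.
Proof.
  intros Hr. rewrite determinant_static by (apply f_neq0; lra).
  rewrite Ropp_involutive. apply sqrt_pow2; lra.
Qed.

Lemma christoffel_variation_zero i j l :
  eq_slab a b (christoffel_variation h (fun _ _ => fconst 0) g (fun _ _ => fconst 0) i j l)
    (fconst 0).
Proof.
  intros t r th _. unfold christoffel_variation, christoffel_of, sum3.
  rewrite !(proj2 (partial_fconst _ 0 t r th)). unfold fconst. ring.
Qed.

Lemma ricci_variation_zero i j t r th : a < r < b ->
  ricci_variation Gam (christoffel_variation h (fun _ _ => fconst 0) g (fun _ _ => fconst 0))
    i j t r th = 0.
Proof.
  intros Hr. unfold ricci_variation, sum3.
  rewrite !(partial_slab a b _ _ _ (christoffel_variation_zero _ _ _)) by auto.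
  rewrite !christoffel_variation_zero by auto.
  rewrite !(proj2 (partial_fconst _ 0 t r th)). unfold fconst. ring.
Qed.

Lemma scalar_variation_vanishes psi : test_function B psi ->
  is_derive (fun e => action T B g (vary_scalar (angular_scalar p) psi e)) 0 0.
Proof.
  intros Hpsi.
  assert (psi_bg : forall n, bg a b n psi) by (intros n; now apply (bg_test_function a b B)).
  destruct (pert_lagrangian a b T (fun _ => g) (vary_scalar (angular_scalar p) psi)
    (radial (fun r => r)) (fconst 0) g (fun _ _ => fconst 0) h (fun _ _ => fconst 0)
    dphi (fun i => partial i psi)) as [L0 HL0].
  - eapply pert_ext; [| | |apply (bg_id a b hab 0)].
    + apply near_all. intros e t r th Hr. symmetry. now apply sqrt_determinant_static.
    + intros t r th _; reflexivity.
    + intros t r th _; reflexivity.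
  - intros i j. apply bg_static_metric.
  - intros i j. eapply pert_ext; [| | |apply pert_pred,
      (bg_inverse_static a b f f1 f2 ha hab f_neq0 f_derive f1_derive f2_continuous i j)].
    + apply near_all. intros e t r th Hr. symmetry.
      apply inverse_static_correct; [apply f_neq0|]; lra.
    + intros t r th _; reflexivity.
    + intros t r th _; reflexivity.
  - intros i. eapply pert_ext; [| | |apply (pert_affine a b 0 (dphi i) (partial i psi));
      [apply bg_dphi|apply bg_partial, psi_bg]].
    + apply near_all. intros e t r th Hr.
      destruct (partial_fconst i e t r th) as [K1 K2].
      assert (E : ex_partial i psi t r th) by (apply (bg_ex_partial a b 0); auto).
      destruct (partial_fmult i (fconst e) psi t r th K1 E) as [M1 M2].
      destruct (partial_fplus i (angular_scalar p) (fmult (fconst e) psi) t r th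
        (ex_partial_angular_scalar p i t r th) M1) as [_ N].
      symmetry. refine (eq_trans N _). rewrite M2, K2, partial_angular_scalar.
      unfold fconst; ring.
    + intros t r th _; reflexivity.
    + intros t r th _; reflexivity.
  - pose proof (is_derive_box_integral a b B ht hr hth har hrb _ _ _
      (pert_first_order _ _ _ _ _ _ HL0)) as D.
    eapply is_derive_value; [|exact D]. clear D HL0.
    (* [2 * p / r ^ 2] and [2 * p * R_thth / r ^ 4] are the derivatives of the kinetic and the Ricci
       term with respect to the theta component of the gradient; the factor r is the volume. *)
    set (w := fun r => / (16 * PI * G T) * (r * - Q_variation T (fconst (p ^ 2 / r ^ 2))
      (fconst (p ^ 2 * (ricci_static f f1 f2 cth cth r / r ^ 4)))
      (fconst (- f2 r - 2 * f1 r / r)) (fconst (2 * p / r ^ 2))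
      (fconst (2 * p * ricci_static f f1 f2 cth cth r / r ^ 4)) (fconst 0) 0 0 0)).
    refine (eq_trans _ (box_integral_angular w psi Hpsi)). apply box_integral_ext; auto.
    intros t r th (_ & Hrb & _). assert (Hr : a < r < b) by lra.
    assert (Hr0 : r <> 0) by lra. assert (Hf0 : f r <> 0) by (apply f_neq0; lra).
    assert (HR : forall i j, Ric i j t r th = ricci_static f f1 f2 i j r)
      by (intros; now apply (ricci_static_correct a b f f1 f2)).
    assert (HK : forall h', trace_of h' (ricci_variation Gam (christoffel_variation h
      (fun _ _ => fconst 0) g (fun _ _ => fconst 0))) t r th = 0).
    { intros h'. unfold trace_of, sum3. rewrite !ricci_variation_zero by auto. ring. }
    assert (HK0 : forall S, trace_of (fun _ _ => fconst 0) S t r th = 0).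
    { intros S. unfold trace_of, sum3, fconst. ring. }
    rewrite (Q_variation_scal _ _ _ _ _ _ (p ^ 2 / r ^ 2)
      (p ^ 2 * (ricci_static f f1 f2 cth cth r / r ^ 4))
      (- f2 r - 2 * f1 r / r) (2 * p / r ^ 2)
      (2 * p * ricci_static f f1 f2 cth cth r / r ^ 4) (partial cth psi t r th)).
    + rewrite HK, HK0. unfold w. unfold fconst at 1. unfold radial. ring.
    + now apply kinetic_background.
    + rewrite <- HR. now apply ricci_gradient_background.
    + unfold trace_of, sum3. rewrite !HR. simpl. field; auto.
    + unfold quadratic_of, sum3. simpl angular_gradient. simpl inverse_static.
      unfold fconst. field; auto.
    + unfold quadratic_of, raise_of. unfold sum3. rewrite !HR, !ricci_variation_zero by auto.
      simpl angular_gradient. simpl inverse_static. simpl ricci_static. unfold fconst.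
      field; auto.
    + rewrite HK, HK0. ring.
Qed.

End Variations.

(** * The solution *)

Section Solution.
Variables (T : theory) (p mu : R).

Notation S0 := (beta_moment T p 0).
Notation S1 := (beta_moment T p 1).
Notation S2 := (beta_moment T p 2).
Notation S3 := (beta_moment T p 3).
Notation P0 := (alpha_moment T p 0).
Notation P1 := (alpha_moment T p 1).

Lemma power_ratio_even n r : r <> 0 -> (p ^ 2 / r ^ 2) ^ n = p ^ (2 * n) / r ^ (2 * n).
Proof.
  intros Hr. rewrite !pow_mult. unfold Rdiv. rewrite Rpow_mult_distr, pow_inv. reflexivity.
Qed.

(** The factor [2 m + 1] splits into the moments 0 and 1. *)
Lemma f_denominator_moments r : r <> 0 -> f_denominator T p r = 1 + S0 r + 2 * S1 r.
Proof.
  intros Hr. unfold f_denominator. rewrite Rplus_assoc. apply f_equal.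
  transitivity (sum_n_m (fun m =>
      1 * (beta T m * L T ^ (2 * (m + 1)) * (p ^ 2 / r ^ 2) ^ (m + 1) * INR m ^ 0)
      + 2 * (beta T m * L T ^ (2 * (m + 1)) * (p ^ 2 / r ^ 2) ^ (m + 1) * INR m ^ 1)
      + 0 * 0) 0 (M T)).
  - apply sum_n_m_ext; intros m. rewrite power_ratio_even by auto.
    assert (r ^ (2 * (m + 1)) <> 0) by now apply pow_nonzero.
    generalize dependent (r ^ (2 * (m + 1))). generalize (p ^ (2 * (m + 1))).
    intros. as_real. field; auto.
  - rewrite sum_n_m_lin3. unfold beta_moment. as_real. ring.
Qed.

(** Each term with [n >= 2] is a primitive of [- r] times the alpha term of index [n]; the logarithm
    plays this part for [n = 1], where the power law would divide by zero. *)
Lemma derive_f_numerator r : 0 < r ->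
  is_derive (f_numerator T p mu) r (2 * r / L T ^ 2 - r * P0 r).
Proof.
  intros Hr. pose proof (L_gt0 T) as HL.
  set (F' n r := - r * (alpha T n * L T ^ (2 * (n - 1)) * (p ^ 2 / r ^ 2) ^ n * INR n ^ 0)).
  assert (D1 : is_derive (fun r => r ^ 2 / L T ^ 2 - mu - alpha T 1 * p ^ 2 * ln (r / L T)) r
    (2 * r / L T ^ 2 - alpha T 1 * p ^ 2 / r)).
  { auto_derive.
    - repeat split; auto. apply Rdiv_lt_0_compat; auto.
    - field; split; lra. }
  assert (D2 : is_derive (fun r => sum_n_m (fun n => alpha T n * p ^ (2 * n) * L T ^ (2 * (n - 1)) /
      (2 * INR (n - 1) * r ^ (2 * (n - 1)))) 2 (Defs.N T)) r
    (sum_n_m (fun n => F' n r) 2 (Defs.N T))).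
  { apply is_derive_sum_n_m. intros n Hn.
    destruct n as [|[|n]]; [lia|lia|].
    replace (S (S n) - 1)%nat with (S n) by lia.
    unfold F'. rewrite power_ratio_even by lra.
    replace (S (S n) - 1)%nat with (S n) by lia.
    replace (2 * S (S n))%nat with (2 + 2 * S n)%nat by lia. rewrite !pow_add.
    assert (Hp : r ^ (2 * S n) <> 0) by (apply pow_nonzero; lra).
    assert (HS : INR (S n) <> 0) by (apply not_0_INR; lia).
    assert (D : is_derive (fun r => r ^ (2 * S n)) r (2 * INR (S n) * (r ^ (2 * S n) / r))).
    { eapply is_derive_value; [|apply (is_derive_pow (fun r => r) (2 * S n) r 1),
        (@is_derive_id R_AbsRing)].
      rewrite mult_INR. replace (2 * S n)%nat with (S (pred (2 * S n))) at 2 by lia.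
      rewrite <- tech_pow_Rmult. simpl (INR 2). field; lra. }
    set (c := alpha T (S (S n)) * (p ^ 2 * p ^ (2 * S n)) * L T ^ (2 * S n)).
    eapply is_derive_value;
      [|apply (is_derive_scal (fun r => / (2 * INR (S n) * r ^ (2 * S n))) r c),
        (is_derive_inv (fun r => 2 * INR (S n) * r ^ (2 * S n))),
        Rmult_integral_contrapositive;
        [apply (is_derive_scal (fun r => r ^ (2 * S n))), D|split; auto; lra]].
    unfold c. generalize dependent (r ^ (2 * S n)).
    generalize (p ^ (2 * S n)) (L T ^ (2 * S n)) (INR (S n)) HS. intros.
    simpl. field. repeat split; auto; lra. }
  eapply is_derive_value; [|exact (is_derive_plus (V := R_NormedModule) _ _ _ _ _ D1 D2)].
  unfold plus; simpl.
  assert (E : sum_n_m (fun n => F' n r) 1 (Defs.N T) = - r * P0 r).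
  { unfold F', alpha_moment. exact (sum_n_m_mult_l (K := R_AbsRing) (- r) _ _ _). }
  unfold Rminus at 2. rewrite Ropp_mult_distr_l, <- E.
  (* If the truncation bound is 0, the coefficient [alpha T 1] of the logarithm vanishes by
     [alpha_finite]; otherwise the logarithm supplies the term of index 1 missing from the sum. *)
  destruct (Defs.N T) as [|n] eqn:HN.
  - rewrite !sum_n_m_zero by lia. rewrite (alpha_finite T 1) by lia.
    unfold zero; simpl. field; split; lra.
  - rewrite (sum_Sn_m _ 1) by lia. unfold plus; simpl. unfold F' at 2. simpl. as_real.
    rewrite Rmult_1_r. field; split; lra.
Qed.

(** Obtained by solving the equation for [(D f)'], not from the quotient rule: [f_solution_ode]
    becomes pure algebra, and the calculus is confined to [derive_f_solution]. Likewise for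
    [f_solution'']. *)
Definition f_solution' (r : R) : R :=
  (2 * r / L T ^ 2 - r * P0 r + 2 / r * (S0 r + 3 * S1 r + 2 * S2 r) * f_solution T p mu r)
  / (1 + S0 r + 2 * S1 r).

Definition f_solution'' (r : R) : R :=
  (2 / L T ^ 2 - P0 r + 2 * P1 r + 4 / r * (S0 r + 3 * S1 r + 2 * S2 r) * f_solution' r
   - (2 / r ^ 2 * (S0 r + 3 * S1 r + 2 * S2 r)
     + 4 / r ^ 2 * (S0 r + 4 * S1 r + 5 * S2 r + 2 * S3 r)) * f_solution T p mu r)
  / (1 + S0 r + 2 * S1 r).

Lemma locally_pos r : 0 < r -> locally r (fun s => 0 < s).
Proof. intros Hr. apply (open_gt 0); auto. Qed.

Section Point.
Variable r : R.
Hypotheses (Hr : 0 < r) (Hd : f_denominator T p r <> 0).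

Lemma moments_neq0 : 1 + S0 r + 2 * S1 r <> 0.
Proof. rewrite <- f_denominator_moments by lra. exact Hd. Qed.

Lemma ex_derive_beta i : ex_derive (beta_moment T p i) r.
Proof. eexists; apply derive_beta_moment; lra. Qed.

Lemma ex_derive_alpha i : ex_derive (alpha_moment T p i) r.
Proof. eexists; apply derive_alpha_moment; lra. Qed.

Lemma Derive_beta i : Derive (fun x => beta_moment T p i x) r =
  - 2 / r * (beta_moment T p i r + beta_moment T p (S i) r).
Proof. apply is_derive_unique, derive_beta_moment; lra. Qed.

Lemma Derive_alpha i : Derive (fun x => alpha_moment T p i x) r =
  - 2 / r * alpha_moment T p (S i) r.
Proof. apply is_derive_unique, derive_alpha_moment; lra. Qed.

Lemma derive_f_solution : is_derive (f_solution T p mu) r (f_solution' r).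
Proof.
  pose proof moments_neq0 as H0. pose proof (L_gt0 T).
  apply (is_derive_ext_loc (fun r => f_numerator T p mu r / (1 + S0 r + 2 * S1 r))).
  { eapply filter_imp; [|apply (locally_pos r Hr)]. intros s Hs. unfold f_solution.
    rewrite f_denominator_moments by lra. reflexivity. }
  assert (D : Derive (fun x => f_numerator T p mu x) r = 2 * r / L T ^ 2 - r * P0 r)
    by now apply is_derive_unique, derive_f_numerator.
  auto_derive.
  - repeat split; auto using ex_derive_beta.
    eexists; now apply derive_f_numerator.
  - rewrite D, !Derive_beta. unfold f_solution', f_solution.
    rewrite f_denominator_moments by lra. field. repeat split; auto; lra.
Qed.

Lemma derive_f_solution' : is_derive f_solution' r (f_solution'' r).
Proof.
  pose proof moments_neq0 as H0. pose proof (L_gt0 T).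
  assert (D : Derive (fun x => f_solution T p mu x) r = f_solution' r)
    by apply is_derive_unique, derive_f_solution.
  unfold f_solution' at 1. auto_derive.
  - repeat split; auto using ex_derive_beta, ex_derive_alpha; try lra.
    eexists; apply derive_f_solution.
  - rewrite D, !Derive_beta, !Derive_alpha. unfold f_solution'', f_solution'.
    field. repeat split; auto; lra.
Qed.

Lemma continuous_f_solution'' : continuous f_solution'' r.
Proof.
  pose proof moments_neq0 as H0. pose proof (L_gt0 T).
  apply (ex_derive_continuous (V := R_NormedModule)). unfold f_solution''. auto_derive.
  repeat split; auto using ex_derive_beta, ex_derive_alpha; try lra;
    try (apply Rmult_integral_contrapositive; split; lra).
  - eexists; apply derive_f_solution'.
  - eexists; apply derive_f_solution.
Qed.

Lemma f_solution_ode :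
  (1 + S0 r + 2 * S1 r) * f_solution' r
    - 2 / r * (S0 r + 3 * S1 r + 2 * S2 r) * f_solution T p mu r
  = 2 * r / L T ^ 2 - r * P0 r.
Proof.
  pose proof moments_neq0 as H0. pose proof (L_gt0 T). unfold f_solution'.
  field. repeat split; auto; lra.
Qed.

Lemma f_solution_ode' :
  (1 + S0 r + 2 * S1 r) * f_solution'' r
    - 4 / r * (S0 r + 3 * S1 r + 2 * S2 r) * f_solution' r
  + (2 / r ^ 2 * (S0 r + 3 * S1 r + 2 * S2 r)
     + 4 / r ^ 2 * (S0 r + 4 * S1 r + 5 * S2 r + 2 * S3 r)) * f_solution T p mu r
  = 2 / L T ^ 2 - P0 r + 2 * P1 r.
Proof.
  pose proof moments_neq0 as H0. pose proof (L_gt0 T). unfold f_solution''.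
  field. repeat split; auto; lra.
Qed.

End Point.

(** Both the denominator and [f] are continuous where the denominator is nonzero. This provides the
    radial margin around a closed box. *)
Lemma regular_region_open t r th : regular_region T p mu t r th ->
  locally r (fun s => regular_region T p mu t s th).
Proof.
  intros (Hr & Hd & Hf).
  assert (nz : forall (g : R -> R), continuous g r -> g r <> 0 -> locally r (fun s => g s <> 0)).
  { intros g Hg H0. apply (Hg (fun y => y <> 0)). now apply (open_neq 0). }
  apply filter_and; [now apply locally_pos|apply filter_and].
  - assert (H : locally r (fun s => 1 + S0 s + 2 * S1 s <> 0)).
    { apply nz; [|now apply moments_neq0].
      apply (ex_derive_continuous (V := R_NormedModule)). auto_derive.
      repeat split; auto using ex_derive_beta. }
    eapply filter_imp; [|apply filter_and; [exact H|apply (locally_pos r Hr)]].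
    intros s [Hs Hs0]. rewrite f_denominator_moments by lra. exact Hs.
  - apply nz; auto. apply (ex_derive_continuous (V := R_NormedModule)).
    eexists; now apply derive_f_solution.
Qed.

End Solution.

Theorem mainTheorem16 (T : theory) (p mu : R) :
  solves_field_equations T (regular_region T p mu)
    (static_metric (f_solution T p mu)) (angular_scalar p).
Proof.
  (* The region is open in r and the same for all t and theta, so a closed box in it sits inside a
     closed interval of regular radii; halving the radii of openness keeps both new ends regular. *)
  assert (slab_of_box : forall B, box_in B (regular_region T p mu) ->
    exists a b, 0 < a /\ a < r0 B /\ r1 B < b /\
      forall r, a <= r <= b -> regular_region T p mu 0 r 0).
  { intros B (Ht & Hr & Hth & HB).
    assert (Hreg : forall r, r0 B <= r <= r1 B -> regular_region T p mu 0 r 0).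
    { intros r Hr'. apply (HB (t0 B) r (th0 B)). repeat split; lra. }
    destruct (regular_region_open T p mu 0 (r0 B) 0) as [d Hd]; [apply Hreg; lra|].
    destruct (regular_region_open T p mu 0 (r1 B) 0) as [d' Hd']; [apply Hreg; lra|].
    pose proof (cond_pos d). pose proof (cond_pos d').
    assert (Hlow : forall r, r0 B - d / 2 <= r <= r0 B -> regular_region T p mu 0 r 0).
    { intros r Hr'. apply Hd. change (Rabs (r - r0 B) < d).
      rewrite Rabs_left1; lra. }
    assert (Hhigh : forall r, r1 B <= r <= r1 B + d' / 2 -> regular_region T p mu 0 r 0).
    { intros r Hr'. apply Hd'. change (Rabs (r - r1 B) < d').
      rewrite Rabs_right; lra. }
    exists (r0 B - d / 2), (r1 B + d' / 2). repeat split; try lra.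
    - apply (Hlow (r0 B - d / 2)); lra.
    - destruct (Rlt_dec r (r0 B)); [apply Hlow; lra|].
      destruct (Rlt_dec (r1 B) r); [apply Hhigh; lra|]. apply Hreg; lra.
    - destruct (Rlt_dec r (r0 B)); [apply Hlow; lra|].
      destruct (Rlt_dec (r1 B) r); [apply Hhigh; lra|]. apply Hreg; lra.
    - destruct (Rlt_dec r (r0 B)); [apply Hlow; lra|].
      destruct (Rlt_dec (r1 B) r); [apply Hhigh; lra|]. apply Hreg; lra. }
  assert (zero_integral : forall B F, (forall t r th, F t r th = 0) -> box_integral B F = 0).
  { intros B F HF. unfold box_integral.
    rewrite <- (RInt_zero (t0 B) (t1 B)). apply RInt_ext; intros t _.
    rewrite <- (RInt_zero (r0 B) (r1 B)). apply RInt_ext; intros r _.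
    rewrite <- (RInt_zero (th0 B) (th1 B)). apply RInt_ext; intros th _. apply HF. }
  split.
  - intros B k HB Hk Hsym.
    destruct (slab_of_box B HB) as (a & b & Ha & Har & Hrb & Hreg).
    destruct HB as (Ht & Hr & Hth & _).
    rewrite zero_integral by (intros; unfold sum3; ring).
    apply (metric_variation_vanishes a b B) with (f1 := f_solution' T p mu)
      (f2 := f_solution'' T p mu); try lra; auto.
    + intros r Hr'. apply (Hreg r Hr').
    + intros r Hr'. apply derive_f_solution; apply (Hreg r Hr').
    + intros r Hr'. apply derive_f_solution'; apply (Hreg r Hr').
    + intros r Hr'. apply continuous_f_solution''; apply (Hreg r Hr').
    + intros i j. do 3 (apply functional_extensionality; intro). apply Hsym.
    + intros r Hr'. apply f_solution_ode; apply (Hreg r Hr').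
    + intros r Hr'. apply f_solution_ode'; apply (Hreg r Hr').
  - intros B psi HB Hpsi.
    destruct (slab_of_box B HB) as (a & b & Ha & Har & Hrb & Hreg).
    destruct HB as (Ht & Hr & Hth & _).
    rewrite zero_integral by (intros; ring).
    apply (scalar_variation_vanishes a b B) with (f1 := f_solution' T p mu)
      (f2 := f_solution'' T p mu); try lra; auto.
    + intros r Hr'. apply (Hreg r Hr').
    + intros r Hr'. apply derive_f_solution; apply (Hreg r Hr').
    + intros r Hr'. apply derive_f_solution'; apply (Hreg r Hr').
    + intros r Hr'. apply continuous_f_solution''; apply (Hreg r Hr').
Qed.
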